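(* Let $R$ be a commutative associative unital ring, $I\trianglelefteq R$ an ideal, and $l\geq 3$. The relative symplectic Steinberg group $\mathrm{StSp}_{2l}(R,I)$ (maximal form parameter $\Gamma=I$) can be defined, as an abstract group, by the set of generators $$\{(u,v,a,b)\mid u,v\in V,\ u\text{ is a column of a symplectic elementary matrix},\ \langle u,v\rangle=0,\ a,b\in I\}$$ and the following relations (imposed whenever all symbols involved are generators from this set): (T1) $(u,vr,a,b)=(u,v,ar,b)$ for any $r\in R$; (T2) $(u,v,a,b)(u,w,a,c)=(u,v+w,a,b+c+a^2\langle v,w\rangle)$; (T3) $(u,v,a,0)(u,v,b,0)=(u,v,a+b,0)$; (T4) $(u,v,a,0)=(v,u,a,0)$ if $v$ is also a column of a symplectic elementary matrix; (T5) $(u',v',a',b')(u,v,a,b)(u',v',a',b')^{-1}=(T(u',v'a',b')u,\,T(u',v'a',b')v,\,a,\,b)$; (T6) $(u,u,a,0)=(u,0,0,2a)$; (T7) $(u+vr,0,0,a)=(u,0,0,a)(v,0,0,ar^2)(v,u,ar,0)$ for $r\in R$, if $v$ and $u+vr$ are also columns of symplectic elementary matrices. Moreover, the isomorphism between $\mathrm{StSp}_{2l}(R,I)$ and the group so presented can be chosen so that the usual relative generators satisfy $$Y_{ij}(a)=(e_i,\,e_{-j},\,a\varepsilon_{-j},\,0)\ \text{ for } j\neq\pm i,\qquad Y_{i,-i}(a)=(e_i,\,0,\,0,\,a)\qquad(a\in I).$$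
   Context: $V=R^{2l}$ is the free right $R$-module with basis $e_{-l},\dots,e_{-1},e_1,\dots,e_l$; all indices range over $\{\pm1,\dots,\pm l\}$; $\varepsilon_i=\mathrm{sgn}(i)$; $\langle\ ,\ \rangle$ is the symplectic form with $\langle e_i,e_j\rangle=\varepsilon_i\delta_{i,-j}$; $\mathrm{Sp}_{2l}(R)$ is its isometry group. For $\langle u,v\rangle=0$, $a\in R$, $T(u,v,a)\in\mathrm{Sp}_{2l}(R)$ is $w\mapsto w+u(\langle v,w\rangle+a\langle u,w\rangle)+v\langle u,w\rangle$. Put $T_{ij}(a)=T(e_i,e_{-j}a\varepsilon_{-j},0)$ for $i\ne\pm j$ and $T_{i,-i}(a)=T(e_i,0,a)$. $\mathrm{Ep}_{2l}(R)$ is the normal subgroup of $\mathrm{Sp}_{2l}(R)$ generated by all $T_{ij}(a),T_{i,-i}(a)$, $a\in R$ (it equals the subgroup they generate). A column of a symplectic elementary matrix is a vector $fe_i$ with $f\in\mathrm{Ep}_{2l}(R)$. Commutators: $[x,y]=xyx^{-1}y^{-1}$. Absolute Steinberg group $\mathrm{StSp}_{2l}(R)$: generators $X_{ij}(r)$, $i\neq j$, $r\in R$; relations (for all indices for which the symbols make sense) (S0) $X_{ij}(r)=X_{-j,-i}(-r\varepsilon_i\varepsilon_j)$; (S1) $X_{ij}(r)X_{ij}(s)=X_{ij}(r+s)$; (S2) $[X_{ij}(r),X_{hk}(s)]=1$ for $h\notin\{j,-i\}$, $k\notin\{i,-j\}$; (S3) $[X_{ij}(r),X_{jk}(s)]=X_{ik}(rs)$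 for $i\notin\{-j,-k\}$, $j\neq-k$; (S4) $[X_{i,-i}(r),X_{-i,j}(s)]=X_{ij}(rs\varepsilon_i)X_{-j,j}(-rs^2)$; (S5) $[X_{ij}(r),X_{j,-i}(s)]=X_{i,-i}(2rs\varepsilon_i)$. Relative Steinberg group $\mathrm{StSp}_{2l}(R,I)$: a group with an action $h\mapsto{}^gh$ of $\mathrm{StSp}_{2l}(R)$, defined, as a group with action, by relative generators $Y_{ij}(a)$, $i\ne j$, $a\in I$, and the relations (for $r\in R$, $a,b\in I$ and all indices for which the symbols make sense) (KL0) $Y_{ij}(a)=Y_{-j,-i}(-a\varepsilon_i\varepsilon_j)$; (KL1) $Y_{ij}(a)Y_{ij}(b)=Y_{ij}(a+b)$; (KL2) ${}^{X_{ij}(r)}Y_{hk}(a)=Y_{hk}(a)$ for $h\notin\{j,-i\}$, $k\notin\{i,-j\}$; (KL3) ${}^{X_{ij}(r)}Y_{jk}(a)\cdot Y_{jk}(a)^{-1}=Y_{ik}(ra)$ for $i\notin\{-j,-k\}$, $j\ne-k$; (KL4) ${}^{X_{i,-i}(r)}Y_{-i,j}(a)\cdot Y_{-i,j}(a)^{-1}=Y_{ij}(ra\varepsilon_i)Y_{-j,j}(-ra^2)$; (KL5) $Y_{i,-i}(a)\cdot\big({}^{X_{-i,j}(r)}Y_{i,-i}(a)\big)^{-1}=Y_{ij}(ar\varepsilon_i)Y_{-j,j}(-ar^2)$; (KL6) ${}^{X_{ij}(r)}Y_{j,-i}(a)\cdot Y_{j,-i}(a)^{-1}=Y_{i,-i}(2ra\varepsilon_i)$;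 (KL7) ${}^{X_{ij}(a)}Y_{hk}(b)=Y_{ij}(a)Y_{hk}(b)Y_{ij}(a)^{-1}$. That is: take the free group on symbols $(g,x)$ with $g\in\mathrm{StSp}_{2l}(R)$ and $x$ a relative generator, with action ${}^f(g,x)=(fg,x)$, write ${}^gx$ for $(g,x)$, and factor out the smallest normal subgroup stable under the action containing KL0–KL7. *)

(* Defs.v *)
From HB Require Import structures.
From mathcomp Require Import all_boot all_order all_algebra.
From mathcomp Require Import boolp classical_sets ring.

Set Implicit Arguments.
Unset Strict Implicit.
Unset Printing Implicit Defensive.

Import GRing.Theory.

Local Open Scope classical_set_scope.
Local Open Scope quotient_scope.
Local Open Scope group_scope.

(* Presented groups are actual quotient types with Leibniz equality; this and  *)
(* the choiceType structure required by groupType are obtained classically.    *)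

Section QuotientGroup.
Variable G : groupType.

Record is_normal (N : set G) : Prop := IsNormal {
  normal1 : N 1;
  normalM : forall x y, N x -> N y -> N (x * y);
  normalV : forall x, N x -> N x^-1;
  normalJ : forall x g, N x -> N (g * x * g^-1) }.

Variables (N : set G) (hN : is_normal N).

Definition coset_rel (x y : G) : bool := `[< N (x / y) >].

Lemma coset_rel_refl : reflexive coset_rel.
Proof. by move=> x; apply/asboolP; rewrite divgg; exact: normal1. Qed.

Lemma coset_rel_sym : symmetric coset_rel.
Proof.
by move=> x y; apply/asboolP/asboolP => h; rewrite -invgF; apply: normalV.
Qed.

Lemma coset_rel_trans : transitive coset_rel.
Proof.
move=> y x z /asboolP xy /asboolP yz; apply/asboolP.
by have := normalM hN xy yz; rewrite mulgA mulgVK.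
Qed.

Canonical coset_equiv :=
  EquivRel coset_rel coset_rel_refl coset_rel_sym coset_rel_trans.

Definition quot_group := {eq_quot coset_equiv}.

HB.instance Definition _ := EqQuotient.on quot_group.
HB.instance Definition _ := Choice.on quot_group.

Definition quot_proj (x : G) : quot_group := \pi_quot_group x.

Lemma quot_projP x y : quot_proj x = quot_proj y <-> N (x / y).
Proof.
by split=> [/eqmodP/asboolP | h] //; apply/eqmodP/asboolP.
Qed.

Lemma quot_projK (a : quot_group) : quot_proj (repr a) = a.
Proof. exact: reprK. Qed.

Definition quot_one : quot_group := quot_proj 1.
Definition quot_mul (a b : quot_group) := quot_proj (repr a * repr b).
Definition quot_inv (a : quot_group) := quot_proj (repr a)^-1.

Lemma quot_mulE x y : quot_mul (quot_proj x) (quot_proj y) = quot_proj (x * y).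
Proof.
apply/quot_projP.
have /quot_projP hx := quot_projK (quot_proj x).
have /quot_projP hy := quot_projK (quot_proj y).
have := normalM hN (normalJ hN (repr (quot_proj x)) hy) hx.
by rewrite invgM !mulgA mulgVK.
Qed.

Lemma quot_invE x : quot_inv (quot_proj x) = quot_proj x^-1.
Proof.
apply/quot_projP.
have /quot_projP hx := quot_projK (quot_proj x).
have := normalJ hN (repr (quot_proj x))^-1 (normalV hN hx).
by rewrite invgF !invgK !mulgA mulgVK.
Qed.

Fact quot_mulA : associative quot_mul.
Proof.
move=> a b c; rewrite -(quot_projK a) -(quot_projK b) -(quot_projK c).
by rewrite !quot_mulE mulgA.
Qed.
Fact quot_mul1g : left_id quot_one quot_mul.
Proof. by move=> a; rewrite -(quot_projK a) quot_mulE mul1g. Qed.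
Fact quot_mulg1 : right_id quot_one quot_mul.
Proof. by move=> a; rewrite -(quot_projK a) quot_mulE mulg1. Qed.
Fact quot_mulVg : left_inverse quot_one quot_inv quot_mul.
Proof. by move=> a; rewrite -(quot_projK a) quot_invE quot_mulE mulVg. Qed.
Fact quot_mulgV : right_inverse quot_one quot_inv quot_mul.
Proof. by move=> a; rewrite -(quot_projK a) quot_invE quot_mulE mulgV. Qed.

HB.instance Definition _ := isGroup.Build quot_group
  quot_mulA quot_mul1g quot_mulg1 quot_mulVg quot_mulgV.

Fact quot_proj_gmulfM : {morph quot_proj : x y / x * y}.
Proof. by move=> x y; rewrite -quot_mulE. Qed.
Fact quot_proj_gmulf1 : quot_proj 1 = 1.
Proof. by []. Qed.
HB.instance Definition _ :=
  isMultiplicative.Build G quot_group quot_proj quot_proj_gmulfM.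
HB.instance Definition _ :=
  Multiplicative_isUMagmaMorphism.Build G quot_group quot_proj quot_proj_gmulf1.

End QuotientGroup.

Lemma is_normal_bigcap (G : groupType) (F : set (set G)) :
  (forall N, F N -> is_normal N) -> is_normal (\bigcap_(N in F) N).
Proof.
move=> hF; split=> [N /hF|x y hx hy N FN|x hx N FN|x g hx N FN].
- exact: normal1.
- by apply: (normalM (hF N FN)); [exact: hx|exact: hy].
- by apply: (normalV (hF N FN)); exact: hx.
- by apply: (normalJ (hF N FN)); exact: hx.
Qed.

Definition normal_closure (G : groupType) (S : set G) : set G :=
  smallest (@is_normal G) S.

Lemma normal_closure_normal (G : groupType) (S : set G) :
  is_normal (normal_closure S).
Proof. by apply: is_normal_bigcap => N []. Qed.

(* Free group on X: words in the letters (x, false), for x, and (x, true), for *)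
(* the inverse of x, up to insertion and deletion of pairs x x^-1, x^-1 x.     *)

Section FreeGroup.
Variable X : Type.

Definition word := seq ({classic X} * bool).

Inductive free_eq : word -> word -> Prop :=
| free_eq_refl w : free_eq w w
| free_eq_sym w1 w2 : free_eq w1 w2 -> free_eq w2 w1
| free_eq_trans w1 w2 w3 : free_eq w1 w2 -> free_eq w2 w3 -> free_eq w1 w3
| free_eq_cancel u v x b :
    free_eq (u ++ (x, b) :: (x, ~~ b) :: v) (u ++ v).

Definition free_rel (w1 w2 : word) : bool := `[< free_eq w1 w2 >].

Lemma free_rel_refl : reflexive free_rel.
Proof. by move=> w; apply/asboolP; constructor. Qed.
Lemma free_rel_sym : symmetric free_rel.
Proof. by move=> w1 w2; apply/asboolP/asboolP; apply: free_eq_sym. Qed.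
Lemma free_rel_trans : transitive free_rel.
Proof.
by move=> w2 w1 w3 /asboolP h /asboolP k; apply/asboolP; apply: free_eq_trans k.
Qed.

Canonical free_equiv :=
  EquivRel free_rel free_rel_refl free_rel_sym free_rel_trans.

Definition free_group := {eq_quot free_equiv}.

HB.instance Definition _ := EqQuotient.on free_group.
HB.instance Definition _ := Choice.on free_group.

Definition free_class (w : word) : free_group := \pi_free_group w.

Lemma free_classP w1 w2 : free_class w1 = free_class w2 <-> free_eq w1 w2.
Proof. by split=> [/eqmodP/asboolP | h] //; apply/eqmodP/asboolP. Qed.

Lemma free_classK (a : free_group) : free_class (repr a) = a.
Proof. exact: reprK. Qed.

Definition word_inv (w : word) : word := rev [seq (p.1, ~~ p.2) | p <- w].

Lemma word_invK : involutive word_inv.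
Proof.
move=> w; rewrite /word_inv map_rev revK -map_comp -[RHS]map_id.
by apply: eq_map => -[x b] /=; rewrite negbK.
Qed.

Lemma free_eq_cat w1 w2 w1' w2' :
  free_eq w1 w1' -> free_eq w2 w2' -> free_eq (w1 ++ w2) (w1' ++ w2').
Proof.
have hl u v v' : free_eq v v' -> free_eq (u ++ v) (u ++ v').
  elim=> [w0|v1 v2 _ /free_eq_sym //|v1 v2 v3 _ ih1 _ ih2|a b x c].
  - exact: free_eq_refl.
  - exact: free_eq_trans ih2.
  - by rewrite !catA; apply: free_eq_cancel.
have hr u v v' : free_eq v v' -> free_eq (v ++ u) (v' ++ u).
  elim=> [w0|v1 v2 _ /free_eq_sym //|v1 v2 v3 _ ih1 _ ih2|a b x c].
  - exact: free_eq_refl.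
  - exact: free_eq_trans ih2.
  - by rewrite -!catA /=; apply: free_eq_cancel.
by move=> h1 h2; apply: free_eq_trans (hr _ _ _ h1) (hl _ _ _ h2).
Qed.

Lemma free_eq_inv w w' : free_eq w w' -> free_eq (word_inv w) (word_inv w').
Proof.
elim=> [w0|v1 v2 _ /free_eq_sym //|v1 v2 v3 _ ih1 _ ih2|a b x c].
- exact: free_eq_refl.
- exact: free_eq_trans ih2.
- rewrite /word_inv !map_cat /= !rev_cat !rev_cons negbK -!cats1 -!catA /=.
  exact: free_eq_cancel.
Qed.

Lemma free_eq_invr w : free_eq (w ++ word_inv w) [::].
Proof.
elim: w => [|[x b] w ih] /=; first exact: free_eq_refl.
have -> : (x, b) :: w ++ word_inv ((x, b) :: w) =
    [:: (x, b)] ++ (w ++ word_inv w) ++ [:: (x, ~~ b)].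
  by rewrite /word_inv /= rev_cons -cats1 -catA.
apply: free_eq_trans (free_eq_cancel [::] [::] x b).
apply: free_eq_cat (free_eq_refl [:: (x, b)]) _.
exact: free_eq_cat ih (free_eq_refl [:: (x, ~~ b)]).
Qed.

Definition free_one : free_group := free_class [::].
Definition free_mul (a b : free_group) := free_class (repr a ++ repr b).
Definition free_inv (a : free_group) := free_class (word_inv (repr a)).

Lemma free_mulE w1 w2 :
  free_mul (free_class w1) (free_class w2) = free_class (w1 ++ w2).
Proof.
by apply/free_classP/free_eq_cat; apply/free_classP; exact: free_classK.
Qed.

Lemma free_invE w : free_inv (free_class w) = free_class (word_inv w).
Proof. by apply/free_classP/free_eq_inv/free_classP; exact: free_classK. Qed.

Fact free_mulA : associative free_mul.
Proof.
move=> a b c; rewrite -(free_classK a) -(free_classK b) -(free_classK c).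
by rewrite !free_mulE catA.
Qed.
Fact free_mul1g : left_id free_one free_mul.
Proof. by move=> a; rewrite -(free_classK a) free_mulE. Qed.
Fact free_mulg1 : right_id free_one free_mul.
Proof. by move=> a; rewrite -(free_classK a) free_mulE cats0. Qed.
Fact free_mulgV : right_inverse free_one free_inv free_mul.
Proof.
move=> a; rewrite -(free_classK a) free_invE free_mulE.
by apply/free_classP; exact: free_eq_invr.
Qed.
Fact free_mulVg : left_inverse free_one free_inv free_mul.
Proof.
move=> a; rewrite -(free_classK a) free_invE free_mulE.
by apply/free_classP; rewrite -{2}[repr a]word_invK; exact: free_eq_invr.
Qed.

HB.instance Definition _ := isGroup.Build free_group
  free_mulA free_mul1g free_mulg1 free_mulVg free_mulgV.

Definition free_gen (x : X) : free_group := free_class [:: (x, false)].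

Lemma free_class_cat w1 w2 : free_class (w1 ++ w2) = free_class w1 * free_class w2.
Proof. by rewrite -free_mulE. Qed.

Variables (H : groupType) (f : X -> H).

Definition word_eval (w : word) : H :=
  \prod_(p <- w) (if p.2 then (f p.1)^-1 else f p.1).

(* The morphism free_group -> H that extends f. *)
Definition free_lift (a : free_group) : H := word_eval (repr a).

Lemma word_eval_free_eq w1 w2 : free_eq w1 w2 -> word_eval w1 = word_eval w2.
Proof.
elim=> // [? ? ? _ -> _ -> //|u v x b].
rewrite /word_eval !big_cat !big_cons /=; congr (_ * _).
by case: b; rewrite /= ?mulKg ?mulVKg.
Qed.

Lemma free_lift_class w : free_lift (free_class w) = word_eval w.
Proof. by apply/word_eval_free_eq/free_classP; exact: free_classK. Qed.

Lemma free_lift_gen x : free_lift (free_gen x) = f x.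
Proof. by rewrite free_lift_class /word_eval big_seq1. Qed.

Fact free_lift_gmulfM : {morph free_lift : x y / x * y}.
Proof.
move=> a b; rewrite -(free_classK a) -(free_classK b) -free_class_cat.
by rewrite !free_lift_class /word_eval big_cat.
Qed.
Fact free_lift_gmulf1 : free_lift 1 = 1.
Proof. by rewrite free_lift_class /word_eval big_nil. Qed.
HB.instance Definition _ :=
  isMultiplicative.Build free_group H free_lift free_lift_gmulfM.
HB.instance Definition _ :=
  Multiplicative_isUMagmaMorphism.Build free_group H free_lift free_lift_gmulf1.

End FreeGroup.


Definition relators (G : groupType) (rel : G -> G -> Prop) : set G :=
  [set z | exists x y, rel x y /\ z = x / y].

Section Presentation.
Variables (X : Type) (rel : free_group X -> free_group X -> Prop).

Definition presented :=
  quot_group (normal_closure_normal (relators rel)).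

Definition pres_gen (x : X) : presented :=
  quot_proj (normal_closure_normal (relators rel)) (free_gen x).

End Presentation.

(* The free group on the symbols (g, x), g in H, x in X, with the action       *)
(* f (g, x) = (f g, x) of H, modulo the smallest normal subgroup that is       *)
(* stable under the action and contains the relators of rel.                   *)
Section RelativePresentation.
Variables (H : groupType) (X : Type).

Definition rel_act (f : H) : free_group (H * X) -> free_group (H * X) :=
  free_lift (fun p : H * X => free_gen (f * p.1, p.2)).

Definition is_stable (N : set (free_group (H * X))) : Prop :=
  forall f x, N x -> N (rel_act f x).

Variable rel : free_group (H * X) -> free_group (H * X) -> Prop.

Definition stable_normal_closure : set (free_group (H * X)) :=
  smallest [set N | is_normal N /\ is_stable N] (relators rel).

Lemma stable_normal_closure_normal : is_normal stable_normal_closure.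
Proof. by apply: is_normal_bigcap => N [[]]. Qed.

Definition rel_presented := quot_group stable_normal_closure_normal.

Definition rel_pres_gen (x : X) : rel_presented :=
  quot_proj stable_normal_closure_normal (free_gen (1, x)).

End RelativePresentation.

Local Open Scope ring_scope.

(* Indices: (k, false) stands for k + 1 and (k, true) for - (k + 1).           *)
Definition idx (l : nat) := ('I_l * bool)%type.

Definition opi l (i : idx l) : idx l := (i.1, ~~ i.2).

(* A submodule of R as a module over itself; unlike idealr, I = R is allowed.  *)
Definition is_ideal (R : comPzRingType) (I : {pred R}) : Prop :=
  submod_closed (I : {pred R^o}).

Section Symplectic.
Variables (R : comPzRingType) (l : nat).
Implicit Types (i j : idx l) (a : R).

Definition eps i : R := (-1) ^+ i.2.

(* R being commutative, right multiplication by scalars is written *:.         *)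
Definition vec := {ffun idx l -> R^o}.
HB.instance Definition _ := GRing.Lmodule.on vec.

Definition basis i : vec := [ffun k => (k == i)%:R].

Definition form (u v : vec) : R := \sum_i eps i * u i * v (opi i).

Lemma opiK : involutive (@opi l).
Proof. by case=> k b; rewrite /opi negbK. Qed.

Lemma form_basis i j : form (basis i) (basis j) = eps i * (i == opi j)%:R.
Proof.
rewrite /form (bigD1 i) //= big1 ?addr0 => [|k /negPf ki].
  by rewrite /basis !ffunE eqxx mulr1 (inv_eq opiK).
by rewrite /basis !ffunE ki mulr0 mul0r.
Qed.

Record sp := Sp {
  sp_fun :> vec -> vec;
  sp_linear : linear sp_fun;
  sp_bij : bijective sp_fun;
  sp_form : forall u v, form (sp_fun u) (sp_fun v) = form u v }.

HB.instance Definition _ := gen_eqMixin sp.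
HB.instance Definition _ := gen_choiceMixin sp.

Lemma spP (f g : sp) : f =1 g -> f = g.
Proof.
case: f g => [f f1 f2 f3] [g g1 g2 g3] /= /funext fg.
by case: g / fg g1 g2 g3 => *; congr Sp; exact: Prop_irrelevance.
Qed.

Definition sp_one : sp.
Proof. by exists id => //; exists id. Defined.

Definition sp_mul (f g : sp) : sp.
Proof.
exists (f \o g) => [a u v /=||u v /=]; first by rewrite !sp_linear.
- exact: bij_comp (sp_bij f) (sp_bij g).
- by rewrite !sp_form.
Defined.

Lemma sp_inv_subproof (f : sp) : {g : vec -> vec | cancel f g /\ cancel g f}.
Proof. by apply: cid; have [g fK gK] := sp_bij f; exists g. Qed.

Definition sp_inv (f : sp) : sp.
Proof.
exists (sval (sp_inv_subproof f)) => [a u v||u v];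
  have [fK gK] := svalP (sp_inv_subproof f).
- by apply: (can_inj fK); rewrite sp_linear !gK.
- by exists f.
- by rewrite -(sp_form f) !gK.
Defined.

Fact sp_mulA : associative sp_mul. Proof. by move=> f g h; apply: spP. Qed.
Fact sp_mul1g : left_id sp_one sp_mul. Proof. by move=> f; apply: spP. Qed.
Fact sp_mulg1 : right_id sp_one sp_mul. Proof. by move=> f; apply: spP. Qed.
Fact sp_mulVg : left_inverse sp_one sp_inv sp_mul.
Proof.
move=> f; apply: spP => u /=.
by case: (svalP (sp_inv_subproof f)).
Qed.
Fact sp_mulgV : right_inverse sp_one sp_inv sp_mul.
Proof.
move=> f; apply: spP => u /=.
by case: (svalP (sp_inv_subproof f)).
Qed.

HB.instance Definition _ := isGroup.Build sp
  sp_mulA sp_mul1g sp_mulg1 sp_mulVg sp_mulgV.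

Lemma formDl u v w : form (u + v) w = form u w + form v w.
Proof.
by rewrite -big_split; apply: eq_bigr => i _; rewrite /= !ffunE mulrDr mulrDl.
Qed.

Lemma formDr u v w : form u (v + w) = form u v + form u w.
Proof. by rewrite -big_split; apply: eq_bigr => i _; rewrite /= !ffunE mulrDr. Qed.

Lemma formZl a u v : form (a *: u) v = a * form u v.
Proof.
by rewrite /form mulr_sumr; apply: eq_bigr => i _; rewrite ffunE mulrCA !mulrA.
Qed.

Lemma formZr a u v : form u (a *: v) = a * form u v.
Proof.
by rewrite /form mulr_sumr; apply: eq_bigr => i _; rewrite ffunE mulrCA !mulrA.
Qed.

Lemma epsN i : eps (opi i) = - eps i.
Proof. by case: i => k []; rewrite /eps /= ?expr1 ?expr0 ?opprK. Qed.

Lemma formC u v : form v u = - form u v.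
Proof.
rewrite /form (reindex_inj (inv_inj opiK)) -sumrN; apply: eq_bigr => i _.
by rewrite epsN opiK !mulNr mulrAC.
Qed.

Lemma form_alt u : form u u = 0.
Proof.
transitivity (\sum_(k < l) \sum_(b : bool) eps (k, b) * u (k, b) * u (k, ~~ b)).
  by rewrite pair_big; apply: eq_bigr => -[k b].
by apply: big1 => k _; rewrite big_bool /eps /opi /= expr0 expr1; ring.
Qed.

Definition transv (u v : vec) a (w : vec) : vec :=
  w + (form v w + a * form u w) *: u + form u w *: v.

Lemma transv_linear u v a : linear (transv u v a).
Proof.
move=> b x y; rewrite /transv !(formDr, formZr).
by apply/ffunP => i; rewrite !ffunE /GRing.scale /=; ring.
Qed.

Lemma transv_comp u v w a b x : form u v = 0 -> form u w = 0 ->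
  transv u v a (transv u w b x) = transv u (v + w) (a + b + form v w) x.
Proof.
move=> uv uw; rewrite /transv !(formDr, formZr, formDl) uw form_alt.
rewrite (formC u v) uv; apply/ffunP => i.
by rewrite !ffunE /GRing.scale /=; ring.
Qed.

Lemma transv_form u v a x y : form u v = 0 ->
  form (transv u v a x) (transv u v a y) = form x y.
Proof.
move=> uv; rewrite /transv !(formDr, formZr, formDl, formZl) !form_alt.
by rewrite (formC u v) uv (formC u x) (formC v x); ring.
Qed.

Lemma transvK u v a : form u v = 0 ->
  cancel (transv u v a) (transv u (- v) (- a)).
Proof.
move=> uv x; have uNv : form u (- v) = 0 by rewrite -scaleN1r formZr uv mulr0.
rewrite transv_comp // !addNr add0r -scaleN1r formZl form_alt mulr0 /transv.
by rewrite -(scale0r (0 : vec)) formZl !mul0r addr0 !scale0r scaler0 !addr0.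
Qed.

Lemma transv_bij u v a : form u v = 0 -> bijective (transv u v a).
Proof.
move=> uv; exists (transv u (- v) (- a)); first exact: transvK.
rewrite -{2}[v]opprK -{2}[a]opprK; apply: transvK.
by rewrite -scaleN1r formZr uv mulr0.
Qed.

Definition transv_sp u v a (uv : form u v = 0) : sp :=
  Sp (transv_linear u v a) (transv_bij a uv)
     (fun x y => transv_form a x y uv).

(* T_ij(a) = T(e_i, e_{-j} a eps_{-j}, 0) and T_{i,-i}(a) = T(e_i, 0, a); both *)
(* lie in sp by transv_sp.                                                     *)
Definition elementary : set sp := [set f : sp |
  (exists i j a, [/\ i != j, i != opi j &
     f =1 transv (basis i) ((a * eps (opi j)) *: basis (opi j)) 0]) \/
  (exists i a, f =1 transv (basis i) 0 a)].

Definition Ep : set sp := normal_closure elementary.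

Definition is_column (u : vec) : Prop := exists f i, Ep f /\ u = f (basis i).

End Symplectic.

Definition comm (G : groupType) (x y : G) : G := (x * y * x^-1 * y^-1)%g.

Section AbsoluteSteinberg.
Variables (R : comPzRingType) (l : nat).
Implicit Types (i j h k : idx l) (r s : R).

Record xgen := XGen {
  xrow : idx l; xcol : idx l; xpar : R; xneq : xrow != xcol }.

Definition Xw i j r (ij : i != j) : free_group xgen := free_gen (XGen r ij).
Arguments Xw i j r%_R ij : clear implicits.

(* In every presentation of this file, a relation quantifies over proofs that  *)
(* each of its symbols makes sense: Xw i j r, for instance, carries a proof of *)
(* i != j.                                                                     *)
Inductive st_rel : free_group xgen -> free_group xgen -> Prop :=
| st_S0 i j r (ij : i != j) (ji : opi j != opi i) :
    st_rel (Xw i j r ij) (Xw (opi j) (opi i) (- r * eps R i * eps R j) ji)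
| st_S1 i j r s (ij : i != j) :
    st_rel (Xw i j r ij * Xw i j s ij)%g (Xw i j (r + s) ij)
| st_S2 i j h k r s (ij : i != j) (hk : h != k) :
    h \notin [:: j; opi i] -> k \notin [:: i; opi j] ->
    st_rel (comm (Xw i j r ij) (Xw h k s hk)) 1%g
| st_S3 i j k r s (ij : i != j) (jk : j != k) (ik : i != k) :
    i \notin [:: opi j; opi k] -> j != opi k ->
    st_rel (comm (Xw i j r ij) (Xw j k s jk)) (Xw i k (r * s) ik)
| st_S4 i j r s (ii : i != opi i) (nij : opi i != j)
    (ij : i != j) (jj : opi j != j) :
    st_rel (comm (Xw i (opi i) r ii) (Xw (opi i) j s nij))
           (Xw i j (r * s * eps R i) ij * Xw (opi j) j (- (r * s ^+ 2)) jj)%g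
| st_S5 i j r s (ij : i != j) (ji : j != opi i) (ii : i != opi i) :
    st_rel (comm (Xw i j r ij) (Xw j (opi i) s ji))
           (Xw i (opi i) (2%:R * r * s * eps R i) ii).

Definition StSp := presented st_rel.

Definition Xst i j r (ij : i != j) : StSp := pres_gen st_rel (XGen r ij).

End AbsoluteSteinberg.
Arguments Xst {R l} i j r%_R ij.

Section RelativeSteinberg.
Variables (R : comPzRingType) (l : nat) (I : {pred R}).
Implicit Types (i j h k : idx l) (r a b : R).

(* The long root generators (j = -i) also have arbitrary parameters in I: the  *)
(* form parameter is maximal.                                                  *)
Record ygen := YGen {
  yrow : idx l; ycol : idx l; ypar : R;
  yneq : yrow != ycol; ymem : ypar \in I }.

Local Notation F := (free_group (StSp R l * ygen)).

Definition Yw i j a (ij : i != j) (aI : a \in I) : F :=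
  free_gen (1%g, YGen ij aI).
Arguments Yw i j a%_R ij aI : clear implicits.

Local Notation "g ▹ y" := (@rel_act (StSp R l) ygen g y)
  (at level 30, right associativity).

Inductive kl_rel : F -> F -> Prop :=
| kl_KL0 i j a (ij : i != j) (ji : opi j != opi i)
    (aI : a \in I) (aI' : - a * eps R i * eps R j \in I) :
    kl_rel (Yw i j a ij aI)
           (Yw (opi j) (opi i) (- a * eps R i * eps R j) ji aI')
| kl_KL1 i j a b (ij : i != j)
    (aI : a \in I) (bI : b \in I) (abI : a + b \in I) :
    kl_rel (Yw i j a ij aI * Yw i j b ij bI)%g (Yw i j (a + b) ij abI)
| kl_KL2 i j h k r a (ij : i != j) (hk : h != k) (aI : a \in I) :
    h \notin [:: j; opi i] -> k \notin [:: i; opi j] ->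
    kl_rel (Xst i j r ij ▹ Yw h k a hk aI) (Yw h k a hk aI)
| kl_KL3 i j k r a (ij : i != j) (jk : j != k) (ik : i != k)
    (aI : a \in I) (raI : r * a \in I) :
    i \notin [:: opi j; opi k] -> j != opi k ->
    kl_rel ((Xst i j r ij ▹ Yw j k a jk aI) * (Yw j k a jk aI)^-1)%g
           (Yw i k (r * a) ik raI)
| kl_KL4 i j r a (ii : i != opi i) (nij : opi i != j)
    (ij : i != j) (jj : opi j != j) (aI : a \in I)
    (raI : r * a * eps R i \in I) (ra2I : - (r * a ^+ 2) \in I) :
    kl_rel ((Xst i (opi i) r ii ▹ Yw (opi i) j a nij aI)
              * (Yw (opi i) j a nij aI)^-1)%g
           (Yw i j (r * a * eps R i) ij raI
              * Yw (opi j) j (- (r * a ^+ 2)) jj ra2I)%g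
| kl_KL5 i j r a (ii : i != opi i) (nij : opi i != j)
    (ij : i != j) (jj : opi j != j) (aI : a \in I)
    (arI : a * r * eps R i \in I) (ar2I : - (a * r ^+ 2) \in I) :
    kl_rel (Yw i (opi i) a ii aI
              * (Xst (opi i) j r nij ▹ Yw i (opi i) a ii aI)^-1)%g
           (Yw i j (a * r * eps R i) ij arI
              * Yw (opi j) j (- (a * r ^+ 2)) jj ar2I)%g
| kl_KL6 i j r a (ij : i != j) (ji : j != opi i) (ii : i != opi i)
    (aI : a \in I) (raI : 2%:R * r * a * eps R i \in I) :
    kl_rel ((Xst i j r ij ▹ Yw j (opi i) a ji aI) * (Yw j (opi i) a ji aI)^-1)%g
           (Yw i (opi i) (2%:R * r * a * eps R i) ii raI)
| kl_KL7 i j h k a b (ij : i != j) (hk : h != k)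
    (aI : a \in I) (bI : b \in I) :
    kl_rel (Xst i j a ij ▹ Yw h k b hk bI)
           (Yw i j a ij aI * Yw h k b hk bI * (Yw i j a ij aI)^-1)%g.

Definition StSp_rel := rel_presented kl_rel.

Definition Yst i j a (ij : i != j) (aI : a \in I) : StSp_rel :=
  rel_pres_gen kl_rel (YGen ij aI).

End RelativeSteinberg.
Arguments Yst {R l I} i j a%_R ij aI.

Section TransvectionPresentation.
Variables (R : comPzRingType) (l : nat) (I : {pred R}).
Implicit Types (u v w : vec R l) (a b c r : R).

Definition is_tgen u v a b : Prop :=
  [/\ is_column u, form u v = 0, a \in I & b \in I].

Record tgen := TGen {
  tfst : vec R l; tsnd : vec R l; tpar1 : R; tpar2 : R;
  tgenP : is_tgen tfst tsnd tpar1 tpar2 }.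

Definition Tw u v a b (h : is_tgen u v a b) : free_group tgen :=
  free_gen (TGen h).
Arguments Tw (u v a b)%_R h : clear implicits.

Inductive t_rel : free_group tgen -> free_group tgen -> Prop :=
| t_T1 u v a b r
    (h1 : is_tgen u (r *: v) a b) (h2 : is_tgen u v (a * r) b) :
    t_rel (Tw u (r *: v) a b h1) (Tw u v (a * r) b h2)
| t_T2 u v w a b c (h1 : is_tgen u v a b) (h2 : is_tgen u w a c)
    (h3 : is_tgen u (v + w) a (b + c + a ^+ 2 * form v w)) :
    t_rel (Tw u v a b h1 * Tw u w a c h2)%g
          (Tw u (v + w) a (b + c + a ^+ 2 * form v w) h3)
| t_T3 u v a b (h1 : is_tgen u v a 0) (h2 : is_tgen u v b 0)
    (h3 : is_tgen u v (a + b) 0) :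
    t_rel (Tw u v a 0 h1 * Tw u v b 0 h2)%g (Tw u v (a + b) 0 h3)
| t_T4 u v a (h1 : is_tgen u v a 0) (h2 : is_tgen v u a 0) :
    t_rel (Tw u v a 0 h1) (Tw v u a 0 h2)
| t_T5 u v a b u' v' a' b'
    (h' : is_tgen u' v' a' b') (h : is_tgen u v a b)
    (h'' : is_tgen (transv u' (a' *: v') b' u) (transv u' (a' *: v') b' v) a b) :
    t_rel (Tw u' v' a' b' h' * Tw u v a b h * (Tw u' v' a' b' h')^-1)%g
          (Tw (transv u' (a' *: v') b' u) (transv u' (a' *: v') b' v) a b h'')
| t_T6 u a (h1 : is_tgen u u a 0) (h2 : is_tgen u 0 0 (2%:R * a)) :
    t_rel (Tw u u a 0 h1) (Tw u 0 0 (2%:R * a) h2)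
| t_T7 u v a r (h1 : is_tgen (u + r *: v) 0 0 a) (h2 : is_tgen u 0 0 a)
    (h3 : is_tgen v 0 0 (a * r ^+ 2)) (h4 : is_tgen v u (a * r) 0) :
    t_rel (Tw (u + r *: v) 0 0 a h1)
          (Tw u 0 0 a h2 * Tw v 0 0 (a * r ^+ 2) h3 * Tw v u (a * r) 0 h4)%g.

Definition Tgroup := presented t_rel.

Definition Tst u v a b (h : is_tgen u v a b) : Tgroup := pres_gen t_rel (TGen h).

End TransvectionPresentation.
Arguments is_tgen {R l} I (u v a b)%_R.
Arguments Tst {R l I} (u v a b)%_R h.

(* Main.v *)
(* Write pi for the projection of StSp to Sp. Every column is pi(x) e_i for some x in StSp, *)

(* Both groups are given by universal properties, so maps in the two directions are produced from
   relations and then compared on generators. Towards the T-group one needs an action of [StSp] on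
   it and the relations KL0-KL7: replacing u, v by their images under pi respects T1-T7, which gives
   the action ([Tt_twist]), and [root_tau_kl] derives KL0-KL7. Towards the relative Steinberg group
   one needs transvections that satisfy T1-T7 there ([transvections_exist]). The maps respect the
   actions and every generator is a translate of one with u = e_i ([column_orbit]), so it is enough
   to compare them there, where [Tt_heis] identifies the image of E_i(a v, b) with (e_i, v, a, b).

   That columns form orbits of [StSp] is not a formality, because Ep is defined as a normal closure.
   [range_normal] proves that the range of pi is normal: every T(u, v, b) with u orthogonal to v is
   a product of elements of the range ([st_image_transv]).

   The construction of T(u, 0, a) uses only relations between root elements. They are collected in
   [stdata], which holds for the absolute group acting on itself by conjugation (with I = R) and for
   its action on the relative group, so that the lemmas serve both. [E_mul] makes the elements
   E_i(v, b) a Heisenberg group, and by [act_sE] and [act_lE] the root elements that fix e_i act on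
   it through v. [Z_plane] shows that T(w, 0, a) does not depend on the auxiliary plane, [Z_split]
   and [F_split] expand it along hyperbolic planes, and [Zt_plane3] compares the expansions along
   two planes by means of a third.

   T5 requires more than equivariance: T(u, v a, b) in the relative group must conjugate as its
   counterpart in [StSp] acts. This is the Peiffer identity of a crossed module. Instead of a map to
   [StSp], the relation [linked] between products of matching generators is used, and [peiffer] is
   proved for every factor of the construction. *)
(* so an inverse of the map Y_ij(a) |-> (e_i, ...) has to send (pi(x) e_i, pi(x) v, a, b) to *)
(* ^x E_i(a v, b), where E_i(v, b) is the evident product of relative generators lifting     *)
(* T(e_i, v, b). The point is that this does not depend on x. It holds because the long      *)
(* root elements extend to a family T(u, 0, a), u in V, on which StSp acts through pi: then  *)
(*   E_i(a v, b) = T(e_i, 0, a)^-1 T(e_i + v, 0, a) T(v, 0, a)^-1 T(e_i, 0, b),              *)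
(* and the right-hand side makes sense, equivariantly, with any column u in place of e_i.    *)
(* The family is built as follows. If w is orthogonal to the hyperbolic plane H_i of e_i,    *)
(* move T(e_i, 0, a) by an element taking e_i to e_i + w and divide by T(e_i, 0, a) and      *)
(* E_i(a w, 0); what remains is T(w, 0, a), and it is independent of i once w is orthogonal  *)
(* to two planes. For u = p + w with p in H_i and w orthogonal to H_i, put                   *)
(*   T(u, 0, a) = T(p, 0, a) T(p, a w, 0) T(w, 0, a).                                        *)
(* A third plane, available as l >= 3, shows that the choice of i does not matter; as each   *)
(* root element preserves the splitting for a suitable i, equivariance follows.              *)
(* T1-T7 are then verified at u = e_i, where they come down to the multiplication law        *)
(*   E_i(v, b) E_i(w, c) = E_i(v + w, b + c + <v, w>).                                       *)
(* Conversely T1-T7 imply KL0-KL7 by computation; this gives the map to the T-group and,     *)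
(* applied to Sp itself with I = R, also the projection pi.                                  *)
From HB Require Import structures.
From mathcomp Require Import all_boot all_order all_algebra.
From mathcomp Require Import boolp classical_sets ring.
Require Import Defs.

Set Implicit Arguments.
Unset Strict Implicit.
Unset Printing Implicit Defensive.

Import GRing.Theory.
Local Open Scope ring_scope.

(** * Vectors and transvections *)

Section Vectors.
Variables (R : comPzRingType) (l : nat).
Implicit Types (i j k : idx l) (u v w : vec R l) (a b c r : R) (J : {pred R}).

Lemma opi_neq i : (opi i == i) = false.
Proof. by case: i => k []; rewrite /opi xpair_eqE /= andbF. Qed.

Lemma opi_eq i j : (opi i == j) = (i == opi j).
Proof. exact: (inv_eq (@opiK l)). Qed.

Lemma opi_eqC i j : (i == opi j) = (j == opi i).
Proof. by rewrite eq_sym opi_eq. Qed.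

Lemma plane_neq i j : i.1 != j.1 -> (i == j) = false.
Proof. by case: i j => [i b] [j c] /= /negPf ij; rewrite xpair_eqE ij. Qed.

Lemma plane_eq i j : i.1 = j.1 -> i = j \/ i = opi j.
Proof.
case: i j => [i b] [j c] /= ->; case: b c => [] []; rewrite /opi /=; by [left|right].
Qed.

Lemma plane_neqP i j : i != j -> i != opi j -> i.1 != j.1.
Proof. by move=> ij iNj; apply: contraNneq ij => /plane_eq [->|/eqP]; rewrite ?(negPf iNj). Qed.

Lemma epsK i : eps R i * eps R i = 1.
Proof. by case: i => k []; rewrite /eps /= ?expr1 ?expr0 ?mulrNN ?mulr1. Qed.

Lemma basisE i k : basis R i k = (k == i)%:R.
Proof. by rewrite ffunE. Qed.

Lemma vaddE u v k : (u + v) k = u k + v k. Proof. by rewrite ffunE. Qed.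
Lemma voppE u k : (- u) k = - u k. Proof. by rewrite ffunE. Qed.
Lemma vscaleE a u k : (a *: u) k = a * u k. Proof. by rewrite ffunE. Qed.
Lemma v0E k : (0 : vec R l) k = 0. Proof. by rewrite ffunE. Qed.
Definition vE := (vaddE, voppE, vscaleE, v0E, basisE).

Lemma form_basisl i w : form (basis R i) w = eps R i * w (opi i).
Proof.
rewrite /form (bigD1 i) //= big1 ?addr0 => [|k /negPf ki].
  by rewrite basisE eqxx mulr1.
by rewrite basisE ki mulr0 mul0r.
Qed.

Lemma form_basisr i w : form w (basis R i) = - (eps R i * w (opi i)).
Proof. by rewrite formC form_basisl. Qed.

Lemma form0l w : form 0 w = 0.
Proof. by rewrite -(scale0r (0 : vec R l)) formZl mul0r. Qed.
Lemma form0r w : form w 0 = 0.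
Proof. by rewrite formC form0l oppr0. Qed.
Lemma formNl u v : form (- u) v = - form u v.
Proof. by rewrite -scaleN1r formZl mulN1r. Qed.
Lemma formNr u v : form u (- v) = - form u v.
Proof. by rewrite -scaleN1r formZr mulN1r. Qed.
Definition fE := (formDl, formDr, formZl, formZr, formNl, formNr, form0l, form0r,
  form_basisl, form_basisr, @form_alt R l).

Lemma transvE u v a w k :
  transv u v a w k = w k + (form v w + a * form u w) * u k + form u w * v k.
Proof. by rewrite /transv !vE. Qed.

Lemma form_planes u v : form u v =
  \sum_(k < l) (u (k, false) * v (k, true) - u (k, true) * v (k, false)).
Proof.
transitivity (\sum_(k < l) \sum_(b : bool) eps R (k, b) * u (k, b) * v (k, ~~ b)).
  by rewrite pair_big; apply: eq_bigr => -[k b].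
by apply: eq_bigr => k _; rewrite big_bool /eps /= expr0 expr1; ring.
Qed.

(** One predicate records both the ideal that contains the coordinates and the basis vectors that
    may occur. With [J := I] it describes parameters of elements of G, with [J := predT] a mere
    vanishing condition. *)
Definition supp J (D : pred (idx l)) v : Prop :=
  forall j, v j \in J /\ (~~ D j -> v j = 0).

Section Supp.
Variables (J : {pred R}) (hJ : is_ideal J).

Lemma ideal0 : 0 \in J. Proof. by have [] := hJ. Qed.
Lemma idealD a b : a \in J -> b \in J -> a + b \in J.
Proof. by move=> aJ bJ; have [_ h] := hJ; have := h 1 a b aJ bJ; rewrite scale1r. Qed.
Lemma idealMl r a : a \in J -> r * a \in J.
Proof. by move=> aJ; have [h0 h] := hJ; have := h r a 0 aJ h0; rewrite addr0. Qed.
Lemma idealMr r a : a \in J -> a * r \in J.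
Proof. by rewrite mulrC; exact: idealMl. Qed.
Lemma idealN a : a \in J -> - a \in J.
Proof. by rewrite -mulN1r; exact: idealMl. Qed.

Lemma supp0 D : supp J D 0.
Proof. by move=> j; rewrite v0E ideal0. Qed.

Lemma suppD D v w : supp J D v -> supp J D w -> supp J D (v + w).
Proof.
move=> hv hw j; have [vJ v0] := hv j; have [wJ w0] := hw j.
by rewrite vE idealD //; split=> // Dj; rewrite v0 // w0 // addr0.
Qed.

Lemma suppZ D c v : supp J D v -> supp J D (c *: v).
Proof.
move=> hv j; have [vJ v0] := hv j.
by rewrite vE idealMl //; split=> // Dj; rewrite v0 // mulr0.
Qed.

Lemma suppZl D c v : c \in J -> supp predT D v -> supp J D (c *: v).
Proof.
move=> cJ hv j; have [_ v0] := hv j.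
by rewrite vE idealMr //; split=> // Dj; rewrite v0 // mulr0.
Qed.

Lemma suppN D v : supp J D v -> supp J D (- v).
Proof. by rewrite -scaleN1r; exact: suppZ. Qed.

Lemma supp_basis (D : pred (idx l)) a j : a \in J -> D j -> supp J D (a *: basis R j).
Proof.
move=> aJ Dj k; rewrite !vE; split; first exact: idealMr.
by case: eqP => [->|_]; rewrite ?Dj // mulr0.
Qed.

Lemma suppS (D D' : pred (idx l)) v : {subset D <= D'} -> supp J D v -> supp J D' v.
Proof.
by move=> DD hv j; have [vJ v0] := hv j; split=> // /(contra (DD j)) /v0.
Qed.

Lemma suppE (D : pred (idx l)) v j : supp J D v -> ~~ D j -> v j = 0.
Proof. by move=> hv; apply: (hv j).2. Qed.

Lemma suppI (D D' : pred (idx l)) v : supp J D v -> supp J D' v ->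
  supp J (fun j => D j && D' j) v.
Proof.
move=> h h' j; have [vJ v0] := h j; have [_ v0'] := h' j; split=> //.
by rewrite negb_and => /orP[/v0|/v0'].
Qed.

Lemma supp2 i j v : supp J (predC1 i) v -> supp J (predC1 j) v ->
  supp J (fun k => (k != i) && (k != j)) v.
Proof. exact: suppI. Qed.

Lemma form_ideal D D' v w : supp J D v -> supp predT D' w -> form v w \in J.
Proof.
move=> hv _; rewrite /form; elim/big_ind: _ => [|x y|k _]; first exact: ideal0.
- exact: idealD.
- by apply: idealMr; apply: idealMl; case: (hv k).
Qed.

(** The sum step hands over the supports of both summands, because the multiplication law of E_i is
    available only for vectors with coordinates in the ideal and without an e_{-i} coordinate. *)
Lemma vec_ind (D : pred (idx l)) (P : vec R l -> Prop) :
  P 0 -> (forall j a, D j -> a \in J -> P (a *: basis R j)) ->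
  (forall v w, supp J D v -> supp J D w -> P v -> P w -> P (v + w)) ->
  forall v, supp J D v -> P v.
Proof.
move=> P0 Pb PD v hv.
have -> : v = \sum_j v j *: basis R j.
  apply/ffunP => k; rewrite sum_ffunE (bigD1 k) //= big1 ?addr0 => [|j /negPf jk].
    by rewrite !vE eqxx mulr1.
  by rewrite !vE eq_sym jk mulr0.
set u := \sum_j _; suff [] : supp J D u /\ P u by [].
apply: (big_rec (fun w => supp J D w /\ P w)) => [|j w _ [hw Pw]].
  by split; [exact: supp0|].
case Dj: (D j); last first.
  by rewrite (suppE hv) ?Dj // scale0r add0r.
have hj : supp J D (v j *: basis R j) by apply: supp_basis => //; case: (hv j).
split; first exact: suppD.
by apply: PD => //; apply: Pb => //; case: (hv j).
Qed.

End Supp.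

Lemma transvD u v a w w' : transv u v a (w + w') = transv u v a w + transv u v a w'.
Proof. by apply/ffunP => k; rewrite !(transvE, fE, vE); ring. Qed.

Lemma transv_lin u v b c w : transv u v b (c *: w) = c *: transv u v b w.
Proof. by apply/ffunP => k; rewrite !(transvE, fE, vE); ring. Qed.

Lemma transvC u v w : transv u v 0 w = transv v u 0 w.
Proof. by apply/ffunP => k; rewrite !transvE; ring. Qed.

Lemma transvZ u v r w : transv u (r *: v) 0 w = transv (r *: u) v 0 w.
Proof. by apply/ffunP => k; rewrite !(transvE, fE, vE); ring. Qed.

Lemma transv_id u v a w : form u w = 0 -> form v w = 0 -> transv u v a w = w.
Proof. by move=> uw vw; apply/ffunP => k; rewrite transvE uw vw; ring. Qed.

Lemma form_basis_neq i j : i.1 != j.1 -> form (basis R i) (basis R j) = 0.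
Proof.
by move=> ij; rewrite form_basis (plane_neq (j := opi j)) ?mulr0.
Qed.

Lemma supp_transv J D u v a w : is_ideal J -> supp predT D u -> supp predT D v ->
  supp J D w -> supp J D (transv u v a w).
Proof.
move=> hJ hu hv hw; have fJ x : form x w \in J.
  by rewrite formC idealN // (form_ideal hJ hw (D' := predT)).
by rewrite /transv; do !apply: suppD => //; apply: suppZl; rewrite // ?idealD ?idealMl.
Qed.

Lemma supp_basis1 (D : pred (idx l)) j : D j -> supp predT D (basis R j).
Proof.
by move=> Dj k; split=> //; rewrite basisE; case: eqP => [->|//]; rewrite Dj.
Qed.

(** As a support this is the orthogonal complement of the hyperbolic plane of e_i and e_{-i}. It
    depends on [i.1] only, so [perp i] and [perp (opi i)] are convertible, which is used silently
    below. *)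
Definition perp i : pred (idx l) := fun j => j.1 != i.1.

Section Perp.
Variables (J : {pred R}) (i : idx l) (w : vec R l).
Hypothesis hw : supp J (perp i) w.

Lemma perp_coord : w i = 0. Proof. by rewrite (suppE hw) // /perp eqxx. Qed.
Lemma perp_coordN : w (opi i) = 0. Proof. by rewrite (suppE hw) // /perp eqxx. Qed.
Lemma perp_forml : form (basis R i) w = 0.
Proof. by rewrite form_basisl perp_coordN mulr0. Qed.
Lemma perp_formr : form w (basis R i) = 0.
Proof. by rewrite form_basisr perp_coordN mulr0 oppr0. Qed.
Lemma perp_predC1 : supp J (predC1 i) w.
Proof. by apply: suppS hw => j; apply: contraNneq => ->. Qed.
Lemma perp_predC1N : supp J (predC1 (opi i)) w.
Proof. by apply: suppS hw => j; apply: contraNneq => ->. Qed.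
End Perp.

Lemma ideal_predT : is_ideal (predT : {pred R}).
Proof. by split. Qed.

Lemma supp_predT J D v : supp J D v -> supp predT D v.
Proof. by move=> hv j; split=> //; case: (hv j). Qed.

End Vectors.

(** * The Heisenberg subgroups E_i(v, b) = T(e_i, v, b) *)

Section Data.
Variables (R : comPzRingType) (l : nat) (I : {pred R}) (S G : groupType).
Variables (sS : idx l -> idx l -> R -> S) (lS : idx l -> R -> S).
Variables (act : S -> G -> G).
Variables (sG : idx l -> idx l -> R -> G) (lG : idx l -> R -> G).

(* sS i j r and sG i j a stand for T(e_i, e_j r, 0) with i, j in distinct planes, lS i r and *)
(* lG i a for T(e_i, 0, a); S acts on G, and the last four fields are KL7. *)
Record stdata : Prop := StData {
  st_act1 : forall y, act 1%g y = y;
  st_actA : forall x x' y, act (x * x')%g y = act x (act x' y);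
  st_actM : forall x y y', act x (y * y')%g = (act x y * act x y')%g;
  st_sSC : forall i j r, i.1 != j.1 -> sS i j r = sS j i r;
  st_sC : forall i j a, i.1 != j.1 -> a \in I -> sG i j a = sG j i a;
  st_sD : forall i j a b, i.1 != j.1 -> a \in I -> b \in I ->
    sG i j (a + b) = (sG i j a * sG i j b)%g;
  st_lD : forall i a b, a \in I -> b \in I -> lG i (a + b) = (lG i a * lG i b)%g;
  st_ss0 : forall i j h k r a, i.1 != j.1 -> h.1 != k.1 -> a \in I ->
    h != opi i -> h != opi j -> k != opi i -> k != opi j ->
    act (sS i j r) (sG h k a) = sG h k a;
  st_sl0 : forall i j h r a, i.1 != j.1 -> a \in I -> h != opi i -> h != opi j ->
    act (sS i j r) (lG h a) = lG h a;
  st_ls0 : forall i h k r a, h.1 != k.1 -> a \in I -> h != opi i -> k != opi i ->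
    act (lS i r) (sG h k a) = sG h k a;
  st_ll0 : forall i h r a, a \in I -> h != opi i -> act (lS i r) (lG h a) = lG h a;
  st_ss : forall i j k r a, i.1 != j.1 -> k.1 != j.1 -> k.1 != i.1 -> a \in I ->
    act (sS i j r) (sG (opi j) k a) =
      (sG (opi j) k a * sG i k (eps R j * r * a))%g;
  st_ss2 : forall i j r a, i.1 != j.1 -> a \in I ->
    act (sS i j r) (sG (opi j) i a) =
      (sG (opi j) i a * lG i (2%:R * (eps R j * r * a)))%g;
  st_ls : forall i k r a, i.1 != k.1 -> a \in I ->
    act (lS i r) (sG (opi i) k a) =
      (sG (opi i) k a * sG i k (eps R i * r * a) * lG k (r * a ^+ 2))%g;
  st_sl : forall i j r a, i.1 != j.1 -> a \in I ->
    act (sS i j r) (lG (opi j) a) =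
      (lG (opi j) a * lG i (a * r ^+ 2) * sG i (opi j) (eps R j * r * a))%g;
  st_pss : forall i j h k a b, i.1 != j.1 -> h.1 != k.1 -> a \in I -> b \in I ->
    act (sS i j a) (sG h k b) = (sG i j a * sG h k b * (sG i j a)^-1)%g;
  st_psl : forall i j h a b, i.1 != j.1 -> a \in I -> b \in I ->
    act (sS i j a) (lG h b) = (sG i j a * lG h b * (sG i j a)^-1)%g;
  st_pls : forall i h k a b, h.1 != k.1 -> a \in I -> b \in I ->
    act (lS i a) (sG h k b) = (lG i a * sG h k b * (lG i a)^-1)%g;
  st_pll : forall i h a b, a \in I -> b \in I ->
    act (lS i a) (lG h b) = (lG i a * lG h b * (lG i a)^-1)%g }.

(** The part of E_i(v, 0) that comes from the k-th hyperbolic plane. In the plane of e_i only the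
    e_i coordinate counts, and T(e_i, e_i c, 0) = T(e_i, 0, 2c). In another plane the long factor
    cancels the value of the form on the two components of v, which arises when the two short
    elements are multiplied. *)
Definition Eblock i (v : vec R l) (k : 'I_l) : G :=
  if k == i.1 then lG i (2%:R * v i)
  else (sG i (k, false) (v (k, false)) * sG i (k, true) (v (k, true))
        * lG i (- (v (k, false) * v (k, true))))%g.

End Data.

HB.lock Definition heis (R : comPzRingType) (l : nat) (G : groupType)
    (sG : idx l -> idx l -> R -> G) (lG : idx l -> R -> G) (i : idx l) (v : vec R l) (b : R) : G :=
  ((\prod_(k < l) Eblock sG lG i v k) * lG i b)%g.

Lemma heisE (R : comPzRingType) (l : nat) (G : groupType)
    (sG : idx l -> idx l -> R -> G) (lG : idx l -> R -> G) (i : idx l) (v : vec R l) (b : R) :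
  heis sG lG i v b = ((\prod_(k < l) Eblock sG lG i v k) * lG i b)%g.
Proof. by rewrite unlock. Qed.

Lemma commuteVl (G : groupType) (x y : G) : commute x y -> commute x^-1%g y.
Proof. by move/commute_sym/commuteV/commute_sym. Qed.

Lemma commuteMl (G : groupType) (x y z : G) :
  commute x z -> commute y z -> commute (x * y)%g z.
Proof. by move=> xz yz; apply/commute_sym/commuteM; apply/commute_sym. Qed.

Lemma commuteP (G : groupType) (x y : G) :
  commute x y <-> (x * y * x^-1)%g = y.
Proof.
split=> [xy|xy]; first by rewrite xy mulgK.
by rewrite /commute -{2}xy mulgVK.
Qed.

Lemma prodgM_commute_uniq (G : groupType) (I : eqType) (r : seq I) (F H : I -> G) :
  uniq r -> (forall i j, i != j -> commute (F i) (H j)) ->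
  (\prod_(i <- r) (F i * H i) = \prod_(i <- r) F i * \prod_(i <- r) H i)%g.
Proof.
move=> + FH; elim: r => [|i r IHr] /=; rewrite !(big_nil, big_cons) ?mulg1//.
case/andP=> ir ur; have com : commute (H i) (\prod_(j <- r) F j)%g.
  rewrite big_seq; apply: commute_prod => j jr.
  by apply/commute_sym/FH; apply: contraNneq ir => <-.
by rewrite IHr // -!mulgA; congr (_ * _)%g; rewrite !mulgA com.
Qed.

Lemma prodg_only (G : groupType) (I : finType) (i0 : I) (F : I -> G) :
  (forall i, i != i0 -> F i = 1%g) -> (\prod_i F i)%g = F i0.
Proof.
move=> F1; transitivity (\prod_(i | i == i0) F i)%g; last exact: big_pred1_eq.
by rewrite [RHS]big_mkcond; apply: eq_bigr => i _; case: ifPn => // /F1.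
Qed.

(** * Multiplication, conjugation and Peiffer identity for the elements E_i(v, b) *)

Section DataTheory.
Variables (R : comPzRingType) (l : nat) (I : {pred R}) (S G : groupType).
Variables (sS : idx l -> idx l -> R -> S) (lS : idx l -> R -> S).
Variables (act : S -> G -> G).
Variables (sG : idx l -> idx l -> R -> G) (lG : idx l -> R -> G).
Hypothesis hI : is_ideal I.
Hypothesis D : stdata I sS lS act sG lG.
Implicit Types (i j h k p q : idx l) (a b c r : R) (u v w : vec R l) (x : S) (y z : G).

Local Notation E := (heis sG lG).

Lemma act_1 x : act x 1%g = 1%g.
Proof. by apply: (mulgI (act x 1%g)); rewrite -(st_actM D) !mulg1. Qed.
Lemma act_V x y : act x y^-1%g = (act x y)^-1%g.
Proof.
by apply: (mulgI (act x y)); rewrite -(st_actM D) !mulgV act_1.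
Qed.
Lemma act_K x y : act x^-1%g (act x y) = y.
Proof. by rewrite -(st_actA D) mulVg (st_act1 D). Qed.
Lemma act_VK x y : act x (act x^-1%g y) = y.
Proof. by rewrite -(st_actA D) mulgV (st_act1 D). Qed.

Lemma lG0 i : lG i 0 = 1%g.
Proof.
apply: (mulgI (lG i 0)); rewrite mulg1 -(st_lD D) ?addr0 //; exact: ideal0.
Qed.
Lemma sG0 i j : i.1 != j.1 -> sG i j 0 = 1%g.
Proof.
move=> ij; apply: (mulgI (sG i j 0)).
by rewrite mulg1 -(st_sD D) ?addr0 //; exact: ideal0.
Qed.

Lemma lG_cent_l i a h b : a \in I -> b \in I -> h != opi i -> commute (lG i a) (lG h b).
Proof. by move=> aI bI hi; apply/commuteP; rewrite -(st_pll D) // (st_ll0 D). Qed.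
Lemma lG_cent_s i a h k b : a \in I -> b \in I -> h.1 != k.1 ->
  h != opi i -> k != opi i -> commute (lG i a) (sG h k b).
Proof. by move=> aI bI hk hi ki; apply/commuteP; rewrite -(st_pls D) // (st_ls0 D). Qed.
Lemma sG_cent i j a h k b : a \in I -> b \in I -> i.1 != j.1 -> h.1 != k.1 ->
  h != opi i -> h != opi j -> k != opi i -> k != opi j ->
  commute (sG i j a) (sG h k b).
Proof. by move=> *; apply/commuteP; rewrite -(st_pss D) // (st_ss0 D). Qed.

Lemma Eblock_lG i v (k : 'I_l) a : (forall j, v j \in I) -> a \in I ->
  commute (lG i a) (Eblock sG lG i v k).
Proof.
move=> vI aI; rewrite /Eblock; case: eqP => [_|/eqP ki].
  by apply: lG_cent_l; rewrite // ?idealMl // -opi_eq opi_neq.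
have ki' : i.1 != k by rewrite eq_sym.
have kf (b : bool) : (k, b) != opi i by rewrite (plane_neq (i := (k, b))).
have ii : i != opi i by rewrite -opi_eq opi_neq.
by do !apply: commuteM; [apply: lG_cent_s|apply: lG_cent_s|apply: lG_cent_l];
  rewrite ?idealN ?idealMl.
Qed.

Lemma Eblock_comm i v w (k m : 'I_l) : k != m -> (forall j, v j \in I) -> (forall j, w j \in I) ->
  commute (Eblock sG lG i v k) (Eblock sG lG i w m).
Proof.
move=> km vI wI.
case ki : (k == i.1).
  rewrite {1}/Eblock ki; apply: Eblock_lG => //; exact: idealMl.
case mi : (m == i.1).
  rewrite {2}/Eblock mi; apply/commute_sym; apply: Eblock_lG => //; exact: idealMl.
have ki' : i.1 != k by rewrite eq_sym ki.
have mi' : i.1 != m by rewrite eq_sym mi.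
have ii : i != opi i by rewrite -opi_eq opi_neq.
have kf (b : bool) : (k, b) != opi i by rewrite (plane_neq (i := (k, b))) //= ki.
have mf (b : bool) : (m, b) != opi i by rewrite (plane_neq (i := (m, b))) //= mi.
have if_ (b : bool) : i != opi (k, b) by rewrite (plane_neq (j := opi (k, b))).
have kmf (b c : bool) : (m, b) != opi (k, c) by rewrite (plane_neq (i := (m, b))) //= eq_sym.
have hs (b c : bool) : commute (sG i (k, b) (v (k, b))) (sG i (m, c) (w (m, c))).
  by apply: sG_cent.
have hL b : b \in I -> commute (Eblock sG lG i v k) (lG i b).
  by move=> bI; apply/commute_sym; apply: Eblock_lG.
rewrite {2}/Eblock mi; apply: commuteM; last by apply: hL; rewrite idealN ?idealMl.
rewrite /Eblock ki; apply: commuteMl; last first.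
  by apply: commuteM; apply: lG_cent_s; rewrite ?idealN ?idealMl.
by apply: commuteM; apply: commuteMl.
Qed.

(** The contribution of the k-th plane to the form; it vanishes in the plane of i because the
    vectors in question have no e_{-i} coordinate. *)
Definition blockform i v w (k : 'I_l) : R :=
  if k == i.1 then 0
  else v (k, false) * w (k, true) - v (k, true) * w (k, false).

Lemma blockform_sum i v w : v (opi i) = 0 -> w (opi i) = 0 ->
  form v w = \sum_k blockform i v w k.
Proof.
move=> v0 w0; rewrite form_planes; apply: eq_bigr => k _; rewrite /blockform.
case: eqP => // ->; move: v0 w0; case: i => i []; rewrite /opi /= => -> ->.
  by rewrite !mul0r !mulr0 subrr.
by rewrite !mul0r !mulr0 subrr.
Qed.

Lemma Eblock_mul i v w (k : 'I_l) : (forall j, v j \in I) -> (forall j, w j \in I) ->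
  (Eblock sG lG i v k * Eblock sG lG i w k)%g =
  (Eblock sG lG i (v + w) k * lG i (blockform i v w k))%g.
Proof.
move=> vI wI; rewrite /Eblock /blockform; case: eqP => [_|/eqP ki].
  by rewrite lG0 mulg1 -(st_lD D) ?idealMl // vE mulrDr.
have ki' : i.1 != k by rewrite eq_sym.
have ii : i != opi i by rewrite -opi_eq opi_neq.
set k0 := (k, false); set k1 := (k, true).
have kf (b : bool) : (k, b) != opi i by rewrite (plane_neq (i := (k, b))).
have hl (b c : bool) : commute (lG i (- (v k0 * v k1))) (sG i (k, b) (w (k, c))).
  by apply: lG_cent_s => //; rewrite idealN ?idealMl.
(* The only noncommuting short factors belong to opposite basis vectors; their commutator is
   [st_ss2], with the action turned into conjugation by KL7. *)
have com : (sG i k1 (v k1) * sG i k0 (w k0))%g =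
    (sG i k0 (w k0) * sG i k1 (v k1) * lG i (- (2%:R * (v k1 * w k0))))%g.
  have ws := st_sC D (i := i) (j := k0) ki' (wI k0).
  have h1 : k0.1 != i.1 by [].
  have := st_ss2 D (i := i) (j := k1) (v k1) ki' (wI k0).
  rewrite (_ : opi k1 = k0) // -ws (st_pss D) //.
  move=> e; apply: (mulIg (sG i k1 (v k1))^-1)%g; rewrite e.
  rewrite -!mulgA; congr (_ * _)%g.
  have -> : 2%:R * (eps R k1 * v k1 * w k0) = - (2%:R * (v k1 * w k0)).
    by rewrite /eps /= expr1; ring.
  by rewrite mulgA -lG_cent_s ?mulgK ?idealN ?idealMl //; exact: kf.
rewrite !vE !(st_sD D) // !mulgA.
rewrite -(mulgA (_ * _)%g (lG i _) (sG i k0 _)) hl !mulgA.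
rewrite -(mulgA _ (lG i _) (sG i k1 _)) hl !mulgA.
rewrite -(mulgA (sG i k0 (v k0)) (sG i k1 (v k1)) _) com !mulgA.
have hl2 : commute (lG i (- (2%:R * (v k1 * w k0)))) (sG i k1 (w k1)).
  by apply: lG_cent_s; rewrite ?idealN ?idealMl //; exact: kf.
rewrite -(mulgA _ (lG i _) (sG i k1 (w k1))) hl2 !mulgA.
have lll y a b : a \in I -> b \in I -> (y * lG i a * lG i b)%g = (y * lG i (a + b))%g.
  by move=> aI bI; rewrite -mulgA -(st_lD D).
rewrite !lll ?(idealD, idealN, idealMl) //.
by congr (_ * lG i _)%g; ring.
Qed.

(** Blocks in different planes commute and the elements T(e_i, 0, c) commute with all blocks, so the
    product can be rearranged plane by plane; the cocycles [blockform] add up to the form. *)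
Lemma E_mul i v w b c : supp I (predC1 (opi i)) v -> supp I (predC1 (opi i)) w ->
  b \in I -> c \in I -> (E i v b * E i w c)%g = E i (v + w) (b + c + form v w).
Proof.
move=> hv hw bI cI.
have vI j : v j \in I by case: (hv j).
have wI j : w j \in I by case: (hw j).
have v0 : v (opi i) = 0 by rewrite (suppE hv) //= eqxx.
have w0 : w (opi i) = 0 by rewrite (suppE hw) //= eqxx.
have bfI (k : 'I_l) : blockform i v w k \in I.
  by rewrite /blockform; case: ifP => _; rewrite ?ideal0 ?idealD ?idealN ?idealMl.
rewrite !heisE mulgA -(mulgA _ (lG i b)).
have -> : (lG i b * \prod_(k < l) Eblock sG lG i w k)%g =
    (\prod_(k < l) Eblock sG lG i w k * lG i b)%g.
  by apply: commute_prod => k _; apply: Eblock_lG.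
rewrite mulgA -prodgM_commute_uniq ?index_enum_uniq //; last first.
  by move=> ? ? km; apply: Eblock_comm.
under eq_bigr do rewrite Eblock_mul //.
rewrite prodgM_commute_uniq ?index_enum_uniq //; last first.
  move=> ? ? km; apply/commute_sym; apply: Eblock_lG => // j.
  by rewrite vE idealD.
have -> : (\prod_(k < l) lG i (blockform i v w k))%g = lG i (form v w).
  rewrite (blockform_sum v0 w0).
  rewrite -[RHS]mulg1 -[RHS]mulg1.
  (* Membership in I is carried along, since additivity of [lG] is known on I only. *)
  pose K a g := a \in I /\ lG i a = g.
  suff [] : K (\sum_(k < l) blockform i v w k) (\prod_(k < l) lG i (blockform i v w k))%g.
    by move=> _ ->; rewrite !mulg1.
  apply: (big_rec2 K) => [|k x y _ [xI <-]]; first by rewrite /K ideal0 // lG0.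
  by rewrite /K idealD // (st_lD D).
have fI : form v w \in I by exact: (form_ideal hI hv (supp_predT hw)).
rewrite -!mulgA; congr (_ * _)%g; rewrite -!(st_lD D) ?idealD //.
by congr (lG i _); ring.
Qed.

Lemma E0 i b : E i 0 b = lG i b.
Proof.
rewrite heisE big1 ?mul1g // => k _; rewrite /Eblock.
case: eqP => [_|/eqP ki]; first by rewrite v0E mulr0 lG0.
by rewrite !v0E mulr0 oppr0 !sG0 ?lG0 ?mulg1 // eq_sym.
Qed.

Lemma E_long i v b : E i v b = (E i v 0 * lG i b)%g.
Proof. by rewrite !heisE lG0 mulg1. Qed.

Lemma E_basis i j a : i.1 != j.1 -> a \in I -> E i (a *: basis R j) 0 = sG i j a.
Proof.
move=> ij aI; rewrite heisE lG0 mulg1 (prodg_only (i0 := j.1)) => [|k kj].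
  rewrite /Eblock eq_sym (negPf ij) !vE; case: j ij => k [] /= ki.
    by rewrite !eqxx !xpair_eqE /= andbF !mulr0 mul0r oppr0 sG0 // lG0 mul1g mulr1 mulg1.
  by rewrite !eqxx !xpair_eqE /= andbF !mulr0 oppr0 sG0 // lG0 !mulg1 mulr1.
have vk (b : bool) : (a *: basis R j) (k, b) = 0.
  by rewrite !vE (plane_neq (i := (k, b))) // mulr0.
rewrite /Eblock !vk mul0r oppr0 lG0; case: eqP => [_|/eqP ki].
  by rewrite !vE (plane_neq ij) !mulr0 lG0.
by rewrite !sG0 ?mulg1 // eq_sym.
Qed.

Lemma E_basis_i i a : a \in I -> E i (a *: basis R i) 0 = lG i (2%:R * a).
Proof.
move=> aI; rewrite heisE lG0 mulg1 (prodg_only (i0 := i.1)) => [|k kj].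
  by rewrite /Eblock eqxx !vE eqxx mulr1.
have vk (b : bool) : (a *: basis R i) (k, b) = 0.
  by rewrite !vE (plane_neq (i := (k, b))) // mulr0.
by rewrite /Eblock (negPf kj) !vk mul0r oppr0 lG0 !sG0 ?mulg1 // eq_sym.
Qed.

Lemma E_basis_long i j a b : i.1 != j.1 -> a \in I ->
  E i (a *: basis R j) b = (sG i j a * lG i b)%g.
Proof. by move=> ij aI; rewrite E_long E_basis. Qed.

Lemma E_split q v w b : supp I (predC1 (opi q)) v -> supp I (predC1 (opi q)) w -> b \in I ->
  E q (v + w) b = (E q v (b - form v w) * E q w 0)%g.
Proof.
move=> hv hw bI; have fI := form_ideal hI hv (supp_predT hw).
rewrite E_mul ?idealD ?idealN ?ideal0 //; congr (E q _ _); ring.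
Qed.

(** An induction principle: a multiplicative relation between group elements and maps of V passes
    from root elements to E_q(v, b) and T(e_q, v, b), because both multiply by the same Heisenberg
    law. [Dp] limits the basis vectors that v may involve. *)
Lemma E_transv (P : G -> (vec R l -> vec R l) -> Prop) (Dp : pred (idx l)) q :
  ~~ Dp (opi q) ->
  (forall y y' f f', P y f -> P y' f' -> P (y * y')%g (f \o f')) ->
  (forall a, a \in I -> P (lG q a) (transv (basis R q) 0 a)) ->
  (forall j a, Dp j -> q.1 != j.1 -> a \in I ->
     P (sG q j a) (transv (basis R q) (a *: basis R j) 0)) ->
  forall v b, supp I Dp v -> b \in I -> P (E q v b) (transv (basis R q) v b).
Proof.
move=> Dq PM Pl Ps v b hv; move: b; have z0 := ideal0 hI.
have sub w : supp I Dp w -> supp I (predC1 (opi q)) w.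
  by apply: suppS => j /= Dj; apply: contraNneq Dq => <-.
have q0 w : supp I Dp w -> form (basis R q) w = 0.
  by move=> hw; rewrite form_basisl (suppE hw) ?mulr0.
move: v hv; apply: (vec_ind hI) => [b bI|j a Dj aI b bI|v w hv hw Pv Pw b bI].
- by rewrite E0; apply: Pl.
- rewrite E_long; have jq : j != opi q by apply: contraNneq Dq => <-.
  have -> : transv (basis R q) (a *: basis R j) b =
      transv (basis R q) (a *: basis R j) 0 \o transv (basis R q) 0 b.
    apply/funext => w /=; rewrite transv_comp ?form0r //; last first.
      by apply: q0; apply: supp_basis.
    by rewrite !addr0 add0r.
  apply: PM; last exact: Pl.
  case: (eqVneq j q) => [{jq} ->|jq']; last first.
    by have qj : q.1 != j.1; [rewrite eq_sym plane_neqP|rewrite E_basis //; apply: Ps].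
  rewrite E_basis_i //.
  have -> : transv (basis R q) (a *: basis R q) 0 = transv (basis R q) 0 (2%:R * a).
    by apply/funext => w; apply/ffunP => m; rewrite !(transvE, fE, vE); ring.
  by apply: Pl; apply: idealMl.
have fI : form v w \in I := form_ideal hI hv (supp_predT hw).
rewrite E_split //; try exact: sub.
have -> : transv (basis R q) (v + w) b =
    transv (basis R q) v (b - form v w) \o transv (basis R q) w 0.
  apply/funext => u /=; rewrite transv_comp ?q0 //.
  by congr (transv _ _ _ _); ring.
by apply: PM; [apply: Pv; rewrite idealD ?idealN|apply: Pw].
Qed.

(** The multiplication law of E_q involves only sums and the form, and f preserves both; hence the
    action needs to be known on root elements only. *)
Lemma E_morph q (x : S) (f : vec R l -> vec R l) :
  {morph f : v w / v + w} -> f 0 = 0 ->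
  (forall v w, form (f v) (f w) = form v w) ->
  (forall v, supp I (predC1 (opi q)) v -> supp I (predC1 (opi q)) (f v)) ->
  (forall b, b \in I -> act x (lG q b) = lG q b) ->
  (forall j a, j != opi q -> a \in I ->
     act x (E q (a *: basis R j) 0) = E q (f (a *: basis R j)) 0) ->
  forall v b, supp I (predC1 (opi q)) v -> b \in I -> act x (E q v b) = E q (f v) b.
Proof.
move=> fD f0 ff fI xl xs v b hv; move: b.
move: v hv; apply: (vec_ind hI) => [b bI|j a ji aI b bI|v w hv hw Pv Pw b bI].
- by rewrite f0 !E0 xl.
- by rewrite E_long (st_actM D) xl // xs // -E_long.
have z0 := ideal0 hI.
have fvw : form v w \in I by exact: (form_ideal hI hv (supp_predT hw)).
rewrite fD -{1}[b](subrK (form v w)) -{1}[b - _]addr0.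
rewrite -E_mul ?idealD ?idealN // (st_actM D) Pv ?idealD ?idealN // Pw //.
rewrite E_mul ?idealD ?idealN //; try exact: fI.
rewrite ff; by congr (E q _ _); ring.
Qed.

Lemma transv_basis p k r j a : transv (basis R p) (r *: basis R k) 0 (a *: basis R j) =
  a *: basis R j + (eps R k * r * a * (opi k == j)%:R) *: basis R p
                 + (eps R p * r * a * (opi p == j)%:R) *: basis R k.
Proof. by apply/ffunP => m; rewrite !(transvE, fE, vE); ring. Qed.

Lemma transv_basis_long p r j a : transv (basis R p) 0 r (a *: basis R j) =
  a *: basis R j + (eps R p * r * a * (opi p == j)%:R) *: basis R p.
Proof. by apply/ffunP => m; rewrite !(transvE, fE, vE); ring. Qed.

Lemma act_sE_basis q p k r j a : p.1 != k.1 -> p != opi q -> k != opi q ->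
  j != opi q -> j != opi p -> a \in I ->
  act (sS p k r) (E q (a *: basis R j) 0) =
  E q (transv (basis R p) (r *: basis R k) 0 (a *: basis R j)) 0.
Proof.
move=> pk pq kq jq jp aI; have ti c := idealMl hI c aI.
have z0 := ideal0 hI.
rewrite transv_basis [opi p == j]eq_sym (negPf jp) mulr0 scale0r addr0.
case: (eqVneq (opi k) j) jq jp => [<-{j} jq jp|kj jq jp].
  have qk : q.1 != k.1.
    by apply: plane_neqP; rewrite 1?opi_eqC // eq_sym -(inj_eq (can_inj (@opiK l))).
  have -> : E q (a *: basis R (opi k) + (eps R k * r * a * 1) *: basis R p) 0 =
      (E q (a *: basis R (opi k)) 0 * E q ((eps R k * r * a) *: basis R p) 0)%g.
    rewrite mulr1 E_mul //; try by apply: supp_basis.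
    by rewrite formZl formZr form_basis_neq ?mulr0 ?addr0 // eq_sym.
  rewrite E_basis // (st_sC D) //; case: (eqVneq q p) => [->|qp].
    by rewrite E_basis_i // (st_ss2 D).
  have qp1 : q.1 != p.1 by apply: plane_neqP => //; rewrite opi_eqC.
  by rewrite E_basis // (st_ss D) // (st_sC D (i := q)).
rewrite mulr0 scale0r addr0; case: (eqVneq j q) => [->|jq'].
  by rewrite E_basis_i // (st_sl0 D) ?ti // opi_eqC.
have jq1 : j.1 != q.1 by apply: plane_neqP.
have qj1 : q.1 != j.1 by rewrite eq_sym.
by rewrite E_basis // (st_ss0 D) // ?(opi_eqC q) // eq_sym.
Qed.

(** As p and k differ from -q, the root element fixes e_q and acts through v alone. The basis vector
    e_{-p} is reduced to the case of e_{-k} by the symmetry of T(e_p, e_k r, 0) in p and k. *)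
Lemma act_sE q p k r v b : p.1 != k.1 -> p != opi q -> k != opi q ->
  supp I (predC1 (opi q)) v -> b \in I ->
  act (sS p k r) (E q v b) = E q (transv (basis R p) (r *: basis R k) 0 v) b.
Proof.
move=> pk pq kq; move: v b; apply: E_morph.
- exact: transvD.
- by apply/ffunP => m; rewrite !(transvE, fE, vE); ring.
- by move=> v w; rewrite transv_form // formZr form_basis_neq // mulr0.
- by move=> v; apply: supp_transv => //; [|apply: suppZ => //]; apply: supp_basis1.
- by move=> b bI; apply: (st_sl0 D); rewrite // opi_eqC.
move=> j a jq aI; case: (eqVneq j (opi p)) => [jp|jp]; last exact: act_sE_basis.
have kp : k.1 != p.1 by rewrite eq_sym.
rewrite (st_sSC D) // transvC -transvZ act_sE_basis //.
by rewrite jp (inj_eq (can_inj (@opiK l))) plane_neq.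
Qed.

Lemma act_lE q p r v b : p != opi q -> 
  supp I (predC1 (opi q)) v -> b \in I ->
  act (lS p r) (E q v b) = E q (transv (basis R p) 0 r v) b.
Proof.
move=> pq; move: v b; apply: E_morph.
- exact: transvD.
- by apply/ffunP => m; rewrite !(transvE, fE, vE); ring.
- by move=> v w; rewrite transv_form // form0r.
- by move=> v; apply: supp_transv => //; [|apply: supp0 => //]; apply: supp_basis1.
- by move=> b bI; apply: (st_ll0 D); rewrite // opi_eqC.
move=> j a jq aI; rewrite transv_basis_long.
have ti c := idealMl hI c aI; have z0 := ideal0 hI.
case: (eqVneq (opi p) j) jq => [<-{j} jq|pj jq].
  have qp : q.1 != p.1.
    by apply: plane_neqP; rewrite 1?opi_eqC // eq_sym -(inj_eq (can_inj (@opiK l))).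
  rewrite mulr1 E_basis // (st_sC D) // (st_ls D) 1?eq_sym //.
  (* The long factor supplied by [st_ls] is exactly what the cocycle of [E_mul] takes away. *)
  have -> : 0 = r * a ^+ 2 + form (a *: basis R (opi p)) ((eps R p * r * a) *: basis R p).
    rewrite formZl formZr form_basisl epsN !vE opiK eqxx mulr1.
    transitivity (r * a ^+ 2 * (1 - eps R p * eps R p)); last by ring.
    by rewrite epsK subrr mulr0.
  rewrite -[r * a ^+ 2 in RHS]add0r -E_mul //; try by apply: supp_basis.
    by rewrite E_basis // E_basis_long // mulgA !(st_sC D (i := q)).
  by rewrite expr2 mulrA.
rewrite mulr0 scale0r addr0; case: (eqVneq j q) => [->|jq'].
  by rewrite E_basis_i // (st_ll0 D) ?ti // opi_eqC.
have jq1 : j.1 != q.1 by apply: plane_neqP.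
have qj1 : q.1 != j.1 by rewrite eq_sym.
by rewrite E_basis // (st_ls0 D) // ?(opi_eqC q) // eq_sym.
Qed.

(* Pairs of matching products of generators of S and of G, with indices in Dp. *)
Inductive linked (Dp : pred (idx l)) : S -> G -> Prop :=
| linked_s i j a : i.1 != j.1 -> a \in I -> Dp i -> Dp j ->
    linked Dp (sS i j a) (sG i j a)
| linked_l i a : a \in I -> Dp i -> linked Dp (lS i a) (lG i a)
| linked_1 : linked Dp 1%g 1%g
| linked_M x x' y y' : linked Dp x y -> linked Dp x' y' ->
    linked Dp (x * x')%g (y * y')%g.

(** The Peiffer identity of a crossed module at z. The relation [linked] replaces a homomorphism
    from G to S, and [Dp] restricts the generators that are tested. *)
Definition peiffer (Dp : pred (idx l)) z :=
  forall x y, linked Dp x y -> act x z = (y * z * y^-1)%g.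

Lemma conj_conj y y' z : (y * (y' * z * y'^-1) * y^-1 = y * y' * z * (y * y')^-1)%g.
Proof. by rewrite !gnorm. Qed.

Lemma conj_mul y z z' : (y * (z * z') * y^-1 = (y * z * y^-1) * (y * z' * y^-1))%g.
Proof. by rewrite !gnorm. Qed.

Lemma conj_inv y z : (y * z^-1 * y^-1 = (y * z * y^-1)^-1)%g.
Proof. by rewrite !gnorm. Qed.

(** KL7 is the case of two generators. For a product on the acting side, the induction hypothesis is
    also applied to the conjugating element itself. *)
Lemma linked_peiffer Dp x y x' y' : linked Dp x y -> linked Dp x' y' ->
  act x y' = (y * y' * y^-1)%g.
Proof.
move=> xy; elim: xy x' y' => {x y} [i j a ij aI Di Dj|i a aI Di||x x1 y y1 xy IH xy1 IH1] x' y' xy'.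
- elim: xy' => {x' y'} [h k b hk bI _ _|h b bI _||x x' y y' _ IH _ IH'].
  + exact: (st_pss D).
  + exact: (st_psl D).
  + by rewrite act_1 mulg1 mulgV.
  + by rewrite (st_actM D) IH IH' -conj_mul.
- elim: xy' => {x' y'} [h k b hk bI _ _|h b bI _||x x' y y' _ IH _ IH'].
  + exact: (st_pls D).
  + exact: (st_pll D).
  + by rewrite act_1 mulg1 mulgV.
  + by rewrite (st_actM D) IH IH' -conj_mul.
- by rewrite (st_act1 D) invg1 mulg1 mul1g.
rewrite (st_actA D) (IH1 _ _ xy') !(st_actM D) act_V (IH _ _ xy') (IH _ _ xy1).
by rewrite -conj_inv -!conj_mul conj_conj.
Qed.

Lemma linkedS (Dp Dp' : pred (idx l)) x y : (forall i, Dp i -> Dp' i) ->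
  linked Dp x y -> linked Dp' x y.
Proof.
move=> DD; elim=> [i j a ij aI /DD Di /DD Dj|i a aI /DD Di||? ? ? ? _ ? _ ?].
- exact: linked_s.
- exact: linked_l.
- exact: linked_1.
- exact: linked_M.
Qed.

Lemma peiffer_linked (Dp Dp' : pred (idx l)) x y : linked Dp x y -> peiffer Dp' y.
Proof.
move=> xy x' y' xy'.
by apply: (@linked_peiffer predT _ _ x y); [apply: linkedS xy'|apply: linkedS xy].
Qed.

Lemma peiffer_gen (Dp : pred (idx l)) z :
  (forall i j a, i.1 != j.1 -> a \in I -> Dp i -> Dp j ->
     act (sS i j a) z = (sG i j a * z * (sG i j a)^-1)%g) ->
  (forall i a, a \in I -> Dp i -> act (lS i a) z = (lG i a * z * (lG i a)^-1)%g) ->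
  peiffer Dp z.
Proof.
move=> hs hl x y; elim=> {x y} [i j a ij aI Di Dj|i a aI Di||x x' y y' xy IH xy' IH'].
- exact: hs.
- exact: hl.
- by rewrite (st_act1 D) invg1 mulg1 mul1g.
rewrite (st_actA D) IH' !(st_actM D) act_V IH (linked_peiffer xy xy').
by rewrite -conj_inv -!conj_mul conj_conj.
Qed.

Lemma peifferM Dp z z' : peiffer Dp z -> peiffer Dp z' -> peiffer Dp (z * z')%g.
Proof. by move=> hz hz' x y xy; rewrite (st_actM D) (hz _ _ xy) (hz' _ _ xy) conj_mul. Qed.

Lemma peifferV Dp z : peiffer Dp z -> peiffer Dp z^-1%g.
Proof. by move=> hz x y xy; rewrite act_V (hz _ _ xy) conj_inv. Qed.

Lemma peiffer_s Dp i j a : i.1 != j.1 -> a \in I -> peiffer Dp (sG i j a).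
Proof. by move=> ij aI; apply: (@peiffer_linked predT); exact: linked_s. Qed.

Lemma peiffer_l Dp i a : a \in I -> peiffer Dp (lG i a).
Proof. by move=> aI; apply: (@peiffer_linked predT); exact: linked_l. Qed.

Lemma peiffer_prod Dp (K : Type) (r : seq K) (F : K -> G) :
  (forall k : K, peiffer Dp (F k)) -> peiffer Dp (\prod_(k <- r) F k)%g.
Proof.
move=> hF; apply: big_ind => //; last exact: peifferM.
by move=> x y _; rewrite act_1 mulg1 mulgV.
Qed.

Lemma peiffer_E Dp i v b : (forall j, v j \in I) -> b \in I -> peiffer Dp (E i v b).
Proof.
move=> vI bI; rewrite heisE; apply: peifferM; last exact: peiffer_l.
apply: peiffer_prod => k; rewrite /Eblock; case: eqP => [_|/eqP ki].
  by apply: peiffer_l; apply: idealMl.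
have ik : i.1 != k by rewrite eq_sym.
do !apply: peifferM; [apply: peiffer_s|apply: peiffer_s|apply: peiffer_l] => //.
by rewrite idealN ?idealMl.
Qed.

(** Commutation in G is often easier to see as invariance under the action, which can be computed on
    vectors. *)
Lemma peiffer_fix Dp x y z : linked Dp x y -> peiffer Dp z -> act x z = z -> commute y z.
Proof. by move=> xy hz xz; apply/commuteP; rewrite -(hz _ _ xy). Qed.

Lemma conj_sE p k a q w c : p.1 != k.1 -> p != opi q -> k != opi q -> a \in I ->
  supp I (predC1 (opi q)) w -> c \in I ->
  (sG p k a * E q w c * (sG p k a)^-1)%g = E q (transv (basis R p) (a *: basis R k) 0 w) c.
Proof.
move=> pk pq kq aI hw cI; rewrite -act_sE // -(@peiffer_E predT _ _ _ _ cI (sS p k a) (sG p k a)) //.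
  by move=> j; case: (hw j).
exact: linked_s.
Qed.

Lemma conj_lE p a q w c : p != opi q -> a \in I ->
  supp I (predC1 (opi q)) w -> c \in I ->
  (lG p a * E q w c * (lG p a)^-1)%g = E q (transv (basis R p) 0 a w) c.
Proof.
move=> pq aI hw cI; rewrite -act_lE // -(@peiffer_E predT _ _ _ _ cI (lS p a) (lG p a)) //.
  by move=> j; case: (hw j).
exact: linked_l.
Qed.

Lemma E_commi i v b w c : supp I (predC1 (opi i)) v -> b \in I ->
  supp I (predC1 (opi i)) w -> c \in I -> form v w = 0 -> commute (E i v b) (E i w c).
Proof.
move=> hv bI hw cI vw; rewrite /commute !E_mul // vw formC vw oppr0.
by rewrite [v + w]addrC [b + c]addrC.
Qed.

(** By the Peiffer identity, conjugation by a root element is the action of its counterpart, known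
    from [act_sE] and [act_lE]; [E_transv] extends this to E_k(v, b). The condition on v ensures
    that e_q is fixed. *)
Lemma E_conj k v b q w c : k != opi q ->
  supp I (fun j => (j != opi k) && (j != opi q)) v -> b \in I ->
  supp I (predC1 (opi q)) w -> c \in I ->
  (E k v b * E q w c * (E k v b)^-1)%g = E q (transv (basis R k) v b w) c.
Proof.
move=> kq hv bI hw cI.
pose P y (f : vec R l -> vec R l) := forall w, supp I (predC1 (opi q)) w ->
  supp I (predC1 (opi q)) (f w) /\ (y * E q w c * y^-1)%g = E q (f w) c.
suff /(_ w hw) [] : P (E k v b) (transv (basis R k) v b) by [].
apply: (E_transv (Dp := fun j => (j != opi k) && (j != opi q))) hv bI.
- by rewrite eqxx.
- move=> y y' f f' Pf Pf' u /Pf' [/Pf [hu e] e'].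
  by split=> //=; rewrite -e -e' conj_conj.
- move=> a aI u hu; split.
    by apply: supp_transv => //; [exact: supp_basis1|exact: supp0].
  by rewrite conj_lE.
move=> j a /andP[jk jq] kj aI u hu; split.
  by apply: supp_transv => //; [exact: supp_basis1|apply: suppZ => //; exact: supp_basis1].
by rewrite conj_sE.
Qed.

Lemma E_comm k v b q w c : k != opi q ->
  supp I (fun j => (j != opi k) && (j != opi q)) v -> b \in I ->
  supp I (fun j => (j != opi k) && (j != opi q)) w -> c \in I ->
  form v w = 0 -> commute (E k v b) (E q w c).
Proof.
move=> kq hv bI hw cI vw; apply/commuteP; rewrite E_conj //.
  by rewrite transv_id // form_basisl (suppE hw) ?mulr0 // eqxx.
by apply: suppS hw => j /andP[].
Qed.

(* T(e_i, e_j r) maps e_{-j} to e_{-j} + c e_i. *)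
Lemma act_sE_opp i j r v b (c := eps R j * r) : i.1 != j.1 ->
  supp I (fun k => (k.1 != j.1) && (k != opi i)) v -> b \in I ->
  act (sS i j r) (E (opi j) v b) =
  (E (opi j) v b * E i (c *: v) (c ^+ 2 * b) * sG i (opi j) (c * b))%g.
Proof.
move=> ij hv; move: b; set D0 := (fun k => _) in hv.
have ti d a : a \in I -> d * a \in I := @idealMl _ _ hI d a.
have z0 := ideal0 hI.
have jj : opi j != j by rewrite opi_neq.
have ii : opi i != i by rewrite opi_neq.
have ji : (opi j).1 != i.1 by rewrite eq_sym.
have ij' : i != opi (opi j) by rewrite opiK (contraNneq _ ij) // => ->.
have Dj w : supp I D0 w -> supp I (fun k => (k != opi i) && (k != opi (opi j))) w.
  by apply: suppS => k /andP[kj ki]; apply/andP; split=> //; rewrite opiK; apply: contraNneq kj => ->.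
have Di w : supp I D0 w -> supp I (predC1 (opi i)) w.
  by apply: suppS => k /andP[].
have Dq w : supp I D0 w -> supp I (predC1 (opi (opi j))) w.
  by move/Dj; apply: suppS => k /andP[].
have hib d : d \in I -> supp I (fun k => (k != opi i) && (k != opi (opi j))) (d *: basis R i).
  by move=> dI; apply: supp_basis => //=; rewrite [i == opi i]eq_sym (negPf ii).
have cs w d a b : supp I D0 w -> a \in I -> b \in I ->
    commute (sG i (opi j) a) (E i (d *: w) b) /\ commute (sG i (opi j) a) (E (opi j) w b).
  move=> hw aI bI; have wj : w j = 0 by rewrite (suppE hw) // /D0 eqxx.
  have wi : w (opi i) = 0 by rewrite (suppE hw) // /D0 eqxx andbF.
  rewrite {2}(st_sC D) // -!E_basis //; split; apply: E_commi => //.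
  - by apply: supp_basis; rewrite //= plane_neq // eq_sym.
  - exact/suppZ/Di.
  - by rewrite formZl formZr form_basisl opiK wj !mulr0.
  - by apply: supp_basis; rewrite //= opiK plane_neq.
  - exact: Dq.
  - by rewrite formZl form_basisl wi !mulr0.
have c2 : c ^+ 2 = r ^+ 2 by rewrite /c exprMn [eps R j ^+ 2]expr2 epsK mul1r.
move: v hv; apply: (vec_ind hI) => [b bI|k a /andP[kj ki] aI b bI|v w hv hw Pv Pw b bI].
- by rewrite scaler0 !E0 (st_sl D) // c2 [b * _]mulrC.
- have jk : (opi j).1 != k.1 by rewrite eq_sym.
  have lE d e : d \in I -> e \in I -> (lG (opi j) d * E i (e *: basis R k) 0 = E i (e *: basis R k) 0 * lG (opi j) d)%g.
    move=> dI eI; apply/commute_sym; rewrite -E0; apply: E_comm => //.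
    + by apply: Dj; apply: supp_basis => //=; rewrite /D0 kj ki.
    + exact: supp0.
    + exact: form0r.
  have -> : act (sS i j r) (E (opi j) (a *: basis R k) b) =
     (E (opi j) (a *: basis R k) 0 * E i (c *: (a *: basis R k)) 0 * act (sS i j r) (lG (opi j) b))%g.
    rewrite E_long (st_actM D); congr (_ * _)%g.
    rewrite E_basis // scalerA; case: (eqVneq k i) => [->|ki'].
      by rewrite (st_ss2 D) // E_basis_i ?ti.
    have ik : i.1 != k.1 by rewrite eq_sym plane_neqP.
    by rewrite (st_ss D) 1?eq_sym // E_basis ?ti.
  rewrite (st_sl D) // [in RHS]E_long [E i _ (_ * b)]E_long !mulgA scalerA.
  rewrite c2 [b * _]mulrC; congr (_ * _ * _)%g.
  by rewrite -!mulgA lE ?ti.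
set q := opi j.
have fI : form v w \in I by exact: (form_ideal hI hv (supp_predT hw)).
have bI' : b - form v w \in I by rewrite idealD ?idealN.
have Zv : supp I (predC1 (opi i)) (c *: v) by apply/suppZ/Di.
have Zw : supp I (predC1 (opi i)) (c *: w) by apply/suppZ/Di.
rewrite [E q (v + w) b]E_split //; try exact: Dq.
rewrite (st_actM D) Pv // Pw // !mulr0 sG0 // mulg1.
have -> : E i (c *: (v + w)) (c ^+ 2 * b) =
    (E i (c *: v) (c ^+ 2 * (b - form v w)) * E i (c *: w) 0)%g.
  rewrite scalerDr E_split ?ti //; congr (E i _ _ * _)%g.
  by rewrite formZl formZr; ring.
set A := E q v _; set B := E i (c *: v) _; set W := E q w 0; set B' := E i (c *: w) 0.
(* Moving [B] past [W] costs a short element with parameter c <v, w>; together with the parameter c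
   (b - <v, w>) already present it gives c b. *)
have swap : (B * W = W * sG i q (c * form v w) * B)%g.
  apply: (mulIg B^-1)%g; rewrite mulgK E_conj ?ti //; last exact: Dq.
    have -> : transv (basis R i) (c *: v) (c ^+ 2 * (b - form v w)) w =
        w + (c * form v w) *: basis R i.
      have wi : form (basis R i) w = 0.
        by rewrite form_basisl (suppE hw) ?mulr0 // /D0 eqxx andbF.
      by apply/ffunP => m; rewrite transvE wi formZl !vE; ring.
    rewrite (st_sC D) ?ti // -E_basis ?ti // E_mul ?ti //; last 2 first.
    - exact: Dq.
    - by apply: supp_basis; rewrite ?ti //= opiK plane_neq.
    rewrite formZr form_basisr (suppE hw (j := opi i)) ?mulr0 ?oppr0 ?mulr0 ?addr0 //.
    by rewrite /D0 eqxx andbF.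
  exact/suppZ/Dj.
have [s1B' s1W] := cs w c (c * (b - form v w)) 0 hw (ti _ _ bI') z0.
have [s2B _] := cs v c (c * form v w) (c ^+ 2 * (b - form v w)) hv (ti _ _ fI) (ti _ _ bI').
have [s2B' _] := cs w c (c * form v w) 0 hw (ti _ _ fI) z0.
rewrite -/B in s2B; rewrite -/B' in s2B' s1B'; rewrite -/W in s1W.
rewrite /q in swap *; rewrite -!mulgA (mulgA (sG _ _ _) W) s1W -!mulgA s1B' (mulgA B) swap -!mulgA; do 2!congr (_ * _)%g.
rewrite !mulgA s2B -!mulgA; congr (_ * _)%g; rewrite mulgA s2B' -mulgA; congr (_ * _)%g.
by rewrite -(st_sD D) ?ti //; congr (sG _ _ _); ring.
Qed.

End DataTheory.

Definition cj (G : groupType) (x y : G) : G := (x * y * x^-1)%g.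

(** * Heisenberg elements of the acting group S and their effect on G *)

Section TwoData.
Variables (R : comPzRingType) (l : nat) (I : {pred R}) (S G : groupType).
Variables (sS : idx l -> idx l -> R -> S) (lS : idx l -> R -> S).
Variables (act : S -> G -> G).
Variables (sG : idx l -> idx l -> R -> G) (lG : idx l -> R -> G).
Hypothesis hI : is_ideal I.
Hypothesis HS : stdata predT sS lS (@cj S) sS lS.
Hypothesis HG : stdata I sS lS act sG lG.
Implicit Types (i j k p q m n : idx l) (a b c r : R) (u v w : vec R l) (x : S) (y z : G).

Let hR := @ideal_predT R.
Local Notation E := (heis sG lG).
Local Notation X := (heis sS lS).
Local Notation linked := (linked I sS lS sG lG).

Lemma X_actE q k v b w c : q != opi k ->
  supp predT (fun j => (j != opi q) && (j != opi k)) v ->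
  supp I (predC1 (opi k)) w -> c \in I ->
  act (X q v b) (E k w c) = E k (transv (basis R q) v b w) c.
Proof.
move=> qk hv hw cI.
pose P x (f : vec R l -> vec R l) := forall w, supp I (predC1 (opi k)) w ->
  supp I (predC1 (opi k)) (f w) /\ act x (E k w c) = E k (f w) c.
suff /(_ w hw) [] : P (X q v b) (transv (basis R q) v b) by [].
apply: (E_transv hR HS (Dp := fun j => (j != opi q) && (j != opi k))) hv isT.
- by rewrite eqxx.
- move=> x x' f f' Pf Pf' u /Pf' [/Pf [hu e] e'].
  by split=> //=; rewrite -e -e' (st_actA HG).
- move=> a _ u hu; split; last by rewrite (act_lE hI HG).
  by apply: supp_transv => //; [exact: supp_basis1|exact: supp0].
move=> j a /andP[jq jk] qj _ u hu; split; last by rewrite (act_sE hI HG).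
by apply: supp_transv => //; [exact: supp_basis1|apply: suppZ => //; exact: supp_basis1].
Qed.

Lemma X_act_fix q v b y (Dp : pred (idx l)) : ~~ Dp (opi q) -> supp predT Dp v ->
  (forall j r, Dp j -> q.1 != j.1 -> act (sS q j r) y = y) ->
  (forall r, act (lS q r) y = y) -> act (X q v b) y = y.
Proof.
move=> Dq hv hs hl; pose P x (f : vec R l -> vec R l) := act x y = y.
apply: (E_transv hR HS (P := P) Dq _ _ _ hv isT).
- by move=> x x' f f' e e'; rewrite /P (st_actA HG) e' e.
- by move=> r _; exact: hl.
- by move=> j r Dj qj _; exact: hs.
Qed.

Lemma X_inv q v b : supp predT (predC1 (opi q)) v -> (X q v b)^-1%g = X q (- v) (- b).
Proof.
move=> hv; apply/(mulgI (X q v b)); rewrite mulgV (E_mul hR HS) //; last exact: suppN.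
by rewrite !subrr formNr form_alt oppr0 addr0 (E0 hR HS) (lG0 hR HS).
Qed.

Lemma linked_E (Dp : pred (idx l)) q v b : Dp q ->
  supp I (fun j => Dp j && (j != opi q)) v -> b \in I -> linked Dp (X q v b) (E q v b).
Proof.
move=> Dq hv; move: b.
have sub w : supp I (fun j => Dp j && (j != opi q)) w -> supp I (predC1 (opi q)) w.
  by apply: suppS => j /andP[].
move: v hv; apply: (vec_ind hI) => [b bI|j a /andP[Dj jq] aI b bI|v w hv hw Pv Pw b bI].
- by rewrite (E0 hR HS) (E0 hI HG); exact: linked_l.
- rewrite [X _ _ _](E_long hR HS) (E_long hI HG); apply: linked_M; last exact: linked_l.
  case: (eqVneq j q) => [->|jq'].
    by rewrite (E_basis_i hR HS) // (E_basis_i hI HG) //; apply: linked_l; rewrite // idealMl.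
  have qj : q.1 != j.1 by rewrite eq_sym plane_neqP.
  by rewrite (E_basis hR HS) // (E_basis hI HG) //; exact: linked_s.
have fI := form_ideal hI hv (supp_predT hw).
rewrite (E_split hI HG) //; try exact: sub.
rewrite (E_split hR HS) //; try exact/(@supp_predT _ _ I)/sub.
by apply: linked_M; [apply: Pv; rewrite idealD ?idealN|apply: Pw; exact: ideal0].
Qed.

(** The e_m with m different from -q span the orthogonal complement of e_q, which T(e_q, v, b)
    preserves; accordingly no root element involving e_{-q} appears when the relations are
    applied. *)
Lemma linked_act q v b x y : supp predT (predC1 (opi q)) v ->
  linked (predC1 (opi q)) x y -> linked (predC1 (opi q)) (cj (X q v b) x) (act (X q v b) y).
Proof.
move=> hv xy; set Dq := predC1 (opi q).
pose P x0 (f : vec R l -> vec R l) := forall x y, linked Dq x y ->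
   linked Dq (cj x0 x) (act x0 y).
have qq : Dq q by rewrite /Dq /= eq_sym opi_neq.
apply: (E_transv hR HS (P := P) (Dp := Dq)) hv isT _ _ xy.
- by rewrite /Dq /= eqxx.
- move=> x0 x1 f0 f1 h0 h1 x' y' /h1 /h0.
  by rewrite /cj !gnorm (st_actA HG).
- move=> r _ x' y'; elim=> [m n a mn aI Dm Dn|m a aI Dm||x1 x2 y1 y2 _ IH1 _ IH2].
  + by rewrite (st_ls0 HS) // (st_ls0 HG) //; exact: linked_s.
  + by rewrite (st_ll0 HS) // (st_ll0 HG) //; exact: linked_l.
  + by rewrite (act_1 HS) (act_1 HG); exact: linked_1.
  + by rewrite (st_actM HS) (st_actM HG); exact: linked_M.
move=> j r Dj qj _ x' y'; elim=> [m n a mn aI Dm Dn|m a aI Dm||x1 x2 y1 y2 _ IH1 _ IH2].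
(* At most one of m, n is -j, since they lie in different planes; by symmetry it may be taken to be
   m. *)
- wlog mj : m n mn Dm Dn / n != opi j.
    move=> wl; case: (eqVneq n (opi j)) => [nj|]; last exact: wl.
    rewrite (st_sC HS (i := m)) // (st_sC HG) //; apply: wl => //; first by rewrite eq_sym.
    by apply: contraNneq mn => ->; rewrite nj.
  have ti c := idealMl hI c aI.
  case: (eqVneq m (opi j)) => [mj'|mj']; last first.
    by rewrite (st_ss0 HS) // (st_ss0 HG) //; exact: linked_s.
  subst m; case: (eqVneq n q) => [->|nq].
    rewrite (st_ss2 HS) // (st_ss2 HG) //.
    by apply: linked_M; [apply: linked_s|apply: linked_l]; rewrite ?idealMl ?ti // eq_sym.
  have nj1 : n.1 != j.1 by rewrite eq_sym.
  have nq1 : n.1 != q.1 by apply: plane_neqP.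
  rewrite (st_ss HS) // (st_ss HG) //.
  by apply: linked_M; apply: linked_s; rewrite ?ti // eq_sym.
- case: (eqVneq m (opi j)) Dm => [->|mj] Dm; last first.
    by rewrite (st_sl0 HS) // (st_sl0 HG) //; exact: linked_l.
  rewrite (st_sl HS) // (st_sl HG) //.
  by do !apply: linked_M; [apply: linked_l|apply: linked_l|apply: linked_s];
    rewrite // ?[a * _]mulrC ?idealMl.
- by rewrite (act_1 HS) (act_1 HG); exact: linked_1.
- by rewrite (st_actM HS) (st_actM HG); exact: linked_M.
Qed.

End TwoData.

(** * Long root elements T(u, 0, a) for all vectors u *)

(* An element of S that maps e_i to e_i + w, for w orthogonal to e_i, e_{-i}. *)
Definition xe (R : comPzRingType) (l : nat) (S : groupType)
    (sS : idx l -> idx l -> R -> S) (lS : idx l -> R -> S) (i : idx l) (w : vec R l) : S :=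
  heis sS lS (opi i) (eps R (opi i) *: w) 0.

(* T(w, 0, a), solved from T(e_i + w, 0, a) = T(e_i, 0, a) T(w, 0, a) T(e_i, a w, 0) *)
HB.lock Definition perp_long (R : comPzRingType) (l : nat) (S G : groupType)
    (sS : idx l -> idx l -> R -> S) (lS : idx l -> R -> S) (act : S -> G -> G)
    (sG : idx l -> idx l -> R -> G) (lG : idx l -> R -> G) (i : idx l) (w : vec R l) (a : R) : G :=
  ((lG i a)^-1 * act (xe sS lS i w) (lG i a) * (heis sG lG i (a *: w) 0)^-1)%g.

Section Long.
Variables (R : comPzRingType) (l : nat) (I : {pred R}) (S G : groupType).
Variables (sS : idx l -> idx l -> R -> S) (lS : idx l -> R -> S).
Variables (act : S -> G -> G).
Variables (sG : idx l -> idx l -> R -> G) (lG : idx l -> R -> G).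
Hypothesis hl : (3 <= l)%N.
Hypothesis hI : is_ideal I.
Hypothesis HS : stdata predT sS lS (@cj S) sS lS.
Hypothesis HG : stdata I sS lS act sG lG.
Implicit Types (i j k p q m n : idx l) (a b c r s t : R) (u v w : vec R l) (x : S) (y z : G).

Let hR := @ideal_predT R.
Local Notation E := (heis sG lG).
Local Notation X := (heis sS lS).
Local Notation linked := (linked I sS lS sG lG).
Local Notation peiffer := (peiffer I sS lS act sG lG).
Local Notation "i _|_ w" := (supp predT (perp i) w) (at level 70).

Local Notation xe := (xe sS lS).
Local Notation Z := (perp_long sS lS act sG lG).

Lemma xeE i w : xe i w = X (opi i) (eps R (opi i) *: w) 0.
Proof. by []. Qed.

Lemma ZE i w a :
  Z i w a = ((lG i a)^-1 * act (xe i w) (lG i a) * (E i (a *: w) 0)^-1)%g.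
Proof. by rewrite [in LHS]unlock. Qed.

Lemma Z_eq i w a : act (xe i w) (lG i a) = (lG i a * Z i w a * E i (a *: w) 0)%g.
Proof. by rewrite ZE !gnorm. Qed.

Lemma cj_eq (x x' x'' : S) : cj x x' = x'' <-> (x * x' = x'' * x)%g.
Proof. by split=> [<-|e]; rewrite /cj ?mulgVK // e mulgK. Qed.

Lemma act_cj x x' y : act x (act x' y) = act (cj x x') (act x y).
Proof. by rewrite -!(st_actA HG) /cj mulgVK. Qed.

Lemma suppZI i w a : a \in I -> i _|_ w -> supp I (perp i) (a *: w).
Proof. exact: suppZl. Qed.

Lemma xe0 i : xe i 0 = 1%g.
Proof. by rewrite !xeE scaler0 (E0 hR HS) (lG0 hR HS). Qed.

Lemma xeD i w w' : i _|_ w -> i _|_ w' -> form w w' = 0 ->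
  xe i (w + w') = (xe i w * xe i w')%g.
Proof.
move=> hw hw' ww; rewrite !xeE (E_mul hR HS) //; first by rewrite formZl formZr ww !mulr0 !addr0 scalerDr.
- by apply/suppZ/perp_predC1N.
- by apply/suppZ/perp_predC1N.
Qed.

Lemma xe_actE i w k v b : i _|_ w -> k _|_ w -> k != i ->
  supp I (predC1 (opi k)) v -> b \in I ->
  act (xe i w) (E k v b) =
  E k (v + v i *: w + (eps R (opi i) * form w v) *: basis R (opi i)) b.
Proof.
move=> iw kw ki hv bI; rewrite (X_actE hI HS HG) //.
- congr (E k _ b); apply/ffunP => m; rewrite !(transvE, vE) formZl form_basisl opiK.
  by rewrite [eps R _ * _ * (eps R _ * _)]mulrACA epsK; ring.
- by rewrite -(inj_eq (can_inj (@opiK l))) !opiK eq_sym.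
- by apply: suppZ => //; apply: supp2; [exact: (perp_predC1N (i := opi i))|exact: perp_predC1N].
Qed.

Lemma xe_act_s i w k a : i.1 != k.1 -> i _|_ w -> k _|_ w -> a \in I ->
  act (xe i w) (sG k i a) = (sG k i a * E k (a *: w) 0)%g.
Proof.
move=> ik iw kw aI; have ki : k.1 != i.1 by rewrite eq_sym.
rewrite -(E_basis hI HG) // xe_actE //; try exact: ideal0; last first.
- by apply: supp_basis => //=; rewrite plane_neq.
- by apply: contraNneq ik => ->.
rewrite formZr (perp_formr iw) !mulr0 scale0r addr0 !vE eqxx mulr1.
rewrite (E_mul hI HG) ?ideal0 //.
- by rewrite formZl formZr (perp_forml iw) !mulr0 !addr0.
- by apply: supp_basis => //=; rewrite plane_neq.
- exact/perp_predC1N/suppZI.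
Qed.

Lemma xe_act_l i w k a : k != i -> i _|_ w -> k _|_ w -> a \in I ->
  act (xe i w) (lG k a) = lG k a.
Proof.
move=> ki iw kw aI; rewrite -(E0 hI HG) xe_actE //; last exact: supp0.
by rewrite form0r mulr0 !vE !scale0r !addr0.
Qed.

(* X = s(-i, j, eps_{-i}) maps e_i to e_i + e_j; comparing the images of T(e_i + e_j, 0, a) *)
(* under x_i(w) and x_j(w) gives Z_i = Z_j. *)
Lemma lG_Z_comm i j w a b : i.1 != j.1 -> i _|_ w -> j _|_ w -> a \in I -> b \in I ->
  commute (lG j a) (Z i w b).
Proof.
move=> ij iw jw aI bI; have ji : j != i by apply: contraNneq ij => ->.
have jiN : j != opi i by rewrite plane_neq // eq_sym.
have ll : commute (lG j a) (lG i b) by apply: (lG_cent_l HG) => //; rewrite plane_neq.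
rewrite ZE; apply: commuteM; first apply: commuteM.
- exact: commuteV.
- have e := xe_act_l ji iw jw aI.
  by rewrite /commute -e -!(st_actM HG) ll.
apply/commuteV; rewrite -(E0 hI HG); apply: (E_comm hI HG) => //.
- exact: supp0.
- by apply: supp2; apply/perp_predC1N/suppZI.
- exact: ideal0.
- exact: form0l.
Qed.

(** Both x_i(w) and x_j(w) send e_i + e_j to e_i + e_j + w, so they should agree on T(e_i + e_j, 0,
    a), which is T(e_i, 0, a) moved by [x0]. Expanding the two images and cancelling commuting
    factors leaves the two versions of T(w, 0, a). *)
Lemma Z_plane i j w a : i.1 != j.1 -> i _|_ w -> j _|_ w -> a \in I -> Z i w a = Z j w a.
Proof.
move=> ij iw jw aI; have ji : j.1 != i.1 by rewrite eq_sym.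
have z0 := ideal0 hI.
have iN : i != opi j by rewrite plane_neq.
have jN : j != opi i by rewrite plane_neq.
have iNj : opi i != j by rewrite opi_eq.
have ii : opi i != i by rewrite opi_neq.
have jne : j != i by apply: contraNneq ij => ->.
have ine : i != j by apply: contraNneq ij => ->.
pose x0 := sS j (opi i) (eps R (opi i)).
have x0l : act x0 (lG i a) = (lG i a * lG j a * sG j i a)%g.
  have := st_sl HG (i := j) (j := opi i) (eps R (opi i)) ji aI.
  by rewrite opiK expr2 epsK mulr1 mul1r.
have c1 : cj x0 (xe i w) = xe i w.
  rewrite !xeE (act_sE hR HS) ?opiK //; last by apply/suppZ/perp_predC1.
  rewrite transv_id //; first by rewrite formZr (perp_forml jw) mulr0.
  by rewrite formZl formZr (perp_forml (i := opi i) iw) !mulr0.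
have c2 : cj x0 (xe j w) = (xe j w * xe i (- w))%g.
  rewrite /x0 (st_sSC HS) // /xe (act_sE_opp hR HS) //.
    rewrite !mulr0 (sG0 hR HS) // mulg1 scalerA scalerN -scaleNr.
    congr (_ * X _ (_ *: _) _)%g.
    by rewrite [eps R (opi j)]epsN mulrN mulrAC epsK mul1r.
  by apply: suppZ => //; apply: suppI => //; rewrite opiK; exact: perp_predC1.
have com : commute (xe i w) (xe j w).
  apply: (E_comm hR HS); rewrite ?opiK //.
  - by apply: supp2; apply/suppZ/perp_predC1.
  - by apply: supp2; apply/suppZ/perp_predC1.
  - by rewrite formZl formZr form_alt !mulr0.
have e1 : (x0 * (xe j w * xe i w) = xe j w * x0)%g.
  apply/cj_eq; rewrite (st_actM HS) c2 c1 -mulgA -xeD ?addNr ?xe0 ?mulg1 //.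
    exact: suppN.
  by rewrite formNl form_alt oppr0.
(* Since x_j(w) fixes T(e_i, 0, a) and [x0] commutes with x_i(w), both sides are the image of T(e_i,
   0, a) under [x0] times x_i(w). *)
have e2 : act (xe j w) (act x0 (lG i a)) = act (xe i w) (act x0 (lG i a)).
  rewrite -!(st_actA HG) -e1 -com !(st_actA HG) (xe_act_l ine jw iw) //.
  by rewrite -!(st_actA HG); move/cj_eq: c1 => ->.
move: e2; rewrite x0l !(st_actM HG) (xe_act_l ine jw iw) // (xe_act_l jne iw jw) //.
rewrite !Z_eq (xe_act_s ij iw jw) // (st_sC HG) // (xe_act_s ji jw iw) //.
rewrite -!mulgA => /mulgI.
have lZ : commute (lG j a) (Z i w a) by apply: lG_Z_comm.
set li := lG j a; set Ei := E i _ 0; set Ej := E j _ 0; set sij := sG _ _ a.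
have Iw k : k _|_ w -> supp I (predC1 (opi k)) (a *: w) by move=> kw; apply/perp_predC1N/suppZI.
have sj : commute sij Ej.
  rewrite /sij 1?(st_sC HG) // -(E_basis hI HG) //.
  apply: (E_commi hI HG) => //; first by apply: supp_basis => //=; rewrite plane_neq.
  - exact: Iw.
  - by rewrite formZl formZr (perp_forml iw) !mulr0.
have si : commute sij Ei.
  rewrite /sij -(E_basis hI HG) //.
  apply: (E_commi hI HG) => //; first by apply: supp_basis => //=; rewrite plane_neq.
  - exact: Iw.
  - by rewrite formZl formZr (perp_forml jw) !mulr0.
have ij' : commute Ei Ej.
  apply: (E_comm hI HG) => //.
  - by apply: supp2; apply: Iw.
  - by apply: supp2; apply: Iw.
  - by rewrite formZl formZr form_alt !mulr0.
have jl : commute li Ei.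
  rewrite /li -(E0 hI HG); apply: (E_comm hI HG) => //.
  - exact: supp0.
  - by apply: supp2; apply: Iw.
  - exact: form0l.
have -> : (Ei * (li * (sij * Ej)) = li * (Ej * (sij * Ei)))%g.
  by rewrite mulgA -jl -mulgA sj (mulgA Ei) ij' -mulgA -si.
by rewrite [in RHS]mulgA -lZ -mulgA => /mulgI /mulIg.
Qed.

(** If m lies in the plane of i, the comparison goes through j; in particular i may be replaced by
    -i. *)
Lemma Z_switch i j m w a : i.1 != j.1 -> i _|_ w -> j _|_ w -> m _|_ w -> a \in I ->
  Z i w a = Z m w a.
Proof.
move=> ij iw jw mw aI; case: (eqVneq i.1 m.1) => [im|im]; last exact: Z_plane.
rewrite (Z_plane ij) //; apply: Z_plane; rewrite // -im eq_sym //.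
Qed.

Lemma Z_act (x : S) (f : vec R l -> vec R l) i w a : cj x (xe i w) = xe i (f w) ->
  act x (lG i a) = lG i a -> act x (E i (a *: w) 0) = E i (a *: f w) 0 ->
  act x (Z i w a) = Z i (f w) a.
Proof.
by move=> e el eE; rewrite !ZE !(st_actM HG) !(act_V HG) el eE act_cj e el.
Qed.

Lemma Z_act_s i m n r w a : i _|_ w -> m.1 != n.1 -> m.1 != i.1 -> n.1 != i.1 -> a \in I ->
  act (sS m n r) (Z i w a) = Z i (transv (basis R m) (r *: basis R n) 0 w) a.
Proof.
move=> iw mn mi ni aI; apply: Z_act.
- rewrite !xeE (act_sE hR HS) ?opiK ?transv_lin //; try by rewrite plane_neq.
  by apply: suppZ => //; apply: perp_predC1.
- by rewrite (st_sl0 HG) // plane_neq // eq_sym.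
rewrite (act_sE hI HG) ?transv_lin //; try by rewrite plane_neq.
  exact/perp_predC1N/suppZI.
exact: ideal0.
Qed.

Lemma Z_act_l i m r w a : i _|_ w -> m.1 != i.1 -> a \in I ->
  act (lS m r) (Z i w a) = Z i (transv (basis R m) 0 r w) a.
Proof.
move=> iw mi aI; apply: Z_act.
- rewrite !xeE (act_lE hR HS) ?opiK ?transv_lin //; try by rewrite plane_neq.
  by apply: suppZ => //; apply: perp_predC1.
- by rewrite (st_ll0 HG) // plane_neq // eq_sym.
rewrite (act_lE hI HG) ?transv_lin //; try by rewrite plane_neq.
  exact/perp_predC1N/suppZI.
exact: ideal0.
Qed.

(** The root element does not commute with x_i(w), but the extra factor is an element E_q(w', 0) of
    S, which fixes T(e_i, 0, a). *)
Lemma Z_fix_s_near i q r w a : i.1 != q.1 -> i _|_ w -> q _|_ w -> a \in I ->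
  act (sS i q r) (Z i w a) = Z i w a.
Proof.
move=> iq iw qw aI; have z0 := ideal0 hI.
have iNi : i != opi i by rewrite eq_sym opi_neq.
have iNq : i != opi q by rewrite plane_neq.
have qNi : q != opi i by rewrite plane_neq // eq_sym.
have qi : q.1 != i.1 by rewrite eq_sym.
have sfix : act (sS i q r) (lG i a) = lG i a by rewrite (st_sl0 HG).
pose c := eps R i * r; pose w' := c *: (eps R (opi i) *: w).
have e : (sS i q r * xe i w = xe i w * X q w' 0 * sS i q r)%g.
  apply/cj_eq; rewrite (st_sSC HS) // /xe (act_sE_opp hR HS) //.
    by rewrite !mulr0 (sG0 hR HS) // mulg1.
  apply: suppZ => //; apply: suppI => //; exact: perp_predC1N.
rewrite !ZE !(st_actM HG) !(act_V HG) sfix -(st_actA HG) e !(st_actA HG) sfix.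
have -> : act (X q w' 0) (lG i a) = lG i a.
  rewrite -(E0 hI HG) (X_actE hI HS HG) //; last exact: supp0.
    by rewrite transv_id ?form0r.
  by do 2!apply: suppZ => //; apply: supp2; apply: perp_predC1N.
rewrite (act_sE hI HG) //; last exact/perp_predC1N/suppZI.
by rewrite transv_id ?formZl ?formZr ?(perp_forml iw) ?(perp_forml qw) ?mulr0.
Qed.

Lemma third_plane i j : exists k, k.1 != i.1 /\ k.1 != j.1.
Proof.
have [k hk] : exists k : 'I_l, k \notin [set i.1; j.1]%SET.
  apply/existsP; apply: contraTT hl => /existsPn h; rewrite -ltnNge ltnS.
  have /subset_leq_card : ([set: 'I_l] \subset [set i.1; j.1])%SET.
    by apply/fintype.subsetP => k _; have := h k; rewrite negbK.
  rewrite cardsT card_ord => /leq_trans; apply.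
  by rewrite cards2; case: (_ != _).
by exists (k, false); move: hk; rewrite !inE negb_or => /andP.
Qed.

(** As w is orthogonal to the plane of m as well, T(w, 0, a) may be computed there, which brings the
    root element into the form treated by [Z_fix_s_near]. *)
Lemma Z_fix_s i j m n r w a : i.1 != j.1 -> i _|_ w -> j _|_ w ->
  m.1 != n.1 -> m _|_ w -> n _|_ w -> a \in I -> act (sS m n r) (Z i w a) = Z i w a.
Proof.
by move=> ij iw jw mn mw nw aI; rewrite (Z_switch ij iw jw mw) // Z_fix_s_near.
Qed.

Lemma Z_fix_l i j m r w a : i.1 != j.1 -> i _|_ w -> j _|_ w -> m _|_ w -> a \in I ->
  act (lS m r) (Z i w a) = Z i w a.
Proof.
move=> ij iw jw mw aI.
wlog mi : i j ij iw jw / m.1 != i.1.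
  move=> wl; case: (eqVneq m.1 i.1) => [mi|]; last exact: (wl i j).
  rewrite (Z_switch ij iw jw jw) //; apply: (wl j i); rewrite // ?mi //.
  by rewrite eq_sym.
by rewrite Z_act_l // transv_id ?form0l // (perp_forml mw).
Qed.

Lemma Z_fix_X (Dp : pred (idx l)) i j q v b w a : i.1 != j.1 -> i _|_ w -> j _|_ w ->
  q _|_ w -> (forall k, Dp k -> k _|_ w) -> ~~ Dp (opi q) -> supp predT Dp v -> a \in I ->
  act (X q v b) (Z i w a) = Z i w a.
Proof.
move=> ij iw jw qw Dw Dq hv aI; apply: (X_act_fix HS HG _ Dq hv).
- by move=> k r Dk qk; apply: (Z_fix_s r ij) => //; exact: Dw.
- by move=> r; apply: (Z_fix_l r ij).
Qed.

(** T(e_q, c w, b) fixes w, which is orthogonal to itself and to e_q. Once the plane of i differs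
    from that of q, all three ingredients of Z_i(w, a) are fixed. *)
Lemma Z_fix_X_par i j q c b w a : i.1 != j.1 -> i _|_ w -> j _|_ w -> q _|_ w ->
  a \in I -> act (X q (c *: w) b) (Z i w a) = Z i w a.
Proof.
move=> ij iw jw qw aI.
wlog qi : i j ij iw jw / q.1 != i.1.
  move=> wl; case: (eqVneq q.1 i.1) => [qi|]; last exact: (wl i j).
  rewrite (Z_switch ij iw jw jw) //; apply: (wl j i); rewrite // ?qi //.
  by rewrite eq_sym.
have z0 := ideal0 hI.
have fx u d : form u w = 0 -> form w u = 0 -> transv (basis R q) (c *: w) b (d *: w) = d *: w.
  by move=> _ _; rewrite transv_id // ?formZl ?formZr ?(perp_forml qw) ?form_alt ?mulr0.
have e : cj (X q (c *: w) b) (xe i w) = xe i w.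
  rewrite !xeE (X_actE hR HS HS) ?opiK //.
  - by rewrite (fx 0) ?form0l ?form0r.
  - by apply: contraNneq qi => ->.
  - by apply: suppZ => //; apply: supp2; [apply: perp_predC1N|apply: perp_predC1].
  - by apply: suppZ => //; apply: perp_predC1.
have s2 k : k _|_ w -> supp predT (fun j => (j != opi q) && (j != opi k)) (c *: w).
  by move=> kw; apply: suppZ => //; apply: supp2; apply: perp_predC1N.
have qNi : q != opi i by rewrite plane_neq.
apply: (Z_act (f := id)) => //.
  rewrite -(E0 hI HG) (X_actE hI HS HG) ?transv_id ?form0r //.
  - exact: s2.
  - exact: supp0.
rewrite (X_actE hI HS HG) //; first by rewrite (fx 0) ?form0l ?form0r.
- exact: s2.
- exact/perp_predC1N/suppZI.
Qed.

(** Conjugating by x_i(w), which is an element E_{-i}, keeps linked pairs without index i linked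
    ([linked_act]); so the Peiffer identity for the transform of T(e_i, 0, a) follows from that for
    T(e_i, 0, a). *)
Lemma peiffer_Z_near i w a : i _|_ w -> a \in I -> peiffer (predC1 i) (Z i w a).
Proof.
move=> iw aI; rewrite ZE; apply: (peifferM HG); first apply: (peifferM HG).
- by apply/(peifferV HG)/(peiffer_l HG).
- move=> x y xy; set f := xe i w.
  have fV : f^-1%g = X (opi i) (- (eps R (opi i) *: w)) (- 0).
    apply: (X_inv HS); apply: suppZ => //; exact: perp_predC1N.
  have hw : supp predT (predC1 (opi (opi i))) (- (eps R (opi i) *: w)).
    by apply: suppN => //; apply: suppZ => //; exact: perp_predC1N.
  have := linked_act hI HS HG (- 0) hw (x := x) (y := y).
  rewrite opiK -fV => /(_ xy) h.
  have -> : x = cj f (cj f^-1%g x) by rewrite /cj !gnorm.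
  by rewrite -act_cj (peiffer_l HG i aI h) !(st_actM HG) (act_V HG) !(act_VK HG).
apply/(peifferV HG)/(peiffer_E hI HG); last exact: ideal0.
by move=> j; case: (suppZI aI iw j).
Qed.

(** A generator that involves the index i does not involve -i, so for it T(w, 0, a) is computed from
    -i instead. *)
Lemma peiffer_Z i j w a : i.1 != j.1 -> i _|_ w -> j _|_ w -> a \in I ->
  peiffer predT (Z i w a).
Proof.
move=> ij iw jw aI.
have ni m : m == i -> m != opi i by move/eqP->; rewrite eq_sym opi_neq.
have iNw : opi i _|_ w by [].
have ZN : Z i w a = Z (opi i) w a by apply: (Z_switch ij).
apply: (peiffer_gen HG) => [m n b mn bI _ _|m b bI _].
- case mi : (m == i); last case ni' : (n == i).
  + rewrite ZN; apply: (peiffer_Z_near iNw aI); apply: linked_s => //=; first exact: ni.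
    by apply: contraNneq mn => ->; rewrite (eqP mi).
  + rewrite ZN; apply: (peiffer_Z_near iNw aI); apply: linked_s => //=; last exact: ni.
    by apply: contraNneq mn => ->; rewrite (eqP ni').
  + by apply: (peiffer_Z_near iw aI); apply: linked_s; rewrite //= ?mi ?ni'.
case mi : (m == i).
  by rewrite ZN; apply: (peiffer_Z_near iNw aI); apply: linked_l => //=; exact: ni.
by apply: (peiffer_Z_near iw aI); apply: linked_l; rewrite //= mi.
Qed.

Lemma linked_EX q v b : supp I (predC1 (opi q)) v -> b \in I -> linked predT (X q v b) (E q v b).
Proof. by move=> hv bI; apply: (linked_E hI HS HG). Qed.

Lemma E_Z_comm i j q v b w a : i.1 != j.1 -> i _|_ w -> j _|_ w -> a \in I -> b \in I ->
  supp I (predC1 (opi q)) v -> act (X q v b) (Z i w a) = Z i w a ->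
  commute (E q v b) (Z i w a).
Proof.
move=> ij iw jw aI bI hv e; apply: (peiffer_fix (linked_EX hv bI)) e.
exact: (peiffer_Z ij).
Qed.

Lemma E_Z_comm_par i j q c w a : i.1 != j.1 -> i _|_ w -> j _|_ w -> q _|_ w ->
  a \in I -> c \in I -> commute (E q (c *: w) 0) (Z i w a).
Proof.
move=> ij iw jw qw aI cI; apply: (E_Z_comm ij) => //; first exact: ideal0.
  exact/perp_predC1N/suppZI.
exact: (Z_fix_X_par c _ ij).
Qed.

Lemma E_Z_comm_disj (Dp : pred (idx l)) i j q v b w a : i.1 != j.1 -> i _|_ w -> j _|_ w ->
  q _|_ w -> (forall k, Dp k -> k _|_ w) -> ~~ Dp (opi q) -> supp I Dp v -> b \in I -> a \in I ->
  commute (E q v b) (Z i w a).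
Proof.
move=> ij iw jw qw Dw Dq hv bI aI; apply: (E_Z_comm ij) => //.
  by apply: suppS hv => k; apply: contraTneq => ->.
exact: (Z_fix_X b ij iw jw qw Dw Dq (supp_predT hv)).
Qed.

Lemma Z0 i w : i _|_ w -> Z i w 0 = 1%g.
Proof.
move=> iw; rewrite ZE (lG0 hI HG) (act_1 HG) scale0r (E0 hI HG) (lG0 hI HG).
by rewrite invg1 !mulg1.
Qed.

(** The analogue of [st_ls] with w in place of a basis vector. It is that relation transported by
    x_i(w): E_k(a w, 0) is the quotient of the x_i(w)-image of T(e_k, e_i a, 0) by this element, and
    x_i(w) commutes with the acting long element. The factor [Z] stems from the long factor of
    [st_ls]. *)
Lemma act_l_opp i k r w a : i.1 != k.1 -> i _|_ w -> k _|_ w -> a \in I ->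
  act (lS (opi k) r) (E k (a *: w) 0) =
  (E k (a *: w) 0 * E (opi k) ((eps R (opi k) * r * a) *: w) 0 * Z i w (r * a ^+ 2))%g.
Proof.
move=> ik iw kw aI; have ki : k.1 != i.1 by rewrite eq_sym.
have z0 := ideal0 hI; have ti d : d * a \in I by apply: idealMl.
have raI : r * a ^+ 2 \in I by rewrite expr2 mulrA ti.
have kNw : opi k _|_ w by [].
have com : cj (lS (opi k) r) (xe i w) = xe i w.
  rewrite !xeE (act_lE hR HS) ?opiK //.
  - by rewrite transv_id ?form0l // formZr (perp_forml kNw) mulr0.
  - by rewrite plane_neq.
  - by apply: suppZ => //; apply: perp_predC1.
have Ek : E k (a *: w) 0 = ((sG k i a)^-1 * act (xe i w) (sG k i a))%g.
  by rewrite (xe_act_s ik iw kw) // mulKg.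
set g := eps R (opi k) * r * a.
have e : act (lS (opi k) r) (sG k i a) = (sG k i a * sG (opi k) i g * lG i (r * a ^+ 2))%g.
  by have := st_ls HG (i := opi k) r ki aI; rewrite opiK.
rewrite [in LHS]Ek (st_actM HG) (act_V HG) act_cj com e !(st_actM HG).
rewrite (xe_act_s ik iw kw) // (xe_act_s (k := opi k) ik iw kw) ?ti // Z_eq.
set A := sG k i a; set B := sG _ i g; set C := lG i _; set K := E k _ 0; set K' := E _ _ 0.
set ZZ := Z _ _ _; set Ei := E i _ 0.
have sI m d : m _|_ w -> d \in I -> supp I (predC1 (opi m)) (d *: w).
  by move=> mw dI; apply/perp_predC1N/suppZI.
have EEc m n d d' : m.1 != n.1 -> m _|_ w -> n _|_ w -> d \in I -> d' \in I ->
    commute (E m (d *: w) 0) (E n (d' *: w) 0).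
  move=> mn mw nw dI dI'; apply: (E_comm hI HG) => //; first by rewrite plane_neq.
  - by apply: supp2; apply: sI.
  - by apply: supp2; apply: sI.
  - by rewrite formZl formZr form_alt !mulr0.
have gI : g \in I by rewrite ti.
have cEi : commute (K * K' * C * ZZ)%g Ei.
  do !apply: commuteMl; try exact: EEc.
  - rewrite /C -(E0 hI HG); apply: (E_commi hI HG); rewrite ?form0l //; first exact: supp0.
    exact: sI.
  - by apply/commute_sym; apply: (E_Z_comm_par ik).
have cC : commute (K * K')%g C.
  rewrite /C -(E0 hI HG); apply: commuteMl; apply: (E_comm hI HG); rewrite ?form0r //;
    by [rewrite plane_neq|apply: supp2; apply: sI|exact: supp0].
(* Conjugating [B] by [K] produces E_i with the argument opposite to that of [Ei], so the two
   cancel. *)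
have KB : (K * B * Ei = B * K)%g.
  have e2 : (K * B * K^-1 = B * E i ((- (r * a ^+ 2)) *: w) 0)%g.
    rewrite /B (st_sC HG) // -(E_basis hI HG) // (E_conj hI HG); rewrite ?plane_neq //.
    - rewrite (E_mul hI HG) ?(sI i) ?idealN //.
      + congr (E i _ _); last by rewrite formZl formZr (perp_forml kNw) !mulr0 !addr0.
        apply/ffunP => m; rewrite transvE formZl formZr (perp_formr kNw) formZr form_basisl !vE eqxx.
        transitivity (g * (m == opi k)%:R + (eps R k * eps R (opi k)) * (r * a ^+ 2) * w m).
          by rewrite /g /= !mulr1; ring.
        by rewrite epsN mulrN epsK mulN1r.
      + by apply: supp_basis => //=; rewrite plane_neq.
      + by apply: sI; rewrite ?idealN.
    - by apply: supp2; apply: sI.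
    - by apply: supp_basis => //=; rewrite plane_neq.
  have -> : (K * B = B * E i ((- (r * a ^+ 2)) *: w) 0 * K)%g by rewrite -e2 mulgVK.
  rewrite -!mulgA (EEc k i) // (mulgA (E i _ 0)) (E_mul hI HG) ?(sI i) ?idealN //.
    by rewrite -scalerDl addNr scale0r formZl formZr form_alt !mulr0 !addr0 (E0 hI HG) (lG0 hI HG) mul1g.
  - by apply: sI; rewrite ?idealN.
  - exact: sI.
apply: (mulgI (A * B * C)%g); rewrite mulVKg.
have cK : commute K^-1%g Ei by apply: commuteVl; apply: EEc.
have KBK : (K * B * K^-1 * Ei = B)%g by rewrite -mulgA cK mulgA KB mulgK.
transitivity (A * (K * B * K^-1) * ((K * K' * C * ZZ) * Ei))%g; first by rewrite !gnorm.
by rewrite cEi -[in RHS]KBK -!mulgA (mulgA K K') (mulgA _ C) cC !gnorm.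
Qed.

End Long.

(** * Expanding T(x + w, 0, a) for x in a hyperbolic plane and w orthogonal to it *)

HB.lock Definition hyper (R : comPzRingType) (l : nat) (i : idx l) (p q : R) : vec R l :=
  p *: basis R i + q *: basis R (opi i).

(* T(x, a w, 0) for x = hyper i p q *)
HB.lock Definition hyper_short (R : comPzRingType) (l : nat) (S G : groupType)
    (sS : idx l -> idx l -> R -> S) (lS : idx l -> R -> S) (act : S -> G -> G)
    (sG : idx l -> idx l -> R -> G) (lG : idx l -> R -> G)
    (i : idx l) (p q : R) (w : vec R l) (a : R) : G :=
  (heis sG lG i ((p * a) *: w) 0 * heis sG lG (opi i) ((q * a) *: w) 0
   * perp_long sS lS act sG lG i w (- (eps R i * p * q * a ^+ 2)))%g.

Section Transvections.
Variables (R : comPzRingType) (l : nat) (I : {pred R}) (S G : groupType).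
Variables (sS : idx l -> idx l -> R -> S) (lS : idx l -> R -> S).
Variables (act : S -> G -> G).
Variables (sG : idx l -> idx l -> R -> G) (lG : idx l -> R -> G).
Hypothesis hl : (3 <= l)%N.
Hypothesis hI : is_ideal I.
Hypothesis HS : stdata predT sS lS (@cj S) sS lS.
Hypothesis HG : stdata I sS lS act sG lG.
Implicit Types (i j k m n : idx l) (a b c r s t p q : R) (u v w : vec R l) (x : S) (y z : G).

Let hR := @ideal_predT R.
Local Notation E := (heis sG lG).
Local Notation X := (heis sS lS).
Local Notation "i _|_ w" := (supp predT (perp i) w) (at level 70).

Local Notation xe := (xe sS lS).
Local Notation Z := (perp_long sS lS act sG lG).
Local Notation Z_eq := (Z_eq sS lS act sG lG).

Local Notation F := (hyper_short sS lS act sG lG).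

Lemma hyperV i (p q : R) : hyper i p q = p *: basis R i + q *: basis R (opi i).
Proof. by rewrite unlock. Qed.

Lemma hyperE i (p q : R) j : hyper i p q j = p * (j == i)%:R + q * (j == opi i)%:R.
Proof. by rewrite hyperV !vE. Qed.

Lemma FE i (p q : R) w a : F i p q w a = (E i ((p * a) *: w) 0 * E (opi i) ((q * a) *: w) 0
  * Z i w (- (eps R i * p * q * a ^+ 2)))%g.
Proof. by rewrite [in LHS]unlock. Qed.

Lemma hyper_supp J i (p q : R) : is_ideal J -> p \in J -> q \in J ->
  supp J (fun j => j.1 == i.1) (hyper i p q).
Proof. by move=> hJ pJ qJ; rewrite hyperV; apply: suppD => //; apply: supp_basis => //=. Qed.

Lemma hyper_perp i k (p q : R) : i.1 != k.1 -> k _|_ hyper i p q.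
Proof.
by move=> ik; apply: suppS (hyper_supp i hR isT isT) => j /eqP ji; rewrite unfold_in /perp ji.
Qed.

Lemma form_hyper i (p q : R) w : i _|_ w -> form (hyper i p q) w = 0.
Proof.
by move=> iw; rewrite hyperV formDl !formZl (perp_forml iw) (perp_forml (i := opi i) iw) !mulr0 addr0.
Qed.

Lemma xe_hyper i k (p q : R) : i.1 != k.1 -> xe k (hyper i p q) =
  (sS i (opi k) (eps R (opi k) * p) * sS (opi i) (opi k) (eps R (opi k) * q)
   * lS (opi k) (- (eps R i * p * q)))%g.
Proof.
move=> ik; have ki : k.1 != i.1 by rewrite eq_sym.
have fe : form ((eps R (opi k) * p) *: basis R i) ((eps R (opi k) * q) *: basis R (opi i)) =
    eps R i * p * q.
  rewrite formZl formZr form_basisl !vE eqxx.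
  transitivity ((eps R (opi k) * eps R (opi k)) * (eps R i * p * q)).
    by rewrite mulr1; ring.
  by rewrite epsK mul1r.
rewrite xeE hyperV scalerDr !scalerA (E_split hR HS) //; last 2 first.
- by apply: supp_basis => //=; rewrite plane_neq // eq_sym.
- by apply: supp_basis => //=; rewrite plane_neq // eq_sym.
rewrite fe add0r (E_basis hR HS) // (E_long hR HS) (E_basis hR HS) // -mulgA.
rewrite (st_sSC HS (i := i)) // (st_sSC HS (i := opi i)) // -mulgA; congr (_ * _)%g.
by apply: (lG_cent_s HS); rewrite ?opiK ?opi_neq ?plane_neq.
Qed.

(** Since x_k(x) sends e_k to e_k + x, the left-hand side is T(e_k + x, a w, 0), and the new factor
    is T(x, a w, 0). This describes F through the action, which is how [FD] and [F_Z_comm] are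
    obtained. *)
Lemma xe_hyper_act_E i k (p q : R) w a : i.1 != k.1 -> i _|_ w -> k _|_ w -> a \in I ->
  act (xe k (hyper i p q)) (E k (a *: w) 0) = (E k (a *: w) 0 * F i p q w a)%g.
Proof.
move=> ik iw kw aI; have ki : k.1 != i.1 by rewrite eq_sym.
have z0 := ideal0 hI; have ti d : d * a \in I by apply: idealMl.
have a2I d : d * a ^+ 2 \in I by rewrite expr2 mulrA ti.
have iNk : i != k by apply: contraNneq ik => ->.
have kNw : opi k _|_ w by []. have iNw : opi i _|_ w by [].
have sI m d : m _|_ w -> d \in I -> supp I (predC1 (opi m)) (d *: w).
  by move=> mw dI; apply/perp_predC1N/suppZI.
have sIk m n d : m _|_ w -> n _|_ w -> d \in I ->
   supp I (fun k => (k.1 != m.1) && (k != opi n)) (d *: w).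
  by move=> mw nw dI; apply: suppI; [apply: suppZI|apply: sI].
have fixE m n n' d r : m.1 != n.1 -> m != opi n' -> n != opi n' -> m _|_ w -> n _|_ w -> n' _|_ w ->
    d \in I -> act (sS m n r) (E n' (d *: w) 0) = E n' (d *: w) 0.
  move=> mn mq nq mw nw qw dI; rewrite (act_sE hI HG) //; last exact: sI.
  by rewrite transv_id // !(formZl, formZr) ?(perp_forml mw) ?(perp_forml nw) ?mulr0.
rewrite xe_hyper // !(st_actA HG) (act_l_opp hI HS HG _ ik) // !(st_actM HG).
set c1 := eps R (opi k) * - (eps R i * p * q) * a.
set c2 := - (eps R i * p * q) * a ^+ 2.
have c1I : c1 \in I by exact: ti. have c2I : c2 \in I by exact: a2I.
have opp m n r d : m.1 != n.1 -> m _|_ w -> n _|_ w -> d \in I ->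
   act (sS m n r) (E (opi n) (d *: w) 0) =
   (E (opi n) (d *: w) 0 * E m ((eps R n * r * d) *: w) 0)%g.
  move=> mn mw nw dI; rewrite (act_sE_opp hI HG) //; last exact: sIk.
  by rewrite !mulr0 (sG0 hI HG) // mulg1 scalerA.
have -> : act (sS (opi i) (opi k) (eps R (opi k) * q)) (E k (a *: w) 0) =
    (E k (a *: w) 0 * E (opi i) ((q * a) *: w) 0)%g.
  by have := opp (opi i) (opi k) (eps R (opi k) * q) a ik iNw kNw aI; rewrite opiK !mulrA epsK mul1r.
rewrite (Z_fix_s hI HS HG _ ik) // fixE ?opiK ?opi_neq ?plane_neq //.
rewrite (Z_fix_s hI HS HG _ ik) // fixE ?opiK ?opi_neq ?plane_neq // !(st_actM HG).
have -> : act (sS i (opi k) (eps R (opi k) * p)) (E k (a *: w) 0) =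
    (E k (a *: w) 0 * E i ((p * a) *: w) 0)%g.
  by have := opp i (opi k) (eps R (opi k) * p) a ik iw kNw aI; rewrite opiK !mulrA epsK mul1r.
rewrite (st_sSC HS) // opp ?ti //.
have -> : eps R i * (eps R (opi k) * p) * (q * a) = - c1 by rewrite /c1; ring.
rewrite FE -!mulgA (mulgA (E (opi k) _ _)) (E_mul hI HG) //; try by apply: sI; rewrite ?idealN.
rewrite -scalerDl addNr scale0r formZl formZr form_alt !mulr0 !addr0 (E0 hI HG) (lG0 hI HG) mul1g.
by rewrite /c2 mulNr.
Qed.

Lemma F_comm i (p q : R) w a y : a \in I ->
  (forall c, c \in I -> commute (E i (c *: w) 0) y) ->
  (forall c, c \in I -> commute (E (opi i) (c *: w) 0) y) ->
  (forall c, c \in I -> commute (Z i w c) y) -> commute (F i p q w a) y.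
Proof.
move=> aI h1 h2 h3; rewrite FE; apply: commuteMl; first apply: commuteMl.
- by apply: h1; apply: idealMl.
- by apply: h2; apply: idealMl.
- by apply: h3; rewrite idealN // expr2 mulrA idealMl.
Qed.

Lemma EE_comm i k w a b : i.1 != k.1 -> i _|_ w -> k _|_ w -> a \in I -> b \in I ->
  commute (E i (a *: w) 0) (E k (b *: w) 0).
Proof.
move=> ik iw kw aI bI; have sI m d : m _|_ w -> d \in I -> supp I (predC1 (opi m)) (d *: w).
  by move=> mw dI; apply/perp_predC1N/suppZI.
apply: (E_comm hI HG); rewrite ?plane_neq ?ideal0 //.
- by apply: supp2; apply: sI.
- by apply: supp2; apply: sI.
- by rewrite formZl formZr form_alt !mulr0.
Qed.

Lemma E_F_comm i k (p q : R) w a b : i.1 != k.1 -> i _|_ w -> k _|_ w -> a \in I -> b \in I ->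
  commute (F i p q w a) (E k (b *: w) 0).
Proof.
move=> ik iw kw aI bI; apply: F_comm => // c cI.
- exact: EE_comm.
- exact: EE_comm.
- by apply/commute_sym; apply: (E_Z_comm_par hI HS HG ik).
Qed.

(** As x and w are orthogonal, x_k(x + w) = x_k(x) x_k(w). Applying the two factors in turn to
    T(e_k, 0, a) produces F when x_k(x) meets E_k(a w, 0). *)
Lemma Z_split i k (p q : R) w a : i.1 != k.1 -> i _|_ w -> k _|_ w -> a \in I ->
  Z k (hyper i p q + w) a = (Z k (hyper i p q) a * Z k w a * F i p q w a)%g.
Proof.
move=> ik iw kw aI; set x := hyper i p q.
have ki : k.1 != i.1 by rewrite eq_sym.
have z0 := ideal0 hI; have ti d : d * a \in I by apply: idealMl.
have kx : k _|_ x by apply: hyper_perp.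
have iNw : opi i _|_ w by [].
have sI m u d : m _|_ u -> d \in I -> supp I (predC1 (opi m)) (d *: u).
  by move=> mw dI; apply/perp_predC1N/suppZI.
have xw : form x w = 0 by apply: form_hyper.
have hx : supp predT (fun j => j.1 == i.1) x by apply: hyper_supp.
have Dw j : j.1 == i.1 -> j _|_ w by move/eqP=> ji; rewrite /perp ji.
have fixZ : act (xe k x) (Z k w a) = Z k w a.
  apply: (Z_fix_X hI HS HG _ ki kw iw (Dp := fun j => j.1 == i.1)) => //.
  exact: suppZ.
have EZ : commute (E k (a *: x) 0) (Z k w a).
  apply: (E_Z_comm_disj hI HS HG ki kw iw kw (Dp := fun j => j.1 == i.1)) => //.
  exact: suppZl.
have ExEw : E k (a *: (x + w)) 0 = (E k (a *: x) 0 * E k (a *: w) 0)%g.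
  by rewrite scalerDr (E_split hI HG) ?formZl ?formZr ?xw ?mulr0 ?subr0 //; apply: sI.
(* The factors E_i and E_{-i} of F shift the argument a x by multiples of w with coefficients eps_i
   p q a^2 and its negative. *)
have EF : commute (F i p q w a) (E k (a *: x) 0).
  have hc m c d u : m.1 = i.1 -> c \in I -> d \in I -> k _|_ u -> form w u = 0 ->
     (E m (c *: w) 0 * E k (a *: u + d *: w) 0 * (E m (c *: w) 0)^-1)%g =
     E k (a *: u + (d + eps R m * u (opi m) * a * c) *: w) 0.
    move=> mi cI dI ku wu; have mw : m _|_ w by apply: Dw; rewrite mi.
    rewrite (E_conj hI HG) ?plane_neq ?mi //.
    - congr (E k _ _); apply/ffunP => j; rewrite transvE !(formZl, formZr, formDr).
      rewrite wu form_alt (perp_forml mw) form_basisl !vE; ring.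
    - by apply: supp2; apply: sI.
    - by apply: suppD => //; apply: sI.
  have xi : x i = p by rewrite hyperE eqxx [i == _]eq_sym opi_neq mulr0 addr0 mulr1.
  have xNi : x (opi i) = q by rewrite hyperE eqxx opi_neq mulr0 add0r mulr1.
  rewrite FE; apply: commuteMl; last first.
    apply/commute_sym; apply: (E_Z_comm_disj hI HS HG ik iw kw kw (Dp := fun j => j.1 == i.1)) => //.
    - exact: suppZl.
    - by rewrite idealN // expr2 mulrA ti.
  apply/commuteP; have Ux : E k (a *: x) 0 = E k (a *: x + 0 *: w) 0 by rewrite scale0r addr0.
  have wx : form w x = 0 by rewrite formC xw oppr0.
  rewrite -conj_conj Ux hc ?ti // add0r hc ?ti // ?idealMl ?ti //; congr (E k (_ + _ *: _) _).
  by rewrite opiK xi xNi epsN; ring.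
have := Z_eq k (x + w) a.
rewrite (xeD HS) // (st_actA HG) Z_eq !(st_actM HG) Z_eq fixZ xe_hyper_act_E // ExEw.
have EwF : commute (F i p q w a) (E k (a *: w) 0) by apply: E_F_comm.
have ExEw' : commute (E k (a *: x) 0) (E k (a *: w) 0).
  by apply: (E_commi hI HG); rewrite // ?formZl ?formZr ?xw ?mulr0 //; apply: sI.
rewrite -!mulgA => /mulgI e; apply: (mulIg (E k (a *: x) 0 * E k (a *: w) 0)%g).
rewrite -e -!mulgA; congr (_ * _)%g.
rewrite (mulgA (E k (a *: x) 0)) EZ -!mulgA; congr (_ * _)%g.
by rewrite -EwF !mulgA -EF.
Qed.

(** Z_k(w', b) is made of T(e_k, 0, b), its image under x_k(w') and E_k(b w', 0); invariance of the
    other element under the corresponding elements of S is therefore enough. *)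
Lemma ZZ_comm i j k w w' a b : i.1 != j.1 -> i _|_ w -> j _|_ w -> k _|_ w -> k _|_ w' ->
  a \in I -> b \in I ->
  (forall c, act (X k (c *: w') 0) (Z i w a) = Z i w a) ->
  (forall c, act (X (opi k) (c *: w') 0) (Z i w a) = Z i w a) ->
  commute (Z k w' b) (Z i w a).
Proof.
move=> ij iw jw kw kw' aI bI h1 h2.
have sI m d : m _|_ w' -> d \in I -> supp I (predC1 (opi m)) (d *: w').
  by move=> mw dI; apply/perp_predC1N/suppZI.
have lc : commute (lG k b) (Z i w a).
  rewrite -(E0 hI HG); apply: (E_Z_comm hI HS HG ij); rewrite ?(E0 hR HS) //; first exact: supp0.
  exact: (Z_fix_l hI HS HG _ ij).
rewrite ZE; do !apply: commuteMl.
- exact: commuteVl.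
- have e : act (xe k w') (Z i w a) = Z i w a by exact: h2.
  by rewrite /commute -e -!(st_actM HG) lc.
apply: commuteVl; apply: (E_Z_comm hI HS HG ij) => //; first exact: ideal0.
exact: sI.
Qed.

Lemma ZZ_comm_par i j k w a b : i.1 != j.1 -> i _|_ w -> j _|_ w -> k _|_ w ->
  a \in I -> b \in I -> commute (Z k w b) (Z i w a).
Proof.
move=> ij iw jw kw aI bI; apply: (ZZ_comm ij) => // c.
  exact: (Z_fix_X_par hI HS HG _ _ ij).
exact: (Z_fix_X_par hI HS HG _ _ ij).
Qed.

Lemma ZZ_comm_disj (Dp : pred (idx l)) i j k w w' a b : i.1 != j.1 -> i _|_ w -> j _|_ w ->
  k _|_ w -> k _|_ w' -> (forall m, Dp m -> m _|_ w) -> supp predT Dp w' ->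
  a \in I -> b \in I -> commute (Z k w' b) (Z i w a).
Proof.
move=> ij iw jw kw kw' Dw hw aI bI.
have hw' : supp predT (fun j => Dp j && (j.1 != k.1)) w' by apply: suppI.
have Dw' m : Dp m && (m.1 != k.1) -> m _|_ w by case/andP => /Dw.
apply: (ZZ_comm ij) => // c.
  apply: (Z_fix_X hI HS HG _ ij iw jw kw Dw'); rewrite //= ?eqxx ?andbF //; exact: suppZ.
apply: (Z_fix_X hI HS HG _ ij iw jw (q := opi k) kw Dw'); rewrite //= ?eqxx ?andbF //.
exact: suppZ.
Qed.

Lemma FD i k (p q : R) w a b : i.1 != k.1 -> i _|_ w -> k _|_ w -> a \in I -> b \in I ->
  F i p q w (a + b) = (F i p q w a * F i p q w b)%g.
Proof.
move=> ik iw kw aI bI; have z0 := ideal0 hI.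
have sI d : d \in I -> supp I (predC1 (opi k)) (d *: w).
  by move=> dI; apply/perp_predC1N/suppZI.
have EF : commute (F i p q w a) (E k (b *: w) 0) by apply: E_F_comm.
have EE : E k ((a + b) *: w) 0 = (E k (a *: w) 0 * E k (b *: w) 0)%g.
  rewrite scalerDl (E_split hI HG) ?formZl ?formZr ?form_alt ?mulr0 ?subr0 //; exact: sI.
apply: (mulgI (E k ((a + b) *: w) 0)); rewrite -xe_hyper_act_E ?idealD //.
rewrite EE (st_actM HG) !xe_hyper_act_E // -!mulgA; congr (_ * _)%g.
by rewrite mulgA EF mulgA.
Qed.

Lemma F0a i (p q : R) w : i _|_ w -> F i p q w 0 = 1%g.
Proof.
move=> iw; rewrite FE !mulr0 scale0r !(E0 hI HG) !(lG0 hI HG) expr2 mulr0 mulr0 oppr0.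
by rewrite (Z0 hI HG) ?mulg1.
Qed.

Lemma E_Z_comm_hyper i k m (p q : R) w a b : i.1 != k.1 -> i.1 != m.1 -> i _|_ w -> m _|_ w ->
  a \in I -> b \in I -> commute (E m (a *: w) 0) (Z k (hyper i p q) b).
Proof.
move=> ik im iw mw aI bI; have [n [nk ni]] := third_plane hl k i.
have kn : k.1 != n.1 by rewrite eq_sym.
have hyp j : j.1 != i.1 -> j _|_ hyper i p q by move=> ji; apply: hyper_perp; rewrite eq_sym.
apply: (E_Z_comm_disj hI HS HG kn (Dp := fun j => (j.1 != i.1) && (j.1 != m.1))).
- exact: hyper_perp.
- exact: hyp.
- exact: hyper_perp.
- by move=> j /andP[/hyp].
- by rewrite eqxx andbF.
- by apply: suppI; apply: suppZI.
- exact: ideal0.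
- by [].
Qed.

(** By [xe_hyper_act_E], F is a quotient of E_k(a w, 0) and its image under x_k(x). The former
    commutes with Z_k(x, b) and x_k(x) fixes Z_k(x, b). *)
Lemma F_Z_comm i k (p q : R) w a b : i.1 != k.1 -> i _|_ w -> k _|_ w -> a \in I -> b \in I ->
  commute (F i p q w a) (Z k (hyper i p q) b).
Proof.
move=> ik iw kw aI bI; have [n [nk ni]] := third_plane hl k i.
have kn : k.1 != n.1 by rewrite eq_sym.
have kx : k _|_ hyper i p q by apply: hyper_perp.
have nx : n _|_ hyper i p q by apply: hyper_perp; rewrite eq_sym.
have EZ : commute (E k (a *: w) 0) (Z k (hyper i p q) b) by apply: E_Z_comm_hyper.
have -> : F i p q w a = ((E k (a *: w) 0)^-1 * act (xe k (hyper i p q)) (E k (a *: w) 0))%g.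
  by rewrite xe_hyper_act_E // mulKg.
apply: commuteMl; first exact: commuteVl.
have e : act (xe k (hyper i p q)) (Z k (hyper i p q) b) = Z k (hyper i p q) b.
  exact: (Z_fix_X_par hI HS HG _ _ kn).
by rewrite /commute -e -!(st_actM HG) EZ.
Qed.

End Transvections.

Section Transvections.
Variables (R : comPzRingType) (l : nat) (I : {pred R}) (S G : groupType).
Variables (sS : idx l -> idx l -> R -> S) (lS : idx l -> R -> S).
Variables (act : S -> G -> G).
Variables (sG : idx l -> idx l -> R -> G) (lG : idx l -> R -> G).
Hypothesis hl : (3 <= l)%N.
Hypothesis hI : is_ideal I.
Hypothesis HS : stdata predT sS lS (@cj S) sS lS.
Hypothesis HG : stdata I sS lS act sG lG.
Implicit Types (i j k m n : idx l) (a b c r s t p q : R) (u v w : vec R l) (x : S) (y z : G).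

Local Notation E := (heis sG lG).
Local Notation X := (heis sS lS).
Local Notation "i _|_ w" := (supp predT (perp i) w) (at level 70).

Local Notation xe := (xe sS lS).
Local Notation Z := (perp_long sS lS act sG lG).

Local Notation F := (hyper_short sS lS act sG lG).

(* T(x, a (y + w), 0) = T(x, a y, 0) T(x, a w, 0) for x, y in distinct hyperbolic planes *)
Lemma F_split i j (p q s t : R) w a (y := hyper j s t) : i.1 != j.1 -> i _|_ w -> j _|_ w ->
  a \in I -> F i p q (y + w) a = (F i p q y a * F i p q w a)%g.
Proof.
move=> ij iw jw aI; have ji : j.1 != i.1 by rewrite eq_sym.
have z0 := ideal0 hI; have ti d : d * a \in I by apply: idealMl.
have iy : i _|_ y by apply: hyper_perp.
have iNw : opi i _|_ w by []. have iNy : opi i _|_ y by [].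
have yw : form y w = 0 by apply: form_hyper.
have a2I d : - (d * a ^+ 2) \in I by rewrite idealN // expr2 mulrA ti.
have sI m u d : m _|_ u -> d \in I -> supp I (predC1 (opi m)) (d *: u).
  by move=> mw dI; apply/perp_predC1N/suppZI.
have ED m c : m _|_ y -> m _|_ w -> c \in I ->
    E m (c *: (y + w)) 0 = (E m (c *: y) 0 * E m (c *: w) 0)%g.
  move=> my mw cI; rewrite scalerDr (E_split hI HG) ?formZl ?formZr ?yw ?mulr0 ?subr0 //; exact: sI.
pose b' := eps R i * p * q * a ^+ 2; have b'I : b' \in I by rewrite /b' expr2 mulrA ti.
(* By the Peiffer identity, conjugation by E_{-i}(- q a y, 0) is the action of x_i at a multiple of
   y, so [xe_hyper_act_E] computes the cost of interchanging these factors. *)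
have key : (E i ((p * a) *: w) 0 * E (opi i) ((q * a) *: y) 0 =
    E (opi i) ((q * a) *: y) 0 * E i ((p * a) *: w) 0 * F j s t w b')%g.
  apply: (mulgI (E (opi i) ((- (q * a)) *: y) 0)).
  have EN : (E (opi i) ((- (q * a)) *: y) 0 * E (opi i) ((q * a) *: y) 0)%g = 1%g.
    rewrite (E_mul hI HG) ?ti //; try by apply: sI; rewrite ?idealN.
    by rewrite -scalerDl addNr scale0r formZl formZr form_alt !mulr0 !addr0 (E0 hI HG) (lG0 hI HG).
  rewrite !mulgA EN mul1g.
  have -> : E (opi i) ((q * a) *: y) 0 = (E (opi i) ((- (q * a)) *: y) 0)^-1%g.
    by apply: (mulgI (E (opi i) ((- (q * a)) *: y) 0)); rewrite EN mulgV.
  have qyI : supp I (predC1 (opi (opi i))) (- (q * a) *: y) by apply: sI; rewrite ?idealN.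
  rewrite -(@peiffer_E _ _ _ _ _ _ _ _ _ _ hI HG predT i _ _ _ z0 _ _ (linked_EX hI HS HG qyI z0)); last first.
    by move=> m; case: (suppZI hI (ti p) iw m).
  have -> : X (opi i) ((- (q * a)) *: y) 0 =
      xe i (hyper j (eps R i * q * a * s) (eps R i * q * a * t)).
    have e : eps R (opi i) * eps R i = -1 by rewrite epsN mulNr epsK.
    have -> : (- (q * a)) *: y =
        eps R (opi i) *: hyper j (eps R i * q * a * s) (eps R i * q * a * t).
      by rewrite /y !hyperV !scalerDr !scalerA !mulrA !e !mulNr !mul1r.
    by rewrite xeE.
  rewrite (xe_hyper_act_E hI HS HG) //.
  have -> : F j (eps R i * q * a * s) (eps R i * q * a * t) w (p * a) = F j s t w b'.
    have e1 c : eps R i * q * a * c * (p * a) = c * b' by rewrite /b'; ring.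
    have e2 : eps R j * (eps R i * q * a * s) * (eps R i * q * a * t) * (p * a) ^+ 2 =
        eps R j * s * t * b' ^+ 2 by rewrite /b'; ring.
    by rewrite !FE !e1 e2.
  by [].
(* The factor created by the interchange cancels the one that [Z_split] creates from the long part
   at y + w. *)
have Fb : (F j s t w b' * F j s t w (- b') = 1)%g.
  by rewrite -(FD hI HS HG _ _ ji) ?idealN // subrr (F0a hI HG).
have bE : - (eps R i * p * q * a ^+ 2) = - b' by [].
rewrite !FE bE ED ?ti // ED ?ti // (Z_split hI HS HG _ _ ji) ?idealN // -/y.
set Ey1 := E i ((p * a) *: y) 0; set Ew1 := E i ((p * a) *: w) 0.
set Ey2 := E (opi i) ((q * a) *: y) 0; set Ew2 := E (opi i) ((q * a) *: w) 0.
set Zy := Z i y _; set Zw := Z i w _; set Fp := F j s t w b'; set Fm := F j s t w _.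
rewrite -/Ew1 -/Ey2 -/Fp in key; rewrite -/Fp -/Fm in Fb.
have c1 : commute Fp Ew2 by apply: (E_F_comm hI HS HG); rewrite // ti.
have c2 : commute Fp Zy by apply: (F_Z_comm hl hI HS HG); rewrite // ?idealN.
have c3 : commute Fp Zw.
  apply: (F_comm hI) => // c cI.
  - by apply: (E_Z_comm_par hI HS HG ij); rewrite // ?idealN.
  - by apply: (E_Z_comm_par hI HS HG ij); rewrite // ?idealN.
  - by apply: (ZZ_comm_par hI HS HG ij); rewrite // ?idealN.
have c4 : commute (Ew1 * Ew2)%g Zy.
  by apply: commuteMl; apply: (E_Z_comm_hyper hl hI HS HG); rewrite // ?ti ?idealN.
have c5 : commute Fp (Zy * Zw)%g by apply: commuteM.
transitivity (Ey1 * Ey2 * (Ew1 * Ew2 * Zy) * Zw)%g; last by rewrite c4 !mulgA.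
transitivity (Ey1 * (Ey2 * Ew1 * (Fp * Ew2)) * (Zy * Zw) * Fm)%g.
  by rewrite !mulgA -(mulgA Ey1 Ew1) key !mulgA.
rewrite c1 -!mulgA; do 4!congr (_ * _)%g.
by rewrite (mulgA Zy) mulgA c5 -mulgA Fb mulg1.
Qed.

End Transvections.

(** * Independence of the hyperbolic plane that is split off, and equivariance *)

HB.lock Definition pl (R : comPzRingType) (l : nat) (i : idx l) (u : vec R l) : vec R l :=
  @hyper R l i (u i) (u (opi i)).

HB.lock Definition rest (R : comPzRingType) (l : nat) (i : idx l) (u : vec R l) : vec R l :=
  u - pl i u.

(* T(u, 0, a), computed after splitting off the i-th hyperbolic plane *)
HB.lock Definition split_long (R : comPzRingType) (l : nat) (S G : groupType)
    (sS : idx l -> idx l -> R -> S) (lS : idx l -> R -> S) (act : S -> G -> G)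
    (sG : idx l -> idx l -> R -> G) (lG : idx l -> R -> G)
    (i k : idx l) (u : vec R l) (a : R) : G :=
  (perp_long sS lS act sG lG k (pl i u) a * hyper_short sS lS act sG lG i (u i) (u (opi i)) (rest i u) a
   * perp_long sS lS act sG lG i (rest i u) a)%g.

Section Transvections.
Variables (R : comPzRingType) (l : nat) (I : {pred R}) (S G : groupType).
Variables (sS : idx l -> idx l -> R -> S) (lS : idx l -> R -> S).
Variables (act : S -> G -> G).
Variables (sG : idx l -> idx l -> R -> G) (lG : idx l -> R -> G).
Hypothesis hl : (3 <= l)%N.
Hypothesis hI : is_ideal I.
Hypothesis HS : stdata predT sS lS (@cj S) sS lS.
Hypothesis HG : stdata I sS lS act sG lG.
Implicit Types (i j k m n : idx l) (a b c r s t p q : R) (u v w : vec R l) (x : S) (y z : G).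

Local Notation E := (heis sG lG).
Local Notation "i _|_ w" := (supp predT (perp i) w) (at level 70).

Local Notation Z := (perp_long sS lS act sG lG).

Local Notation F := (hyper_short sS lS act sG lG).

Local Notation Zt := (split_long sS lS act sG lG).

(** Expand T(x + y, 0, a) = T(y + x, 0, a) by [Z_split] in a third plane; the long factors at x and
    y commute and cancel. *)
Lemma F_sym i j (p q s t : R) a : i.1 != j.1 -> a \in I ->
  F i p q (hyper j s t) a = F j s t (hyper i p q) a.
Proof.
move=> ij aI; have [k [ki kj]] := third_plane hl i j.
have ji : j.1 != i.1 by rewrite eq_sym.
have ik : i.1 != k.1 by rewrite eq_sym.
have jk : j.1 != k.1 by rewrite eq_sym.
set x := hyper i p q; set y := hyper j s t.
have hx m : i.1 != m.1 -> m _|_ x by move=> im; apply: hyper_perp.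
have hy m : j.1 != m.1 -> m _|_ y by move=> jm; apply: hyper_perp.
have e1 := Z_split hI HS HG p q ik (hy i ji) (hy k jk) aI.
have e2 := Z_split hI HS HG s t jk (hx j ij) (hx k ik) aI.
have com : commute (Z k x a) (Z k y a).
  apply: (ZZ_comm_disj hI HS HG ki (hy k jk) (hy i ji) (hy k jk) (hx k ik)
    (Dp := fun m => m.1 == i.1)) => //.
    by move=> m /eqP mi; apply: hy; rewrite mi.
  exact: hyper_supp.
have e := etrans (esym e1) (etrans (congr1 (fun v => Z k v a) (addrC x y)) e2).
by move: com e; move: (Z k x a) (Z k y a) => z1 z2 com; rewrite com => /mulgI.
Qed.

Lemma plV i u : pl i u = @hyper R l i (u i) (u (opi i)).
Proof. by rewrite unlock. Qed.

Lemma restV i u : rest i u = u - pl i u.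
Proof. by rewrite unlock. Qed.

Lemma pl_rest i u : u = pl i u + rest i u.
Proof. by rewrite restV addrC subrK. Qed.

Lemma plE i u j : pl i u j = if j.1 == i.1 then u j else 0.
Proof.
rewrite plV hyperE; case: (eqVneq j.1 i.1) => [ji|ji]; first case: (plane_eq ji) => ->.
- by rewrite eqxx [i == _]eq_sym opi_neq mulr0 addr0 mulr1.
- by rewrite eqxx opi_neq mulr0 add0r mulr1.
by rewrite !plane_neq // !mulr0 addr0.
Qed.

Lemma restE i u j : rest i u j = if j.1 == i.1 then 0 else u j.
Proof. by rewrite restV vaddE voppE plE; case: eqP => _; rewrite ?subrr ?subr0. Qed.

Lemma rest_perp i u : i _|_ rest i u.
Proof. by move=> j; split=> //; rewrite /perp negbK restE => ->. Qed.

Lemma rest_perpS i k u : k _|_ u -> k _|_ rest i u.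
Proof.
move=> ku j; split=> // kj; rewrite restE; case: eqP => // _; exact: (suppE ku).
Qed.

Lemma ZtE i k u a : Zt i k u a =
  (Z k (pl i u) a * F i (u i) (u (opi i)) (rest i u) a * Z i (rest i u) a)%g.
Proof. by rewrite [in LHS]unlock. Qed.

Lemma pl_perp i k u : i.1 != k.1 -> k _|_ pl i u.
Proof. by rewrite plV; exact: hyper_perp. Qed.

Lemma Z_pl i k k' u a : k.1 != i.1 -> k'.1 != i.1 -> a \in I -> Z k (pl i u) a = Z k' (pl i u) a.
Proof.
move=> ki k'i aI; have [n [nk ni]] := third_plane hl k i.
have kn : k.1 != n.1 by rewrite eq_sym.
by apply: (Z_switch hI HS HG kn) => //; apply: pl_perp; rewrite eq_sym.
Qed.

Lemma Zt_switch i k k' u a : k.1 != i.1 -> k'.1 != i.1 -> a \in I -> Zt i k u a = Zt i k' u a.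
Proof. by move=> ki k'i aI; rewrite !ZtE (Z_pl u ki k'i). Qed.

(** Write u = x + y + w with x, y in the planes of i, j and w orthogonal to both. [Z_split],
    [F_split] and [F_sym] turn both sides into products of the same six factors, belonging to x, y,
    w and to the three pairs; the rest is commutation. *)
Lemma Zt_plane3 i j k u a : i.1 != j.1 -> k.1 != i.1 -> k.1 != j.1 -> a \in I ->
  Zt i k u a = Zt j k u a.
Proof.
move=> ij ki kj aI; have ji : j.1 != i.1 by rewrite eq_sym.
have ik : i.1 != k.1 by rewrite eq_sym.
have jk : j.1 != k.1 by rewrite eq_sym.
set p : R := u i; set q : R := u (opi i); set s : R := u j; set t : R := u (opi j).
pose x := @hyper R l i p q; pose y := @hyper R l j s t; pose w := rest j (rest i u).
have wE m : w m = if m.1 == j.1 then 0 else if m.1 == i.1 then 0 else u m by rewrite !restE.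
have yE m : y m = if m.1 == j.1 then u m else 0 by rewrite -plE plV.
have xE m : x m = if m.1 == i.1 then u m else 0 by rewrite -plE plV.
have iw : i _|_ w by apply/rest_perpS/rest_perp.
have jw : j _|_ w by apply: rest_perp.
have ri : rest i u = y + w.
  apply/ffunP => m; rewrite vaddE yE wE restE; case: (eqVneq m.1 j.1) => [->|mj]; first by rewrite (negPf ji) addr0.
  by rewrite add0r.
have rj : rest j u = x + w.
  apply/ffunP => m; rewrite vaddE xE wE restE; case: (eqVneq m.1 j.1) => [->|mj]; first by rewrite (negPf ji) addr0.
  by case: eqP => _; rewrite ?addr0 ?add0r.
have hx m : i.1 != m.1 -> m _|_ x by move=> im; apply: hyper_perp.
have hy m : j.1 != m.1 -> m _|_ y by move=> jm; apply: hyper_perp.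
rewrite !ZtE ri rj -/p -/q -/s -/t !plV -/x -/y.
rewrite (F_split hl hI HS HG p q s t ij iw jw aI) (F_split hl hI HS HG s t p q ji jw iw aI).
rewrite (Z_split hI HS HG s t ji jw iw aI) (Z_split hI HS HG p q ij iw jw aI) -/x -/y.
rewrite -(F_sym _ _ _ _ ij aI) -/y.
have -> : Z i y a = Z k y a by apply: (Z_switch hI HS HG ik) => //; [apply: hy|apply: hy|apply: hy].
have -> : Z j x a = Z k x a by apply: (Z_switch hI HS HG jk) => //; [apply: hx|apply: hx|apply: hx].
have -> : Z j w a = Z i w a by apply: (Z_switch hI HS HG ji).
rewrite -/y.
have xn : k _|_ x by apply: hx. have xj : j _|_ x by apply: hx.
have yn : k _|_ y by apply: hy. have yi : i _|_ y by apply: hy.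
have cAB : commute (Z k x a) (Z k y a).
  apply: (ZZ_comm_disj hI HS HG ki yn yi yn xn (Dp := fun m => m.1 == i.1)) => //.
    by move=> m /eqP mi; apply: hy; rewrite mi.
  exact: hyper_supp.
have iNw : opi i _|_ w by []. have jNw : opi j _|_ w by [].
have cBFi : commute (F i p q w a) (Z k y a).
  apply: (F_comm hI) => // c cI.
  - exact: (E_Z_comm_hyper hl hI HS HG s t jk ji jw iw cI aI).
  - exact: (E_Z_comm_hyper hl hI HS HG s t (m := opi i) jk ji jw iNw cI aI).
  apply: (ZZ_comm_disj hI HS HG ki yn yi yi iw (Dp := fun m => m.1 != j.1)) => //.
  by move=> m mj; apply: hy; rewrite eq_sym.
have cBf : commute (F i p q y a) (Z k y a).
  apply: (F_comm hI) => // c cI.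
  - exact: (E_Z_comm_par hI HS HG ki).
  - exact: (E_Z_comm_par hI HS HG ki).
  exact: (ZZ_comm_par hI HS HG ki).
have cAFj : commute (F j s t w a) (Z k x a).
  apply: (F_comm hI) => // c cI.
  - exact: (E_Z_comm_hyper hl hI HS HG p q ik ij iw jw cI aI).
  - exact: (E_Z_comm_hyper hl hI HS HG p q (m := opi j) ik ij iw jNw cI aI).
  apply: (ZZ_comm_disj hI HS HG kj xn xj xj jw (Dp := fun m => m.1 != i.1)) => //.
  by move=> m mi; apply: hx; rewrite eq_sym.
have cAf : commute (F i p q y a) (Z k x a).
  rewrite /y F_sym // -/x; apply: (F_comm hI) => // c cI.
  - exact: (E_Z_comm_par hI HS HG kj).
  - exact: (E_Z_comm_par hI HS HG kj).
  exact: (ZZ_comm_par hI HS HG kj).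
have cFiW : commute (F i p q w a) (Z i w a).
  apply: (F_comm hI) => // c cI.
  - exact: (E_Z_comm_par hI HS HG ij).
  - exact: (E_Z_comm_par hI HS HG ij).
  exact: (ZZ_comm_par hI HS HG ij).
have cFjW : commute (F j s t w a) (Z i w a).
  apply: (F_comm hI) => // c cI.
  - exact: (E_Z_comm_par hI HS HG ij).
  - exact: (E_Z_comm_par hI HS HG ij).
  exact: (ZZ_comm_par hI HS HG ij).
have cFF : commute (F i p q w a) (F j s t w a).
  apply: (F_comm hI) => // c cI.
  - by apply/commute_sym; apply: (E_F_comm hI HS HG).
  - by apply/commute_sym; apply: (E_F_comm hI HS HG).
  apply/commute_sym; apply: (F_comm hI) => // d dI.
  - exact: (E_Z_comm_par hI HS HG ij).
  - exact: (E_Z_comm_par hI HS HG ij).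
  exact: (ZZ_comm_par hI HS HG ij).
move: (Z k x a) (Z k y a) (Z i w a) (F i p q w a) (F j s t w a) (F i p q y a) cAB cBFi cBf cAFj cAf cFiW cFjW cFF.
move=> A B W Fi Fj f cAB cBFi cBf cAFj cAf cFiW cFjW cFF.
have cB : commute (A * (f * Fi))%g B by do !apply: commuteMl.
have cA : commute (f * Fj)%g A by apply: commuteMl.
have cW : commute Fi (W * Fj)%g by apply: commuteM.
transitivity (B * (A * (f * (Fi * (W * Fj)))))%g.
  by rewrite -!mulgA (mulgA f) (mulgA A) (mulgA _ B) cB -!mulgA.
rewrite cW; transitivity (B * ((f * Fj) * A) * (W * Fi))%g; last by rewrite !mulgA.
by rewrite cA -!mulgA (mulgA W) -cFjW -!mulgA.
Qed.

Lemma Zt_plane i j k k' u a : k.1 != i.1 -> k'.1 != j.1 -> a \in I -> Zt i k u a = Zt j k' u a.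
Proof.
move=> ki kj aI; have [m [mi mj]] := third_plane hl i j.
rewrite (Zt_switch u ki mi aI) (Zt_switch u kj mj aI).
case: (eqVneq i.1 j.1) => [ij|ij]; last exact: Zt_plane3.
have [n [ni nm]] := third_plane hl i m.
have mn : m.1 != n.1 by rewrite eq_sym.
have nj : n.1 != j.1 by rewrite -ij.
by rewrite (@Zt_plane3 i n m) // 1?eq_sym // (@Zt_plane3 n j m).
Qed.

Lemma F_act (x : S) (f : vec R l -> vec R l) i (p q : R) w a : a \in I ->
  (forall c, c \in I -> act x (E i (c *: w) 0) = E i (c *: f w) 0) ->
  (forall c, c \in I -> act x (E (opi i) (c *: w) 0) = E (opi i) (c *: f w) 0) ->
  (forall c, c \in I -> act x (Z i w c) = Z i (f w) c) ->
  act x (F i p q w a) = F i p q (f w) a.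
Proof.
move=> aI h1 h2 h3; rewrite !FE !(st_actM HG) h1 ?h2 ?h3 ?idealMl //.
by rewrite idealN // expr2 mulrA idealMl.
Qed.

Lemma transv_pl m v r i u : i _|_ v -> m.1 != i.1 ->
  pl i (transv (basis R m) v r u) = pl i u.
Proof.
move=> iv mi; apply/ffunP => j; rewrite !plE transvE; case: eqP => // /plane_eq ji.
have im : i.1 != m.1 by rewrite eq_sym.
have -> : v j = 0 by case: ji => ->; [exact: (perp_coord iv)|exact: (perp_coordN iv)].
by rewrite basisE plane_neq ?mulr0 ?addr0 //; case: ji => ->.
Qed.

Lemma transv_rest m v r i u : i _|_ v -> m.1 != i.1 ->
  rest i (transv (basis R m) v r u) = transv (basis R m) v r (rest i u).
Proof.
move=> iv mi; rewrite !restV transv_pl // transvD; congr (_ + _).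
have f0 w : i _|_ w -> form w (- pl i u) = 0.
  by move=> iw; rewrite plV formNr formC form_hyper // !oppr0.
by rewrite transv_id ?f0 //; apply: supp_basis1; rewrite /perp.
Qed.

Lemma transv_coord m v r i u : i _|_ v -> m.1 != i.1 -> transv (basis R m) v r u i = u i.
Proof.
move=> iv mi; rewrite transvE (perp_coord iv) basisE plane_neq 1?eq_sym //.
by rewrite !mulr0 !addr0.
Qed.

(** A root element outside the plane of i fixes the component of u in that plane and moves only the
    remainder, so it acts factor by factor. *)
Lemma Zt_act_s i k m n r u a : k.1 != i.1 -> m.1 != n.1 -> m.1 != i.1 -> n.1 != i.1 -> a \in I ->
  act (sS m n r) (Zt i k u a) = Zt i k (transv (basis R m) (r *: basis R n) 0 u) a.
Proof.
move=> ki mn mi ni aI; have z0 := ideal0 hI.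
have iv : i _|_ (r *: basis R n) by apply: supp_basis.
have ir := rest_perp i u.
have pm j : i.1 != j.1 -> j _|_ pl i u by exact: pl_perp.
have [h [hk hi]] := third_plane hl k i.
rewrite !ZtE !(st_actM HG) transv_pl // !transv_coord // transv_rest //.
have -> : act (sS m n r) (Z k (pl i u) a) = Z k (pl i u) a.
  have kh : k.1 != h.1 by rewrite eq_sym.
  by apply: (Z_fix_s hI HS HG r kh) => //; apply: pm; rewrite eq_sym.
rewrite (Z_act_s hI HS HG) //; congr (_ * _ * _)%g.
have hE j : j.1 = i.1 -> forall c, c \in I -> act (sS m n r) (E j (c *: rest i u) 0) =
    E j (c *: transv (basis R m) (r *: basis R n) 0 (rest i u)) 0.
  move=> ji c cI; rewrite (act_sE hI HG) ?transv_lin ?plane_neq //= ?ji //.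
  by apply: perp_predC1N; rewrite /perp ji; apply: suppZI.
apply: F_act => // [c|c|c cI]; [exact: hE|exact: hE|].
exact: (Z_act_s hI HS HG).
Qed.

Lemma Zt_act_l i k m r u a : k.1 != i.1 -> m.1 != i.1 -> a \in I ->
  act (lS m r) (Zt i k u a) = Zt i k (transv (basis R m) 0 r u) a.
Proof.
move=> ki mi aI; have z0 := ideal0 hI.
have iv : i _|_ (0 : vec R l) by apply: supp0.
have ir := rest_perp i u.
have pm j : i.1 != j.1 -> j _|_ pl i u by exact: pl_perp.
have [h [hk hi]] := third_plane hl k i.
rewrite !ZtE !(st_actM HG) transv_pl // !transv_coord // transv_rest //.
have -> : act (lS m r) (Z k (pl i u) a) = Z k (pl i u) a.
  have kh : k.1 != h.1 by rewrite eq_sym.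
  by apply: (Z_fix_l hI HS HG r kh) => //; apply: pm; rewrite eq_sym.
rewrite (Z_act_l hI HS HG) //; congr (_ * _ * _)%g.
have hE j : j.1 = i.1 -> forall c, c \in I -> act (lS m r) (E j (c *: rest i u) 0) =
    E j (c *: transv (basis R m) 0 r (rest i u)) 0.
  move=> ji c cI; rewrite (act_lE hI HG) ?transv_lin ?plane_neq //= ?ji //.
  by apply: perp_predC1N; rewrite /perp ji; apply: suppZI.
apply: F_act => // [c|c|c cI]; [exact: hE|exact: hE|].
exact: (Z_act_l hI HS HG).
Qed.

End Transvections.

(** * The resulting family T(u, 0, a): special values, Peiffer identity, existence *)

Section LongFamily.
Variables (R : comPzRingType) (l : nat) (I : {pred R}) (S G : groupType).
Variables (sS : idx l -> idx l -> R -> S) (lS : idx l -> R -> S).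
Variables (act : S -> G -> G).
Variables (sG : idx l -> idx l -> R -> G) (lG : idx l -> R -> G).
Hypothesis hl : (3 <= l)%N.
Hypothesis hI : is_ideal I.
Hypothesis HS : stdata predT sS lS (@cj S) sS lS.
Hypothesis HG : stdata I sS lS act sG lG.
Implicit Types (i j k m n : idx l) (a b c r s t p q : R) (u v w : vec R l) (x : S) (y z : G).

Let hR := @ideal_predT R.
Local Notation E := (heis sG lG).
Local Notation peiffer := (peiffer I sS lS act sG lG).
Local Notation "i _|_ w" := (supp predT (perp i) w) (at level 70).

Local Notation xe := (xe sS lS).
Local Notation Z := (perp_long sS lS act sG lG).
Local Notation Z_eq := (Z_eq sS lS act sG lG).

Local Notation F := (hyper_short sS lS act sG lG).

Local Notation Zt := (split_long sS lS act sG lG).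

(** Here x_k(t e_i) is a short root element, and the middle factor in [st_sl] is T(t e_i, 0, a). *)
Lemma Z_axis i k t a : k.1 != i.1 -> a \in I -> Z k (hyper i t 0) a = lG i (a * t ^+ 2).
Proof.
move=> ki aI; have ik : i.1 != k.1 by rewrite eq_sym.
have z0 := ideal0 hI; have ti d : d * a \in I by apply: idealMl.
have h0 : hyper i t 0 = t *: basis R i by rewrite hyperV scale0r addr0.
have e : xe k (hyper i t 0) = sS i (opi k) (eps R (opi k) * t).
  by rewrite h0 xeE scalerA (E_basis hR HS) // (st_sSC HS).
apply: (mulgI (lG k a)); apply: (mulIg (E k (a *: hyper i t 0) 0)).
rewrite -(Z_eq k) e h0 scalerA (E_basis hI HG) // ?idealMr //.
have := st_sl HG (i := i) (j := opi k) (eps R (opi k) * t) ik aI; rewrite opiK => ->.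
rewrite exprMn [eps R (opi k) ^+ 2]expr2 mulrA !epsK !mul1r (st_sC HG (i := i)) ?ti //.
by rewrite [t * a]mulrC.
Qed.

Lemma F_axis i p w a : i _|_ w -> F i p 0 w a = E i ((p * a) *: w) 0.
Proof.
move=> iw; rewrite FE mul0r scale0r mulr0 mul0r oppr0 (Z0 hI HG) // (E0 hI HG) (lG0 hI HG).
by rewrite !mulg1.
Qed.

Lemma Zt_axis i k u a : k.1 != i.1 -> u (opi i) = 0 -> a \in I ->
  Zt i k u a = (lG i (a * u i ^+ 2) * E i ((u i * a) *: rest i u) 0 * Z i (rest i u) a)%g.
Proof.
by move=> ki u0 aI; rewrite ZtE plV u0 Z_axis // F_axis //; exact: rest_perp.
Qed.

Lemma Zt_basis i k t a : k.1 != i.1 -> a \in I -> Zt i k (t *: basis R i) a = lG i (a * t ^+ 2).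
Proof.
move=> ki aI; rewrite Zt_axis //; last by rewrite !vE opi_neq mulr0.
have -> : rest i (t *: basis R i) = 0.
  apply/ffunP => j; rewrite restE !vE; case: eqP => // /eqP ji.
  by rewrite plane_neq // mulr0.
rewrite !vE eqxx mulr1 scaler0 (E0 hI HG) (lG0 hI HG) mulg1.
by rewrite ZE (xe0 HS) (st_act1 HG) mulVg scaler0 (E0 hI HG) (lG0 hI HG) mul1g invg1 mulg1.
Qed.

(** Outside the plane of i the vectors e_i + v and v agree, so it remains to compare e_i
    coordinates: (1 + v_i)^2 = 1 + 2 v_i + v_i^2, where the middle term comes from E_i(a v, 0). *)
Lemma Zt_add_basis i k v a : k.1 != i.1 -> v (opi i) = 0 -> a \in I ->
  Zt i k (basis R i + v) a = (lG i a * E i (a *: v) 0 * Zt i k v a)%g.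
Proof.
move=> ki v0 aI; have z0 := ideal0 hI; have ti d : d * a \in I by apply: idealMl.
have r0 : rest i (basis R i + v) = rest i v.
  apply/ffunP => j; rewrite !restE !vE; case: eqP => // /eqP ji.
  by rewrite plane_neq // add0r.
rewrite !Zt_axis //; last by rewrite !vE opi_neq add0r.
rewrite r0 !vE eqxx !mulgA; congr (_ * _)%g.
set w := rest i v; have iw : i _|_ w by apply: rest_perp.
have sI d : d \in I -> supp I (predC1 (opi i)) (d *: w).
  by move=> dI; apply/perp_predC1N/suppZI.
have s0 : supp I (predC1 (opi i)) (0 : vec R l) by apply: supp0.
have vE' : E i (a *: v) 0 = (lG i (2%:R * (a * v i)) * E i (a *: w) 0)%g.
  have e : a *: v = (a * v i) *: basis R i + a *: w.
    rewrite [in LHS](pl_rest i v) plV v0 hyperV scale0r addr0 scalerDr scalerA.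
    by [].
  rewrite e (E_split hI HG) //; last 2 first.
  - by apply: supp_basis; rewrite ?idealMr //= eq_sym opi_neq.
  - exact: sI.
  by rewrite formZl formZr (perp_forml iw) !mulr0 subr0 (E_basis_i hI HG) ?idealMr.
have m1 d : a * d \in I by apply: idealMr.
have m3 d c : d * (a * c) \in I by apply: idealMl.
rewrite vE' -!(E0 hI HG) !(E_mul hI HG) ?add0r ?(m1, ti, m3, form0l, form0r, addr0) //;
  try by [apply: sI; rewrite // ti|rewrite !idealD // ?m1 ?m3].
rewrite formZl formZr form_alt !mulr0 addr0 -scalerDl /=.
have -> : (1 + v i) * a = a + v i * a by ring.
by congr (E i _ _); ring.
Qed.

(** [peiffer_Z] asks for two planes orthogonal to the vector. Only one is given here, so a further
    plane is split off, and each piece has two. *)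
Lemma Z_peiffer i v a : i _|_ v -> a \in I -> peiffer predT (Z i v a).
Proof.
move=> iv aI; have [j [ji _]] := third_plane hl i i.
have ij : i.1 != j.1 by rewrite eq_sym.
have ir := rest_perpS j iv; have jr := rest_perp j v.
have [k [ki kj]] := third_plane hl i j.
have ik : i.1 != k.1 by rewrite eq_sym.
have aaI d : d * a \in I by apply: idealMl.
rewrite (pl_rest j v) plV (Z_split hI HS HG _ _ ji) // FE.
do !apply: (peifferM HG).
- by apply: (peiffer_Z hI HS HG ik) => //; apply: hyper_perp; rewrite // eq_sym.
- exact: (peiffer_Z hI HS HG ij).
- by apply: (peiffer_E hI HG); rewrite ?ideal0 // => m; rewrite vE idealMr.
- by apply: (peiffer_E hI HG); rewrite ?ideal0 // => m; rewrite vE idealMr.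
by apply: (peiffer_Z hI HS HG ji); rewrite // idealN // expr2 mulrA.
Qed.

Lemma Zt_peiffer i k u a : k.1 != i.1 -> a \in I -> peiffer predT (Zt i k u a).
Proof.
move=> ki aI; have ik : i.1 != k.1 by rewrite eq_sym.
have aaI d : d * a \in I by apply: idealMl.
have ir := rest_perp i u.
rewrite ZtE FE; do !apply: (peifferM HG).
- by apply: Z_peiffer => //; exact: pl_perp.
- by apply: (peiffer_E hI HG); rewrite ?ideal0 // => m; rewrite vE idealMr.
- by apply: (peiffer_E hI HG); rewrite ?ideal0 // => m; rewrite vE idealMr.
- by apply: Z_peiffer; rewrite // idealN // expr2 mulrA.
exact: Z_peiffer.
Qed.

(* vt u a is T(u, 0, a), for an arbitrary vector u. *)
Theorem long_family : exists vt : vec R l -> R -> G,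
  [/\ forall m n r u a, m.1 != n.1 -> a \in I ->
        act (sS m n r) (vt u a) = vt (transv (basis R m) (r *: basis R n) 0 u) a,
      forall m r u a, a \in I -> act (lS m r) (vt u a) = vt (transv (basis R m) 0 r u) a,
      forall i t a, a \in I -> vt (t *: basis R i) a = lG i (a * t ^+ 2),
      forall i v a, v (opi i) = 0 -> a \in I ->
        vt (basis R i + v) a = (lG i a * E i (a *: v) 0 * vt v a)%g
    & forall u a, a \in I -> peiffer predT (vt u a)].
Proof.
pose i0 : idx l := (widen_ord hl ord0, false).
have [k0 [ki _]] := third_plane hl i0 i0.
have sw i k u a : k.1 != i.1 -> a \in I -> Zt i0 k0 u a = Zt i k u a.
  by move=> ki' aI; apply: (Zt_plane hl hI HS HG).
have other i : exists k, k.1 != i.1 by have [k [hk _]] := third_plane hl i i; exists k.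
exists (Zt i0 k0); split=> [m n r u a mn aI|m r u a aI|i t a aI|i v a v0 aI|u a aI].
(* Compute with a plane that is left alone by the given root element. *)
- have [i [im iN]] := third_plane hl m n; have [k ki'] := other i.
  by rewrite !(sw i k) // (Zt_act_s hl hI HS HG) // eq_sym.
- have [i [im _]] := third_plane hl m m; have [k ki'] := other i.
  by rewrite !(sw i k) // (Zt_act_l hl hI HS HG) // eq_sym.
- by have [k ki'] := other i; rewrite (sw i k) // Zt_basis.
- by have [k ki'] := other i; rewrite !(sw i k) // Zt_add_basis.
exact: Zt_peiffer.
Qed.

End LongFamily.

(** * Presented groups *)

Section FreeInd.
Local Open Scope group_scope.
Variable X : Type.

Lemma free_ind (P : free_group X -> Prop) :
  P 1 -> (forall x, P (free_gen x)) -> (forall y z, P y -> P z -> P (y * z)) ->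
  (forall y, P y -> P y^-1) -> forall y, P y.
Proof.
move=> P1 Pg PM PV y; rewrite -(free_classK y); elim: (repr y) => [|[x b] w IH] //.
rewrite -cat1s free_class_cat; apply: PM => //.
case: b; last exact: Pg.
have -> : free_class [:: (x, true)] = (free_gen x)^-1.
  by rewrite -[LHS]/(free_class (word_inv [:: (x, false)])) -free_invE.
exact/PV/Pg.
Qed.

End FreeInd.

Section KernelQuotient.
Local Open Scope group_scope.
Variables (G H : groupType) (f : UMagmaMorphism.type G H).

Lemma kernel_normal : is_normal [set x | f x = 1]%classic.
Proof.
split=> [|x y /= fx fy|x /= fx|x g /= fx].
- by rewrite /= gmulf1.
- by rewrite gmulfM fx fy mulg1.
- by rewrite gmulfV fx invg1.
- by rewrite !gmulfM fx mulg1 gmulfV mulgV.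
Qed.

Variables (N : set G) (hN : is_normal N) (fN : forall x, N x -> f x = 1).

(* fN is an argument so that the morphism instance below can be inferred. *)
Definition quot_lift (a : quot_group hN) : H := let _ := fN in f (repr a).

Lemma quot_liftE x : quot_lift (quot_proj hN x) = f x.
Proof.
have /quot_projP/fN := quot_projK (quot_proj hN x).
by rewrite /quot_lift gmulfF => /divg1_eq.
Qed.

Fact quot_lift_gmulfM : {morph quot_lift : x y / x * y}.
Proof.
move=> a b; rewrite -(quot_projK a) -(quot_projK b) -gmulfM !quot_liftE.
exact: gmulfM.
Qed.
Fact quot_lift_gmulf1 : quot_lift 1 = 1.
Proof. by rewrite -[LHS]/(quot_lift (quot_proj hN 1)) quot_liftE gmulf1. Qed.
HB.instance Definition _ :=
  isMultiplicative.Build (quot_group hN) H quot_lift quot_lift_gmulfM.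
HB.instance Definition _ :=
  Multiplicative_isUMagmaMorphism.Build (quot_group hN) H quot_lift quot_lift_gmulf1.

End KernelQuotient.

Section PresentedLift.
Local Open Scope group_scope.
Variables (X : Type) (rel : free_group X -> free_group X -> Prop).

Lemma pres_rel (x y : free_group X) : rel x y ->
  quot_proj (normal_closure_normal (relators rel)) x =
  quot_proj (normal_closure_normal (relators rel)) y.
Proof.
by move=> xy; apply/quot_projP => N [_]; apply; exists x, y.
Qed.

Lemma pres_ind (P : presented rel -> Prop) :
  P 1 -> (forall x, P (pres_gen rel x)) -> (forall y z, P y -> P z -> P (y * z)) ->
  (forall y, P y -> P y^-1) -> forall y, P y.
Proof.
move=> P1 Pg PM PV y; rewrite -(quot_projK y); move: (repr y).
apply: free_ind => [|x|u v Pu Pv|u Pu]; rewrite ?gmulf1 //.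
- exact: Pg.
- by rewrite gmulfM; apply: PM.
- by rewrite gmulfV; apply: PV.
Qed.

Variables (H : groupType) (f : X -> H).
Hypothesis hf : forall x y, rel x y -> free_lift f x = free_lift f y.

Lemma pres_kernel x : normal_closure (relators rel) x -> free_lift f x = 1.
Proof.
move/(_ [set x | free_lift f x = 1]%classic); apply; split; first exact: kernel_normal.
by move=> _ [y [z [yz ->]]] /=; rewrite gmulfF /= (hf yz) mulgV.
Qed.

Definition pres_lift : UMagmaMorphism.type (presented rel) H :=
  @quot_lift _ _ (free_lift f) _ (normal_closure_normal (relators rel)) pres_kernel.

Lemma pres_lift_gen x : pres_lift (pres_gen rel x) = f x.
Proof. exact: etrans (quot_liftE _ pres_kernel (free_gen x)) (free_lift_gen f x). Qed.

End PresentedLift.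

Section RelativeLift.
Local Open Scope group_scope.
Variables (H : groupType) (X : Type).
Variable rel : free_group (H * X) -> free_group (H * X) -> Prop.

Local Notation N := (stable_normal_closure rel).
Local Notation hN := (stable_normal_closure_normal rel).
Local Notation K := (rel_presented rel).

Lemma stable_normal_closure_stable : is_stable N.
Proof. by move=> h x Nx M [[nM sM] rM]; apply: (sM); apply: (Nx M). Qed.

Lemma rel_act_gen (h : H) p : rel_act h (free_gen p) = free_gen (h * p.1, p.2) :> free_group (H * X).
Proof. exact: free_lift_gen. Qed.

Lemma rel_actM (h : H) (x y : free_group (H * X)) :
  rel_act h (x * y) = rel_act h x * rel_act h y.
Proof. by rewrite /rel_act gmulfM. Qed.

Lemma rel_actV (h : H) (x : free_group (H * X)) : rel_act h x^-1 = (rel_act h x)^-1.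
Proof. by rewrite /rel_act gmulfV. Qed.

Lemma rel_act_1 (h : H) : rel_act h (1 : free_group (H * X)) = 1.
Proof. by rewrite /rel_act gmulf1. Qed.

Definition rp_act (h : H) (a : K) : K := quot_proj hN (rel_act h (repr a)).

Lemma rp_actE h x : rp_act h (quot_proj hN x) = quot_proj hN (rel_act h x).
Proof.
apply/quot_projP; have /quot_projP h1 := quot_projK (quot_proj hN x).
by have := stable_normal_closure_stable h h1; rewrite rel_actM rel_actV.
Qed.

Lemma rp_actM h a b : rp_act h (a * b) = rp_act h a * rp_act h b.
Proof.
rewrite -(quot_projK a) -(quot_projK b) -gmulfM !rp_actE rel_actM.
exact: gmulfM.
Qed.

Lemma rel_presented_ind (P : K -> Prop) :
  P 1 -> (forall h x, P (rp_act h (rel_pres_gen rel x))) ->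
  (forall y z, P y -> P z -> P (y * z)) -> (forall y, P y -> P y^-1) -> forall y, P y.
Proof.
move=> P1 Pg PM PV y; rewrite -(quot_projK y); move: (repr y).
apply: free_ind => [|[h x]|u v Pu Pv|u Pu]; rewrite ?gmulf1 //.
- by have := Pg h x; rewrite rp_actE rel_act_gen mulg1.
- by rewrite gmulfM; apply: PM.
- by rewrite gmulfV; apply: PV.
Qed.

Lemma rp_act1 h : rp_act h 1 = 1.
Proof. by rewrite -[LHS]/(rp_act h (quot_proj hN 1)) rp_actE rel_act_1. Qed.

Lemma rp_actV h a : rp_act h a^-1 = (rp_act h a)^-1.
Proof. by apply: (mulgI (rp_act h a)); rewrite -rp_actM !mulgV rp_act1. Qed.

Lemma rp_actA h h' a : rp_act (h * h') a = rp_act h (rp_act h' a).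
Proof.
elim/rel_presented_ind: a => [|g x|y z ey ez|y ey].
- by rewrite !rp_act1.
- by rewrite /rel_pres_gen !rp_actE !rel_act_gen /= !mulgA.
- by rewrite !rp_actM ey ez.
- by rewrite !rp_actV ey.
Qed.

Lemma rp_act_id a : rp_act 1 a = a.
Proof.
elim/rel_presented_ind: a => [|g x|y z ey ez|y ey].
- by rewrite !rp_act1.
- by rewrite -rp_actA mul1g.
- by rewrite !rp_actM ey ez.
- by rewrite !rp_actV ey.
Qed.

Lemma rel_pres_rel x y : rel x y -> quot_proj hN x = quot_proj hN y.
Proof. by move=> xy; apply/quot_projP => M [_]; apply; exists x, y. Qed.

Variables (G : groupType) (act : H -> G -> G) (f : X -> G).
Hypothesis act1 : forall y, act 1 y = y.
Hypothesis actA : forall h h' y, act (h * h') y = act h (act h' y).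
Hypothesis actM : forall h y z, act h (y * z) = act h y * act h z.
Let fl := free_lift (fun p : H * X => act p.1 (f p.2)).
Hypothesis hf : forall x y, rel x y -> fl x = fl y.

Lemma rel_lift_act h x : fl (rel_act h x) = act h (fl x).
Proof.
have act_1 g : act g 1 = 1 by apply: (mulgI (act g 1)); rewrite -actM !mulg1.
have act_V g y : act g y^-1 = (act g y)^-1.
  by apply: (mulgI (act g y)); rewrite -actM !mulgV act_1.
have flM y z : fl (y * z) = fl y * fl z by exact: gmulfM.
have flV y : fl y^-1 = (fl y)^-1 by exact: gmulfV.
elim/free_ind: x => [|[g x]|y z ey ez|y ey].
- by rewrite rel_act_1 /fl gmulf1 act_1.
- by rewrite rel_act_gen /fl !free_lift_gen /= actA.
- by rewrite rel_actM !flM ey ez actM.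
- by rewrite rel_actV !flV ey act_V.
Qed.

(** As [fl] is equivariant, its kernel is stable as well as normal, hence contains the closure of
    the relators. *)
Lemma rel_kernel x : N x -> fl x = 1.
Proof.
have act_1 g : act g 1 = 1 by apply: (mulgI (act g 1)); rewrite -actM !mulg1.
move/(_ [set x | fl x = 1]%classic); apply; split; first split.
- exact: (kernel_normal fl).
- by move=> h y /= hy; rewrite rel_lift_act hy act_1.
by move=> _ [y [z [yz ->]]] /=; rewrite /fl gmulfF /= -/fl (hf yz) mulgV.
Qed.

Definition rel_lift : UMagmaMorphism.type K G := @quot_lift _ _ fl _ hN rel_kernel.

Lemma rel_lift_gen h x : rel_lift (rp_act h (rel_pres_gen rel x)) = act h (f x).
Proof.
rewrite rp_actE rel_act_gen mulg1.
exact: etrans (quot_liftE _ rel_kernel (free_gen (h, x))) (free_lift_gen _ _).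
Qed.

Lemma rel_lift_pres_gen x : rel_lift (rel_pres_gen rel x) = f x.
Proof. by rewrite -[rel_pres_gen rel x]rp_act_id rel_lift_gen act1. Qed.

End RelativeLift.

(** * From KL0-KL7 to relations between root elements indexed by pairs of basis vectors *)

Section KL.
Variables (R : comPzRingType) (l : nat) (I : {pred R}) (S G : groupType).
Variables (act : S -> G -> G) (X : idx l -> idx l -> R -> S) (Y : idx l -> idx l -> R -> G).
Implicit Types (i j h k : idx l) (a b r : R).
Local Notation eps := (eps R).

(* The relations KL0-KL7 (and S0) for total families X and Y; the values of X_ii, *)
(* of Y_ii and of Y_ij outside I are irrelevant. *)
Record kl_data : Prop := KlData {
  kl_act1 : forall y, act 1%g y = y;
  kl_actA : forall x x' y, act (x * x')%g y = act x (act x' y);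
  kl_actM : forall x y y', act x (y * y')%g = (act x y * act x y')%g;
  kl_S0 : forall i j r, i != j -> X i j r = X (opi j) (opi i) (- r * eps i * eps j);
  kl_0 : forall i j a, i != j -> a \in I ->
    Y i j a = Y (opi j) (opi i) (- a * eps i * eps j);
  kl_1 : forall i j a b, i != j -> a \in I -> b \in I ->
    (Y i j a * Y i j b)%g = Y i j (a + b);
  kl_2 : forall i j h k r a, i != j -> h != k -> a \in I ->
    h \notin [:: j; opi i] -> k \notin [:: i; opi j] ->
    act (X i j r) (Y h k a) = Y h k a;
  kl_3 : forall i j k r a, i != j -> j != k -> i != k -> a \in I ->
    i \notin [:: opi j; opi k] -> j != opi k ->
    (act (X i j r) (Y j k a) * (Y j k a)^-1)%g = Y i k (r * a);
  kl_4 : forall i j r a, opi i != j -> i != j -> a \in I ->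
    (act (X i (opi i) r) (Y (opi i) j a) * (Y (opi i) j a)^-1)%g =
    (Y i j (r * a * eps i) * Y (opi j) j (- (r * a ^+ 2)))%g;
  kl_5 : forall i j r a, opi i != j -> i != j -> a \in I ->
    (Y i (opi i) a * (act (X (opi i) j r) (Y i (opi i) a))^-1)%g =
    (Y i j (a * r * eps i) * Y (opi j) j (- (a * r ^+ 2)))%g;
  kl_6 : forall i j r a, i != j -> j != opi i -> a \in I ->
    (act (X i j r) (Y j (opi i) a) * (Y j (opi i) a)^-1)%g =
    Y i (opi i) (2%:R * r * a * eps i);
  kl_7 : forall i j h k a b, i != j -> h != k -> a \in I -> b \in I ->
    act (X i j a) (Y h k b) = (Y i j a * Y h k b * (Y i j a)^-1)%g }.

(** T(e_i, e_j r, 0) in terms of T_{i,-j}, because eps_j^2 = 1; in this form S0 and KL0 become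
    symmetry in i and j. *)
Definition short_of (H : groupType) (W : idx l -> idx l -> R -> H) i j r : H :=
  W i (opi j) (eps j * r).
Definition long_of (H : groupType) (W : idx l -> idx l -> R -> H) i r : H := W i (opi i) r.

Hypothesis hI : is_ideal I.
Hypothesis D : kl_data.
Let s := short_of Y.
Let L := long_of Y.
Let sX := short_of X.
Let lX := long_of X.

Lemma neq_opi i : i != opi i. Proof. by rewrite eq_sym opi_neq. Qed.

Lemma neq_planeN i j : i.1 != j.1 -> i != opi j.
Proof. by move=> ij; rewrite plane_neq. Qed.

Lemma opi_inj_eq i j : (opi i == opi j) = (i == j).
Proof. exact: (inj_eq (can_inj (@opiK l))). Qed.

Lemma eq_divg (x y z : G) : (x * y^-1)%g = z -> x = (z * y)%g.
Proof. by move=> <-; rewrite mulgVK. Qed.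

Lemma kl_sC_of (H : groupType) (W : idx l -> idx l -> R -> H) i j r :
  (forall i j r, i != j -> W i j r = W (opi j) (opi i) (- r * eps i * eps j)) ->
  i.1 != j.1 -> short_of W i j r = short_of W j i r.
Proof.
move=> W0 ij; rewrite /short_of [LHS]W0 ?neq_planeN // opiK; congr (W _ _ _).
rewrite epsN; transitivity ((eps j * eps j) * (eps i * r)); first by ring.
by rewrite epsK mul1r.
Qed.

(** KL3-KL6 are brought into the order of factors chosen in [stdata]; the commutations needed for
    this come from KL7 combined with KL2. *)
Lemma kl_stdata : stdata I sX lX act s L.
Proof.
have ti c a : a \in I -> c * a \in I := @idealMl _ _ hI c a.
have sC i j a : i.1 != j.1 -> a \in I -> s i j a = s j i a.
  move=> ij aI; rewrite /s /short_of (kl_0 D) ?neq_planeN ?ti // opiK; congr (Y _ _ _).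
  rewrite epsN; transitivity ((eps j * eps j) * (eps i * a)); first by ring.
  by rewrite epsK mul1r.
have sXC i j r : i.1 != j.1 -> sX i j r = sX j i r.
  exact: (kl_sC_of _ (kl_S0 D)).
have ss0 i j h k r a : i.1 != j.1 -> h.1 != k.1 -> a \in I ->
    h != opi i -> h != opi j -> k != opi i -> k != opi j ->
    act (sX i j r) (s h k a) = s h k a.
  move=> ij hk aI hi hj ki kj; apply: (kl_2 D); rewrite ?neq_planeN ?ti //.
    by rewrite !inE negb_or hi hj.
  by rewrite !inE negb_or opiK !opi_eq ki kj.
have pss i j h k a b : i.1 != j.1 -> h.1 != k.1 -> a \in I -> b \in I ->
    act (sX i j a) (s h k b) = (s i j a * s h k b * (s i j a)^-1)%g.
  by move=> ij hk aI bI; apply: (kl_7 D); rewrite ?neq_planeN ?ti.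
have psl i j h a b : i.1 != j.1 -> a \in I -> b \in I ->
    act (sX i j a) (L h b) = (s i j a * L h b * (s i j a)^-1)%g.
  by move=> ij aI bI; apply: (kl_7 D); rewrite ?neq_opi ?neq_planeN ?ti.
have pls i h k a b : h.1 != k.1 -> a \in I -> b \in I ->
    act (lX i a) (s h k b) = (L i a * s h k b * (L i a)^-1)%g.
  by move=> ij aI bI; apply: (kl_7 D); rewrite ?neq_opi ?neq_planeN ?ti.
have pll i h a b : a \in I -> b \in I ->
    act (lX i a) (L h b) = (L i a * L h b * (L i a)^-1)%g.
  by move=> aI bI; apply: (kl_7 D); rewrite ?neq_opi.
have sl0 i j h r a : i.1 != j.1 -> a \in I -> h != opi i -> h != opi j ->
    act (sX i j r) (L h a) = L h a.
  move=> ij aI hi hj; apply: (kl_2 D); rewrite ?neq_opi ?neq_planeN //.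
    by rewrite !inE negb_or hi hj.
  by rewrite !inE negb_or opiK !opi_eq hi hj.
have ls0 i h k r a : h.1 != k.1 -> a \in I -> h != opi i -> k != opi i ->
    act (lX i r) (s h k a) = s h k a.
  move=> hk aI hi ki; apply: (kl_2 D); rewrite ?neq_opi ?neq_planeN ?ti //.
    by rewrite !inE negb_or hi.
  by rewrite !inE negb_or opiK !opi_eq ki.
have ll0 i h r a : a \in I -> h != opi i -> act (lX i r) (L h a) = L h a.
  move=> aI hi; apply: (kl_2 D); rewrite ?neq_opi //.
    by rewrite !inE negb_or hi.
  by rewrite !inE negb_or opiK !opi_eq hi.
have ss i j k r a : i.1 != j.1 -> k.1 != j.1 -> k.1 != i.1 -> a \in I ->
    act (sX i j r) (s (opi j) k a) = (s (opi j) k a * s i k (eps j * r * a))%g.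
  move=> ij kj ki aI; have ik : i.1 != k.1 by rewrite eq_sym.
  have jk : (opi j).1 != k.1 by rewrite eq_sym.
  have com : commute (s i k (eps j * r * a)) (s (opi j) k a).
    apply/commuteP; rewrite -pss ?ti // ss0 ?neq_opi ?neq_planeN ?ti //.
      by rewrite /= eq_sym.
  have h : (act (sX i j r) (s (opi j) k a) * (s (opi j) k a)^-1)%g = s i k (eps j * r * a).
    rewrite /sX /s /short_of (kl_3 D) ?neq_planeN ?ti //.
    - by congr (Y _ _ _); ring.
    - by rewrite !inE negb_or !opiK !plane_neq.
  by rewrite (eq_divg h) com.
have ss2 i j r a : i.1 != j.1 -> a \in I ->
    act (sX i j r) (s (opi j) i a) = (s (opi j) i a * L i (2%:R * (eps j * r * a)))%g.
  move=> ij aI; have ji : (opi j).1 != i.1 by rewrite eq_sym.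
  have com : commute (L i (2%:R * (eps j * r * a))) (s (opi j) i a).
    by apply/commuteP; rewrite -pls ?ti // ls0 ?neq_opi ?neq_planeN ?ti.
  have h : (act (sX i j r) (s (opi j) i a) * (s (opi j) i a)^-1)%g =
      L i (2%:R * (eps j * r * a)).
    rewrite /sX /s /short_of (kl_6 D) ?neq_planeN ?ti //.
    congr (Y _ _ _); transitivity (2%:R * (eps j * r * a) * (eps i * eps i)); first by ring.
    by rewrite epsK mulr1.
  by rewrite (eq_divg h) com.
have ls i k r a : i.1 != k.1 -> a \in I ->
    act (lX i r) (s (opi i) k a) =
      (s (opi i) k a * s i k (eps i * r * a) * L k (r * a ^+ 2))%g.
  move=> ik aI; have ki : k.1 != i.1 by rewrite eq_sym.
  have a2I c : c * a ^+ 2 \in I by rewrite expr2 mulrA ti.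
  have h : (act (lX i r) (s (opi i) k a) * (s (opi i) k a)^-1)%g =
      (s i k (eps i * r * a) * L k (- (r * a ^+ 2)))%g.
    rewrite /lX /s /short_of (kl_4 D) ?neq_planeN ?ti // opiK /L /long_of.
    congr (Y _ _ _ * Y _ _ _)%g; first by ring.
    by rewrite exprMn [eps k ^+ 2]expr2 epsK mul1r.
  have cL c j b : b \in I -> k.1 != j.1 -> c \in I -> commute (L k c) (s j k b).
    move=> bI kj cI; have jk : j.1 != k.1 by rewrite eq_sym.
    by apply/commuteP; rewrite -pls // ls0 ?neq_opi ?neq_planeN.
  have LN : L k (- (r * a ^+ 2)) = (L k (r * a ^+ 2))^-1%g.
    have L0 : L k 0 = 1%g.
      by apply: (mulgI (L k 0)); rewrite mulg1 /L /long_of (kl_1 D) ?neq_opi ?addr0 ?ideal0.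
    apply: (mulgI (L k (r * a ^+ 2))).
    by rewrite mulgV -L0 /L /long_of (kl_1 D) ?neq_opi ?idealN ?subrr.
  have L2 : L k (2%:R * (eps i * (eps i * r * a) * a)) = (L k (r * a ^+ 2) * L k (r * a ^+ 2))%g.
    rewrite /L /long_of (kl_1 D) ?neq_opi //; congr (Y _ _ _).
    transitivity ((eps i * eps i) * (r * a ^+ 2 + r * a ^+ 2)); first by ring.
    by rewrite epsK mul1r.
  (* KL4 places the factors in the opposite order. Interchanging the short ones yields L_k(2 r a^2),
     which turns L_k(- r a^2) into L_k(r a^2). *)
  have sw : (s i k (eps i * r * a) * s (opi i) k a =
      s (opi i) k a * L k (2%:R * (eps i * (eps i * r * a) * a)) * s i k (eps i * r * a))%g.
    have := ss2 k i (eps i * r * a) a ki aI.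
    by rewrite sXC // pss ?ti // => <-; rewrite mulgVK.
  have c1 : commute (L k (r * a ^+ 2)) (s (opi i) k a) by apply: cL.
  have c2 : commute (L k (r * a ^+ 2)) (s i k (eps i * r * a)) by apply: cL; rewrite ?ti.
  rewrite (eq_divg h) LN; move: sw c1 c2; rewrite L2.
  move: (s (opi i) k a) (s i k _) (L k (r * a ^+ 2)) => A C P sw c1 c2.
  have c1' := commuteVl c1; have c2' := commuteVl c2.
  by rewrite -c2' -mulgA sw !mulgA c1' mulgVK -!mulgA c2.
have sl i j r a : i.1 != j.1 -> a \in I ->
    act (sX i j r) (L (opi j) a) =
      (L (opi j) a * L i (a * r ^+ 2) * s i (opi j) (eps j * r * a))%g.
  move=> ij aI; have ji : j.1 != i.1 by rewrite eq_sym.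
  have h : (L (opi j) a * (act (sX i j r) (L (opi j) a))^-1)%g =
      (s (opi j) i (- (eps j * r * a)) * L i (- (a * r ^+ 2)))%g.
    (* With these indices the acting element is X_{j,-i}(eps_i r), that is [sX j i r], which equals
       [sX i j r]. *)
    have e := kl_5 D (i := opi j) (j := opi i) (eps i * r).
    rewrite sXC // /L /sX /s /short_of /long_of in e *.
    rewrite opiK in e *; rewrite e ?neq_planeN ?opi_inj_eq ?plane_neq // opiK.
    congr (Y _ _ _ * Y _ _ _)%g; first by rewrite epsN; ring.
    by rewrite exprMn [eps i ^+ 2]expr2 epsK mul1r.
  have W : act (sX i j r) (L (opi j) a) =
      (L i (a * r ^+ 2) * s (opi j) i (eps j * r * a) * L (opi j) a)%g.
    have t0 : (s (opi j) i (eps j * r * a) * s (opi j) i (- (eps j * r * a)))%g = 1%g.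
      have z0 : s (opi j) i 0 = 1%g.
        apply: (mulgI (s (opi j) i 0)).
        by rewrite mulg1 /s /short_of mulr0 (kl_1 D) ?neq_planeN ?ideal0 // ?addr0 // eq_sym.
      rewrite -z0 /s /short_of (kl_1 D) ?ti ?idealN ?ti //; last by rewrite opi_inj_eq plane_neq.
      by rewrite mulrN subrr mulr0.
    have u0 : (L i (a * r ^+ 2) * L i (- (a * r ^+ 2)))%g = 1%g.
      have z0 : L i 0 = 1%g.
        by apply: (mulgI (L i 0)); rewrite mulg1 /L /long_of (kl_1 D) ?neq_opi ?addr0 ?ideal0.
      by rewrite -z0 /L /long_of (kl_1 D) ?neq_opi ?idealN ?idealMr ?subrr.
    apply: (mulIg (act (sX i j r) (L (opi j) a))^-1)%g.
    by rewrite mulgV -[RHS]mulgA h -mulgA (mulgA (s _ _ _)) t0 mul1g u0.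
  have arI : a * r ^+ 2 \in I by rewrite idealMr.
  have jNi : opi j != opi i by rewrite opi_inj_eq plane_neq.
  have c1 : commute (L (opi j) a) (L i (a * r ^+ 2)).
    by apply/commuteP; rewrite -pll // ll0 // opiK plane_neq.
  have c2 : commute (L (opi j) a) (s (opi j) i (eps j * r * a)).
    have ji' : (opi j).1 != i.1 by rewrite eq_sym.
    by apply/commuteP; rewrite -pls ?ti // ls0 ?ti // ?opiK ?opi_neq ?plane_neq.
  by rewrite W (sC i) ?ti // -mulgA -c2 !mulgA c1.
by split=> //; [exact: (kl_act1 D)|exact: (kl_actA D)|exact: (kl_actM D)
  |by move=> i j a b ij aI bI; rewrite /s /short_of (kl_1 D) ?neq_planeN ?ti // -mulrDr
  |by move=> i a b aI bI; rewrite /L /long_of (kl_1 D) ?neq_opi].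
Qed.

End KL.

(** * From T1-T7 to KL0-KL7 *)

Section Columns.
Variables (R : comPzRingType) (l : nat).
Implicit Types (i j h k : idx l) (a b r : R) (u v w : vec R l).
Local Notation eps := (eps R).
Local Notation e_ := (basis R).

(* The root element T_ij(r), long when j = -i. *)
Definition tX i j r : vec R l -> vec R l :=
  if j == opi i then transv (e_ i) 0 r
  else transv (e_ i) ((r * eps (opi j)) *: e_ (opi j)) 0.

Lemma tX_perp i j : i != j -> form (e_ i) (e_ (opi j)) = 0.
Proof. by move=> ij; rewrite form_basis opiK (negPf ij) mulr0. Qed.

Lemma tX_form i j r u v : i != j -> form (tX i j r u) (tX i j r v) = form u v.
Proof.
move=> ij; rewrite /tX; case: eqP => _; rewrite transv_form ?form0r //.
by rewrite formZr tX_perp ?mulr0.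
Qed.

Lemma tX_fix i j r k : k != j -> k != opi i -> tX i j r (e_ k) = e_ k.
Proof.
move=> kj ki; rewrite /tX; case: eqP => [_|_]; rewrite transv_id ?form0l //.
- by rewrite form_basis opi_eqC (negPf ki) mulr0.
- by rewrite form_basis opi_eqC (negPf ki) mulr0.
by rewrite formZl form_basis opi_inj_eq [j == k]eq_sym (negPf kj) !mulr0.
Qed.

Lemma tX_move i j r : i != j -> j != opi i -> tX i j r (e_ j) = r *: e_ i + e_ j.
Proof.
move=> ij ji; rewrite /tX (negPf ji); apply/ffunP => k; rewrite transvE formZl !form_basis.
rewrite eqxx (opi_eqC i) (negPf ji) !vE /= !mulr1.
transitivity ((e_ j k : R) + (r * (eps (opi j) * eps (opi j))) * (k == i)%:R).
  by rewrite basisE; ring.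
by rewrite epsK mulr1 basisE addrC.
Qed.

Lemma tX_moveN i j r : i != j -> j != opi i ->
  tX i j r (e_ (opi i)) = (eps i * eps (opi j) * r) *: e_ (opi j) + e_ (opi i).
Proof.
move=> ij ji; rewrite /tX (negPf ji); apply/ffunP => k; rewrite transvE formZl !form_basis.
by rewrite opiK eqxx opi_eq (negPf ji) !vE /= !mulr1; ring.
Qed.

Lemma tX_long i r : tX i (opi i) r (e_ (opi i)) = (eps i * r) *: e_ i + e_ (opi i).
Proof.
rewrite /tX eqxx; apply/ffunP => k; rewrite transvE form0l !form_basis opiK eqxx !vE /=.
by ring.
Qed.

Lemma Ep_normal : is_normal (@Ep R l).
Proof. exact: normal_closure_normal. Qed.

Lemma Ep_tX i j r (f : sp R l) : i != j -> f =1 tX i j r -> Ep f.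
Proof.
move=> ij fX N [_]; apply; rewrite /tX in fX; case: (eqVneq j (opi i)) fX => [_|ji] fX.
  by right; exists i, r.
by left; exists i, j, r; split=> //; rewrite opi_eqC.
Qed.

Lemma column_basis i : is_column (e_ i).
Proof. by exists 1%g, i; split=> //; exact: (normal1 Ep_normal). Qed.

Lemma column_Ep (f : sp R l) u : Ep f -> is_column u -> is_column (f u).
Proof.
move=> hf [g [i [hg ->]]]; exists (f * g)%g, i; split=> //.
exact: (normalM Ep_normal).
Qed.

Lemma tX_sp i j r : i != j -> {f : sp R l | f =1 tX i j r}.
Proof.
move=> ij; rewrite /tX; case: eqP => _.
  by exists (transv_sp r (form0r (e_ i))).
have h : form (e_ i) ((r * eps (opi j)) *: e_ (opi j)) = 0 by rewrite formZr tX_perp ?mulr0.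
by exists (transv_sp 0 h).
Qed.

Lemma column_tX i j r u : i != j -> is_column u -> is_column (tX i j r u).
Proof.
move=> ij hu; have [f fX] := tX_sp r ij; rewrite -fX.
by apply: column_Ep => //; exact: Ep_tX fX.
Qed.

Lemma tX_lin i j r b w : tX i j r (b *: w) = b *: tX i j r w.
Proof. by rewrite /tX; case: eqP => _; rewrite transv_lin. Qed.

End Columns.

Section TransvectionSystem.
Variables (R : comPzRingType) (l : nat) (I : {pred R}).
Variables (S G : groupType) (act : S -> G -> G) (X : idx l -> idx l -> R -> S).
Variable tau : vec R l -> vec R l -> R -> R -> G.
Implicit Types (i j h k : idx l) (a b c r : R) (u v w : vec R l).
Local Notation eps := (eps R).
Local Notation e_ := (basis R).
Hypothesis hI : is_ideal I.
Hypothesis act1 : forall y, act 1%g y = y.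
Hypothesis actA : forall x x' y, act (x * x')%g y = act x (act x' y).
Hypothesis actM : forall x y y', act x (y * y')%g = (act x y * act x y')%g.
Hypothesis X0 : forall i j r, i != j -> X i j r = X (opi j) (opi i) (- r * eps i * eps j).
Hypothesis actX : forall i j r u v a b, i != j -> is_tgen I u v a b ->
  act (X i j r) (tau u v a b) = tau (tX i j r u) (tX i j r v) a b.

(* T1-T7 for a total function; its values off the generators are irrelevant. *)
Record t_relations : Prop := TRelations {
  t1 : forall u v a b r, is_tgen I u (r *: v) a b -> is_tgen I u v (a * r) b ->
    tau u (r *: v) a b = tau u v (a * r) b;
  t2 : forall u v w a b c, is_tgen I u v a b -> is_tgen I u w a c ->
    (tau u v a b * tau u w a c)%g = tau u (v + w) a (b + c + a ^+ 2 * form v w);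
  t3 : forall u v a b, is_tgen I u v a 0 -> is_tgen I u v b 0 ->
    (tau u v a 0 * tau u v b 0)%g = tau u v (a + b) 0;
  t4 : forall u v a, is_tgen I u v a 0 -> is_tgen I v u a 0 -> tau u v a 0 = tau v u a 0;
  t5 : forall u' v' a' b' u v a b, is_tgen I u' v' a' b' -> is_tgen I u v a b ->
    is_tgen I (transv u' (a' *: v') b' u) (transv u' (a' *: v') b' v) a b ->
    (tau u' v' a' b' * tau u v a b * (tau u' v' a' b')^-1)%g =
    tau (transv u' (a' *: v') b' u) (transv u' (a' *: v') b' v) a b;
  t6 : forall u a, is_tgen I u u a 0 -> tau u u a 0 = tau u 0 0 (2%:R * a);
  t7 : forall u v a r, is_tgen I (u + r *: v) 0 0 a -> is_tgen I u 0 0 a ->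
    is_tgen I v 0 0 (a * r ^+ 2) -> is_tgen I v u (a * r) 0 ->
    tau (u + r *: v) 0 0 a = (tau u 0 0 a * tau v 0 0 (a * r ^+ 2) * tau v u (a * r) 0)%g }.

Hypothesis T : t_relations.

(** The values prescribed for Y_ij(a), formed with an arbitrary [tau]; used for the T-group, for Sp
    and for the relative Steinberg group. *)
Definition root_tau i j a : G :=
  if j == opi i then tau (e_ i) 0 0 a else tau (e_ i) (e_ (opi j)) (a * eps (opi j)) 0.

Lemma tgen_long u a : is_column u -> a \in I -> is_tgen I u 0 0 a.
Proof. by move=> cu aI; split; rewrite ?form0r ?ideal0. Qed.

Lemma tgen_long' u a b : is_column u -> a \in I -> b \in I -> is_tgen I u 0 a b.
Proof. by move=> cu aI bI; split; rewrite ?form0r. Qed.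

Lemma tau_long u a b : is_column u -> a \in I -> b \in I -> tau u 0 a b = tau u 0 0 b.
Proof.
move=> cu aI bI; have := t1 T (u := u) (v := 0) (a := a) (b := b) (r := 0).
by rewrite scaler0 mulr0 => ->; rewrite //; apply: tgen_long'; rewrite ?ideal0.
Qed.

Lemma tau0 u v : is_column u -> form u v = 0 -> tau u v 0 0 = 1%g.
Proof.
move=> cu uv; have g : is_tgen I u v 0 0 by split; rewrite ?ideal0.
by apply: (mulgI (tau u v 0 0)); rewrite mulg1 (t3 T) ?addr0.
Qed.

Lemma tau_split u v a b : is_tgen I u v a 0 -> b \in I ->
  tau u v a b = (tau u v a 0 * tau u 0 0 b)%g.
Proof.
move=> [cu uv aI z0] bI; rewrite -(tau_long cu aI bI) (t2 T) ?addr0 ?form0r ?mulr0 ?addr0 ?add0r //.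
exact: tgen_long'.
Qed.

Lemma tau_longD u a b : is_column u -> a \in I -> b \in I ->
  (tau u 0 0 a * tau u 0 0 b)%g = tau u 0 0 (a + b).
Proof.
move=> cu aI bI; rewrite (t2 T) ?addr0 ?form0r ?mulr0 ?addr0 //; exact: tgen_long.
Qed.

Lemma tau_sum u v w a : is_tgen I u v a 0 -> is_tgen I u w a 0 -> form v w = 0 ->
  tau u (v + w) a 0 = (tau u v a 0 * tau u w a 0)%g.
Proof. by move=> hv hw vw; rewrite (t2 T) // vw mulr0 !addr0. Qed.

Lemma tgen_basis i j a b : i != opi j -> a \in I -> b \in I -> is_tgen I (e_ i) (e_ j) a b.
Proof.
move=> ij aI bI; split=> //; first exact: column_basis.
by rewrite form_basis (negPf ij) mulr0.
Qed.

Lemma root_tau_gen i j a : i != j -> a \in I ->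
  exists u v c d, is_tgen I u v c d /\ root_tau i j a = tau u v c d.
Proof.
move=> ij aI; rewrite /root_tau; case: eqP => _.
  by exists (e_ i), 0, 0, a; split=> //; apply: tgen_long => //; exact: column_basis.
exists (e_ i), (e_ (opi j)), (a * eps (opi j)), 0; split=> //.
by apply: tgen_basis; rewrite ?opiK ?ideal0 ?idealMr.
Qed.

Lemma root_tau0 i j a : i != j -> a \in I ->
  root_tau i j a = root_tau (opi j) (opi i) (- a * eps i * eps j).
Proof.
move=> ij aI; have aiI := idealMr hI (eps (opi j)) aI.
rewrite /root_tau; case: (eqVneq j (opi i)) => [->|ji].
  rewrite !opiK eqxx; congr (tau _ _ _ _).
  by rewrite epsN; transitivity (a * (eps i * eps i)); [rewrite epsK mulr1|ring].
rewrite !opiK [opi i == j]eq_sym (negPf ji).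
rewrite (t4 T); last 2 first.
- by apply: tgen_basis; rewrite ?opiK ?ideal0.
- by apply: tgen_basis; rewrite ?ideal0 // opi_inj_eq eq_sym.
congr (tau _ _ _ _); rewrite epsN.
by transitivity (- a * eps j * (eps i * eps i)); [rewrite epsK; ring|ring].
Qed.

(** The action moves the vectors, so each relation compares a moved generator with the original. T4
    places the moved column in the second slot, where T2 is additive. The quadratic term of T2 gives
    the long element of KL4 and T6 that of KL6, while KL5 comes from T7 and KL7 from T5. *)
Lemma root_tau_kl : kl_data I act X root_tau.
Proof.
have z0 := ideal0 hI.
have ci i := column_basis R i.
have ti c a : a \in I -> c * a \in I := @idealMl _ _ hI c a.
have tr c a : a \in I -> a * c \in I := @idealMr _ _ hI c a.
have root_long i a : root_tau i (opi i) a = tau (e_ i) 0 0 a by rewrite /root_tau eqxx.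
have root_short i j a : j != opi i ->
   root_tau i j a = tau (e_ i) (e_ (opi j)) (a * eps (opi j)) 0.
  by move=> ji; rewrite /root_tau (negPf ji).
have hg i k a : i != opi k -> a \in I -> is_tgen I (e_ i) (e_ k) a 0.
  by move=> ik aI; apply: tgen_basis.
have tau4 i k a : i != opi k -> a \in I -> tau (e_ i) (e_ k) a 0 = tau (e_ k) (e_ i) a 0.
  by move=> ik aI; apply: (t4 T); apply: hg; rewrite // opi_eqC.
have tX0 i j r : tX i j r 0 = 0 by rewrite -(scale0r (0 : vec R l)) tX_lin !scale0r.
have inj := opi_inj_eq.
split=> //.
- exact: root_tau0.
- move=> i j a b ij aI bI; case: (eqVneq j (opi i)) => [->|ji].
    by rewrite !root_long tau_longD.
  by rewrite !root_short // (t3 T) -?mulrDl //; apply: hg; rewrite ?opiK ?tr.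
- move=> i j h k r a ij hk aI; rewrite !inE !negb_or => /andP[hj hi] /andP[ki kj].
  case: (eqVneq k (opi h)) hk ki kj => [->|kh] hk ki kj.
    by rewrite root_long actX ?tX0 ?tX_fix //; apply: tgen_long.
  have kj' : opi k != j by rewrite -(opiK j) inj.
  have ki' : opi k != opi i by rewrite inj.
  rewrite root_short // actX ?tX_fix //.
  by apply: hg; rewrite ?opiK ?tr.
- move=> i j k r a ij jk ik aI; rewrite !inE !negb_or => /andP[inj' ink] jnk.
  have ji : j != opi i by rewrite opi_eqC.
  have kj : k != opi j by rewrite opi_eqC.
  have ki : k != opi i by rewrite opi_eqC.
  have akI := tr (eps (opi k)) a aI.
  rewrite !root_short // actX //; last by apply: hg; rewrite ?opiK.
  have kj2 : opi k != opi j by rewrite inj eq_sym.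
  have ki2 : opi k != opi i by rewrite inj eq_sym.
  have kj3 : opi k != j by rewrite opi_eq.
  rewrite tX_move // (tX_fix _ (k := opi k)) //.
  have gj : is_tgen I (e_ (opi k)) (e_ j) (a * eps (opi k)) 0 by apply: hg; rewrite ?inj 1?eq_sym.
  have gri : is_tgen I (e_ (opi k)) (r *: e_ i) (a * eps (opi k)) 0.
    by split=> //; rewrite formZr form_basis inj eq_sym (negPf ik) !mulr0.
  (* The moved column r e_i + e_j goes to the second slot, to be split there. *)
  rewrite (t4 T); last 2 first.
  - split=> //; first by rewrite -tX_move //; exact: column_tX.
    by rewrite formDl formZl !form_basis opiK (negPf ik) (negPf jk) !mulr0 addr0.
  - by split=> //; rewrite formDr formZr !form_basis !inj ![k == _]eq_sym (negPf ik) (negPf jk) !mulr0 addr0.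
  rewrite tau_sum //; last by rewrite formZl form_basis (negPf inj') !mulr0.
  rewrite (tau4 (opi k) j) // mulgK (t1 T) //; last by apply: hg; rewrite ?tr.
  by rewrite tau4 ?tr //; congr (tau _ _ _ _); ring.
- move=> i j r a ij' ij aI; have akI := tr (eps (opi j)) a aI.
  have ji : j != opi i by rewrite eq_sym.
  have ji2 : j != opi (opi i) by rewrite opiK eq_sym.
  have jni : opi j != opi i by rewrite inj eq_sym.
  have jni' : opi j != opi (opi i) by rewrite inj.
  have ra2I : - (r * a ^+ 2) \in I by rewrite idealN // expr2 mulrA ti.
  set al := a * eps (opi j) in akI *; set c := eps i * r.
  have rj d : root_tau (opi j) j d = tau (e_ (opi j)) 0 0 d by rewrite -{2}[j]opiK root_long.
  have gj : is_tgen I (e_ (opi j)) (e_ (opi i)) al 0.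
    by apply: hg; rewrite // opiK eq_sym.
  rewrite rj (root_short (opi i)) // (root_short i) //.
  rewrite actX ?neq_opi //; last by apply: hg; rewrite ?opiK.
  rewrite tX_long (tX_fix _ (k := opi j)) //.
  have gji : is_tgen I (e_ (opi j)) (c *: e_ i) al 0.
    by split=> //; rewrite formZr form_basis inj eq_sym (negPf ij) !mulr0.
  have fji : form (e_ (opi j)) (c *: e_ i + e_ (opi i)) = 0.
    rewrite formDr; case: gji => _ -> _ _; case: gj => _ -> _ _; exact: addr0.
  rewrite (t4 T); last 2 first.
  - split=> //; first by rewrite /c -tX_long; apply: column_tX; rewrite ?neq_opi.
    by rewrite formC fji oppr0.
  - by split.
  have fr : form (c *: e_ i) (e_ (opi i)) = r.
    rewrite formZl form_basis opiK eqxx mulr1 /c mulrAC epsK; exact: mul1r.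
  have al2 : al ^+ 2 = a ^+ 2 by rewrite exprMn [eps _ ^+ 2]expr2 epsK mulr1.
  have gji' : is_tgen I (e_ (opi j)) (c *: e_ i) al (- (r * a ^+ 2)) by case: gji; split.
  (* The parameter -(r a^2) cancels the quadratic term of T2, because <c e_i, e_{-i}> = r and [al]
     squares to a^2. *)
  transitivity (tau (e_ (opi j)) (c *: e_ i) al (- (r * a ^+ 2))).
    apply/eqP; rewrite divg_eq; apply/eqP.
    rewrite (tau4 (opi i)) //; last by rewrite opiK.
    rewrite (t2 T) //; congr (tau _ _ _ _).
    by rewrite fr al2; ring.
  rewrite tau_split // (t1 T) //; last by apply: hg; rewrite ?inj ?tr // eq_sym.
  rewrite tau4 ?inj ?tr // 1?eq_sym //; congr (tau _ _ _ _ * _)%g.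
  by rewrite /al /c; ring.
- move=> i j r a ij' ij aI.
  have ji : j != opi i by rewrite eq_sym.
  have ji2 : j != opi (opi i) by rewrite opiK eq_sym.
  have jni : opi j != opi i by rewrite inj eq_sym.
  have inj' : i != opi (opi j) by rewrite opiK.
  set c := eps (opi i) * eps (opi j) * r.
  have c2 : a * c ^+ 2 = a * r ^+ 2.
    by rewrite !exprMn [eps _ ^+ 2]expr2 [eps (opi j) ^+ 2]expr2 !epsK !mul1r.
  have ac2I : a * c ^+ 2 \in I by apply: tr.
  have rj d : root_tau (opi j) j d = tau (e_ (opi j)) 0 0 d by rewrite -{2}[j]opiK root_long.
  have gij d : d \in I -> is_tgen I (e_ i) (e_ (opi j)) d 0 by exact: hg.
  have gji d : d \in I -> is_tgen I (e_ (opi j)) (e_ i) d 0.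
    by apply: hg; rewrite inj eq_sym.
  have gi := tgen_long (ci i) aI.
  rewrite rj root_long root_short // actX // tX0.
  rewrite -{3}[i]opiK tX_moveN // -/c opiK addrC.
  have cc : is_column (e_ i + c *: e_ (opi j)).
    rewrite addrC -[i]opiK -tX_moveN //; exact: column_tX.
  (* The long element at the moved column e_i + c e_{-j} is exactly what T7 expands. *)
  rewrite (t7 T) //; first last.
  - exact: gji (tr _ _ aI).
  - exact: tgen_long.
  - exact: tgen_long.
  have fij : form (e_ i) (e_ (opi j)) = 0 by case: (gij a aI).
  have fx w : form (e_ i) w = 0 -> transv (e_ i) (0 *: 0) a w = w.
    by move=> iw; rewrite scaler0 transv_id ?form0l.
  have cB : commute (tau (e_ i) 0 0 a) (tau (e_ (opi j)) 0 0 (a * c ^+ 2)).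
    apply/commuteP; have gB := tgen_long (ci (opi j)) ac2I.
    by rewrite (t5 T) // ?fx ?form0r.
  have cC : commute (tau (e_ i) 0 0 a) (tau (e_ (opi j)) (e_ i) (a * c) 0).
    apply/commuteP; have gC := gji _ (tr c a aI).
    by rewrite (t5 T) // ?fx ?form_alt.
  have -> : a * r * eps i * eps (opi j) = - (a * c) by rewrite /c !epsN; ring.
  have -> : tau (e_ i) (e_ (opi j)) (- (a * c)) 0 = (tau (e_ (opi j)) (e_ i) (a * c) 0)^-1%g.
    apply: (mulIg (tau (e_ (opi j)) (e_ i) (a * c) 0)).
    have acI := tr c a aI; rewrite mulVg (tau4 i) ?idealN //.
    rewrite (t3 T) ?addNr; [|by apply: gji; rewrite ?idealN|exact: gji].
    by apply: tau0; rewrite // form_basis inj eq_sym (negPf ij) mulr0.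
  have -> : tau (e_ (opi j)) 0 0 (- (a * r ^+ 2)) = (tau (e_ (opi j)) 0 0 (a * c ^+ 2))^-1%g.
    apply: (mulIg (tau (e_ (opi j)) 0 0 (a * c ^+ 2))).
    rewrite mulVg c2 tau_longD ?idealN -?c2 // addNr.
    by apply: tau0; rewrite ?form0r.
  move: cB cC; move: (tau (e_ i) 0 0 a) (tau _ 0 0 _) (tau _ (e_ i) _ _) => A B C cB cC.
  by rewrite cB -mulgA cC !invgM -!mulgA mulVKg.
- move=> i j r a ij ji aI; have aiI := tr (eps i) a aI.
  have ji2 : opi i != opi j by rewrite inj.
  have inN : i != opi i := neq_opi i.
  have inj' : i != opi j by rewrite opi_eqC.
  rewrite root_long root_short ?opiK // 1?inj 1?eq_sym //.
  rewrite actX //; last by apply: hg; rewrite // eq_sym.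
  rewrite tX_move // (tX_fix _ (k := i)) //.
  have gj : is_tgen I (e_ i) (e_ j) (a * eps i) 0 by apply: hg.
  have gri : is_tgen I (e_ i) (r *: e_ i) (a * eps i) 0.
    by split; rewrite // formZr form_alt mulr0.
  have f0 : form (e_ i) (r *: e_ i + e_ j) = 0.
    by rewrite formDr; case: gj => _ -> _ _; case: gri => _ -> _ _; exact: addr0.
  rewrite (t4 T); last 2 first.
  - split=> //; first by rewrite -tX_move //; exact: column_tX.
    by rewrite formC f0 oppr0.
  - by split.
  rewrite tau_sum //; last first.
    by rewrite formZl; case: gj => _ -> _ _; rewrite mulr0.
  rewrite (tau4 j i) //.
  rewrite mulgK (t1 T) //; last by split; rewrite ?form_alt ?tr.
  rewrite (t6 T); last by split; rewrite ?form_alt ?tr.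
  by congr (tau _ _ _ _); ring.
- move=> i j h k a b ij hk aI bI.
  have [u [v [c [d [g ->]]]]] := root_tau_gen hk bI.
  rewrite actX // /root_tau; have gX : is_tgen I (tX i j a u) (tX i j a v) c d.
    case: g => cu uv cI dI; split=> //; first exact: column_tX.
    by rewrite tX_form.
  case: (eqVneq j (opi i)) => [ji|ji].
    rewrite (t5 T) //; first by rewrite /tX ji eqxx scaler0.
    - exact: tgen_long.
    by move: gX; rewrite /tX ji eqxx scaler0.
  rewrite (t5 T) //; first by rewrite /tX (negPf ji).
  - by apply: hg; rewrite ?opiK ?tr.
  by move: gX; rewrite /tX (negPf ji).
Qed.

End TransvectionSystem.

(** * The projection of the Steinberg group to the symplectic group *)

Section SpSystem.
Variables (R : comPzRingType) (l : nat).
Implicit Types (i j h k : idx l) (a b c r : R) (u v w : vec R l) (f g : sp R l).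

Lemma spD f u v : f (u + v) = f u + f v.
Proof. by have := sp_linear f 1 u v; rewrite !scale1r. Qed.

Lemma sp0 f : f 0 = 0.
Proof. by apply: (addrI (f 0)); rewrite -spD !addr0. Qed.

Lemma spZ f a u : f (a *: u) = a *: f u.
Proof. by have := sp_linear f a u 0; rewrite !addr0 sp0 addr0. Qed.

Lemma sp_transv f u v a w : f (transv u v a w) = transv (f u) (f v) a (f w).
Proof. by rewrite /transv !spD !spZ !sp_form. Qed.

Definition tau_sp u v a b : sp R l :=
  if pselect (form u (a *: v) = 0) is left h then transv_sp b h else 1%g.

Lemma tau_spE u v a b : form u (a *: v) = 0 -> tau_sp u v a b =1 transv u (a *: v) b.
Proof. by rewrite /tau_sp; case: pselect. Qed.

Lemma tau_sp_tgen u v a b : is_tgen predT u v a b -> tau_sp u v a b =1 transv u (a *: v) b.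
Proof. by case=> _ uv _ _; apply: tau_spE; rewrite formZr uv mulr0. Qed.

Lemma cj_tau_sp f u v a b : is_tgen predT u v a b -> cj f (tau_sp u v a b) = tau_sp (f u) (f v) a b.
Proof.
move=> [_ uv _ _]; apply: (canLR (mulgK f)); apply: spP => w /=.
have uav : form u (a *: v) = 0 by rewrite formZr uv mulr0.
by rewrite tau_spE // sp_transv spZ tau_spE // -spZ sp_form.
Qed.

Lemma tau_sp_relations : t_relations predT tau_sp.
Proof.
split=> [u v a b r h1 h2|u v w a b c h1 h2|u v a b h1 h2|u v a h1 h2|u' v' a' b' u v a b h1 h2 h3
  |u a h|u v a r h1 h2 h3 h4].
- by apply: spP => w; rewrite !tau_sp_tgen // scalerA.
- have [cu uv _ _] := h1; have [_ uw _ _] := h2.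
  apply: spP => x /=; rewrite !tau_sp_tgen //; last by split; rewrite // formDr uv uw addr0.
  by rewrite transv_comp ?formZr ?uv ?uw ?mulr0 // formZl scalerDr mulrA expr2.
- have [cu uv _ _] := h1; apply: spP => x /=; rewrite !tau_sp_tgen //.
  by rewrite transv_comp ?formZr ?uv ?uw ?mulr0 // formZl form_alt !mulr0 !addr0 -scalerDl.
- by apply: spP => x; rewrite !tau_sp_tgen // transvZ transvC.
- by rewrite -/(cj _ _) cj_tau_sp // !(tau_sp_tgen h1).
- have hu : is_tgen predT u 0 0 (2%:R * a) by case: h => cu _ _ _; split; rewrite ?form0r.
  by apply: spP => x; rewrite !tau_sp_tgen //; apply/ffunP => k; rewrite !(transvE, fE, vE); ring.
apply: spP => x /=; rewrite !tau_sp_tgen //; have [_ vu _ _] := h4.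
have uv : form u v = 0 by rewrite formC vu oppr0.
by apply/ffunP => k; rewrite !(transvE, fE, vE, vu, uv); ring.
Qed.

Definition root_sp := root_tau tau_sp.

Lemma root_spE i j r : i != j -> root_sp i j r =1 tX i j r.
Proof.
move=> ij w; rewrite /root_sp /root_tau /tX; case: eqP => _; rewrite tau_spE //.
- by rewrite scaler0.
- by rewrite scaler0 form0r.
by rewrite formZr tX_perp ?mulr0.
Qed.

(** For I = R and the conjugation action these relations contain S0-S5 for the elementary matrices,
    which is what the projection requires. *)
Lemma root_sp_kl : kl_data predT (@cj (sp R l)) root_sp root_sp.
Proof.
apply: (root_tau_kl (ideal_predT R)) => [y|x x' y|x y y'|i j r ij|i j r u v a b ij h|].
- by rewrite /cj mul1g invg1 mulg1.
- by rewrite /cj !gnorm.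
- by rewrite /cj !gnorm.
- exact: (root_tau0 (ideal_predT R) tau_sp_relations).
- by rewrite cj_tau_sp // !root_spE.
exact: tau_sp_relations.
Qed.

End SpSystem.

Section Projection.
Variables (R : comPzRingType) (l : nat).
Implicit Types (i j h k : idx l) (a b c r : R) (u v w : vec R l) (f g : sp R l).

Definition st_proj_gen (x : xgen R l) : sp R l := root_sp (xrow x) (xcol x) (xpar x).

Lemma st_proj_rel x y : @st_rel R l x y -> free_lift st_proj_gen x = free_lift st_proj_gen y.
Proof.
have gen i j r ij : free_lift st_proj_gen (@Xw R l i j r ij) = root_sp i j r.
  exact: free_lift_gen.
have K := root_sp_kl R l.
case=> [i j r ij ji|i j r s ij|i j h k r s ij hk hh kk|i j k r s ij jk ik hi hj|i j r s ii nij ij jj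
  |i j r s ij ji ii]; rewrite /comm ?gmulfM ?gmulfV ?gmulf1 /= ?gen.
- exact: (kl_S0 K).
- exact: (kl_1 K).
- by apply/eqP; rewrite divg_eq1; apply/eqP; exact: (kl_2 K).
- exact: (kl_3 K).
- exact: (kl_4 K).
exact: (kl_6 K).
Qed.

Definition st_proj := pres_lift st_proj_rel.

Lemma st_projX i j r ij : st_proj (Xst i j r ij) =1 tX i j r.
Proof. by move=> w; rewrite /st_proj pres_lift_gen /= root_spE. Qed.

Lemma st_proj_Ep x : Ep (st_proj x).
Proof.
have N := @Ep_normal R l; elim/pres_ind: x => [|x|x y hx hy|x hx].
- by rewrite gmulf1; exact: (normal1 N).
- apply: (Ep_tX (xneq x)) => w; rewrite /st_proj pres_lift_gen root_spE //; exact: xneq.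
- by rewrite gmulfM; exact: (normalM N).
by rewrite gmulfV; exact: (normalV N).
Qed.

Definition Xt i j r : StSp R l := if pselect (i != j) is left ij then Xst i j r ij else 1%g.

Lemma XtE i j r ij : Xt i j r = Xst i j r ij.
Proof.
by rewrite /Xt; case: pselect => [ij'|//]; congr (Xst _ _ _ _); exact: bool_irrelevance.
Qed.

(** For I = R and conjugation, KL0-KL4 are S0-S4 and KL6 is S5. KL5 is S4 once more, its left-hand
    side being the same commutator, and KL7 is a tautology. *)
Lemma Xt_kl : kl_data predT (@cj (StSp R l)) Xt Xt.
Proof.
have qX i j r (ij : i != j) : quot_proj (normal_closure_normal (relators (@st_rel R l))) (Xw r ij) = Xt i j r.
  by rewrite (XtE r ij).
have rel x y := @pres_rel _ (@st_rel R l) x y.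
have S4 i j r s : opi i != j -> i != j ->
    comm (Xt i (opi i) r) (Xt (opi i) j s) =
    (Xt i j (r * s * eps R i) * Xt (opi j) j (- (r * s ^+ 2)))%g.
  move=> nij ij; have jj : opi j != j by rewrite eq_sym neq_opi.
  by have := rel _ _ (st_S4 r s (neq_opi i) nij ij jj); rewrite /comm ?gmulfM ?gmulfV ?gmulf1 /= ?qX.
split=> [y|x x' y|x y y'|i j r ij|i j r ij _|i j r s ij _ _|i j h k r s ij hk _ hh kk
  |i j k r s ij jk ik _ hi hj|i j r s nij ij _|i j r s nij ij _|i j r s ij ji _|] //.
- by rewrite /cj mul1g invg1 mulg1.
- by rewrite /cj !gnorm.
- by rewrite /cj !gnorm.
- have ji : opi j != opi i by rewrite opi_inj_eq eq_sym.
  by have := rel _ _ (st_S0 r ij ji); rewrite ?gmulfM ?gmulfV ?gmulf1 /= ?qX.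
- have ji : opi j != opi i by rewrite opi_inj_eq eq_sym.
  by have := rel _ _ (st_S0 r ij ji); rewrite ?gmulfM ?gmulfV ?gmulf1 /= ?qX.
- by have := rel _ _ (st_S1 r s ij); rewrite ?gmulfM ?gmulfV ?gmulf1 /= ?qX.
- by have := rel _ _ (st_S2 r s ij hk hh kk); rewrite /comm ?gmulfM ?gmulfV ?gmulf1 /= ?qX => /eqP; rewrite divg_eq1 => /eqP.
- by have := rel _ _ (st_S3 r s ij jk ik hi hj); rewrite /comm ?gmulfM ?gmulfV ?gmulf1 /= ?qX.
- exact: S4.
- by rewrite -S4 // /comm /cj !gnorm.
have ii := neq_opi i.
by have := rel _ _ (st_S5 r s ij ji ii); rewrite /comm ?gmulfM ?gmulfV ?gmulf1 /= ?qX.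
Qed.

End Projection.

(** * The relations KL0-KL7 in the relative Steinberg group *)

Section RelativeTotal.
Variables (R : comPzRingType) (l : nat) (I : {pred R}).
Implicit Types (i j h k : idx l) (a b c r : R) (u v w : vec R l).
Hypothesis hI : is_ideal I.
Local Notation act := (@rp_act _ _ (@kl_rel R l I)).

Definition Yt i j a : StSp_rel l I :=
  if pselect (i != j) is left ij then
    if pselect (a \in I) is left aI then Yst i j a ij aI else 1%g
  else 1%g.

Lemma YtE i j a ij aI : Yt i j a = Yst i j a ij aI.
Proof.
rewrite /Yt; case: pselect => [ij'|//]; case: pselect => [aI'|//].
by congr (Yst _ _ _ _ _); exact: bool_irrelevance.
Qed.

Lemma Yt_kl : kl_data I act (@Xt R l) Yt.
Proof.
pose hN := stable_normal_closure_normal (@kl_rel R l I).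
have qY i j a (ij : i != j) (aI : a \in I) : quot_proj hN (Yw ij aI) = Yt i j a.
  by rewrite (YtE ij aI).
have qXY i j r h k a (ij : i != j) (hk : h != k) (aI : a \in I) :
    quot_proj hN (rel_act (Xst i j r ij) (Yw hk aI)) = act (Xt i j r) (Yt h k a).
  by rewrite -rp_actE (YtE hk aI) (XtE r ij).
have rel x y := @rel_pres_rel _ _ (@kl_rel R l I) x y.
have ti c a : a \in I -> c * a \in I := @idealMl _ _ hI c a.
have tr c a : a \in I -> a * c \in I := @idealMr _ _ hI c a.
have tn a : a \in I -> - a \in I := @idealN _ _ hI a.
have t2 r a : a \in I -> r * a ^+ 2 \in I by move=> aI; rewrite expr2 mulrA ti.
have K := Xt_kl R l; have ii := @neq_opi l.
split=> [y|x x' y|x y y'|i j r ij|i j r ij aI|i j r s ij aI bI|i j h k r s ij hk aI hh kk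
  |i j k r s ij jk ik aI hi hj|i j r s nij ij aI|i j r s nij ij aI|i j r s ij ji aI
  |i j h k a b ij hk aI bI] //.
- exact: rp_act_id.
- exact: rp_actA.
- exact: rp_actM.
- exact: (kl_S0 K).
- have ji : opi j != opi i by rewrite opi_inj_eq eq_sym.
  have aI' : - r * eps R i * eps R j \in I by rewrite !tr ?tn.
  by have := rel _ _ (kl_KL0 ij ji aI aI'); rewrite !qY.
- have abI := idealD hI aI bI.
  by have := rel _ _ (kl_KL1 ij aI bI abI); rewrite gmulfM /= !qY.
- by have := rel _ _ (kl_KL2 r ij hk aI hh kk); rewrite qXY qY.
- have raI := ti r s aI.
  by have := rel _ _ (kl_KL3 ij jk ik aI raI hi hj); rewrite ?gmulfM ?gmulfV /= qXY !qY.
- have jj : opi j != j by rewrite eq_sym ii.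
  have raI : r * s * eps R i \in I by rewrite tr ?ti.
  have r2I : - (r * s ^+ 2) \in I by rewrite tn ?t2.
  by have := rel _ _ (kl_KL4 (ii i) nij ij jj aI raI r2I);
    rewrite ?gmulfM ?gmulfV /= qXY !qY.
- have jj : opi j != j by rewrite eq_sym ii.
  have arI : s * r * eps R i \in I by rewrite !tr.
  have r2I : - (s * r ^+ 2) \in I by rewrite tn ?tr.
  by have := rel _ _ (kl_KL5 (ii i) nij ij jj aI arI r2I);
    rewrite ?gmulfM ?gmulfV /= qXY !qY.
- have raI : 2%:R * r * s * eps R i \in I by rewrite tr ?ti.
  by have := rel _ _ (kl_KL6 ij ji (ii i) aI raI); rewrite ?gmulfM ?gmulfV /= qXY !qY.
by have := rel _ _ (kl_KL7 ij hk aI bI); rewrite ?gmulfM ?gmulfV /= qXY !qY.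
Qed.

End RelativeTotal.

(** * The projection maps onto Ep, and columns are translates of basis vectors *)

Section Orbit.
Variables (R : comPzRingType) (l : nat).
Hypothesis hl : (3 <= l)%N.
Implicit Types (i j : idx l) (a b c r : R) (u v w : vec R l).
Local Notation e_ := (basis R).
Local Notation "i _|_ w" := (supp predT (perp i) w) (at level 70).
Local Notation sX := (short_of (@Xt R l)).
Local Notation lX := (long_of (@Xt R l)).
Local Notation X := (heis sX lX).

Lemma sp_VK (f : sp R l) : cancel f (f^-1)%g.
Proof. by move=> w; rewrite -[LHS]/(sp_fun (f^-1 * f)%g w) mulVg. Qed.

Lemma sp_KV (f : sp R l) : cancel (f^-1)%g f.
Proof. by move=> w; rewrite -[LHS]/(sp_fun (f * f^-1)%g w) mulgV. Qed.

Lemma Xt_stdata : stdata predT sX lX (@cj (StSp R l)) sX lX.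
Proof. exact: kl_stdata (ideal_predT R) (Xt_kl R l). Qed.

Lemma st_proj_short i j r : i.1 != j.1 -> st_proj R l (sX i j r) =1 transv (e_ i) (r *: e_ j) 0.
Proof.
move=> ij w; rewrite /short_of (XtE _ (neq_planeN ij)) st_projX /tX opi_inj_eq eq_sym plane_neq //.
by rewrite opiK mulrAC epsK mul1r.
Qed.

Lemma st_proj_long i r : st_proj R l (lX i r) =1 transv (e_ i) 0 r.
Proof. by move=> w; rewrite /long_of (XtE _ (neq_opi i)) st_projX /tX eqxx. Qed.

Lemma st_proj_heis i v b : v (opi i) = 0 -> st_proj R l (X i v b) =1 transv (e_ i) v b.
Proof.
move=> v0; pose P (x : StSp R l) (f : vec R l -> vec R l) := st_proj R l x =1 f.
apply: (E_transv (ideal_predT R) Xt_stdata (P := P) (Dp := predC1 (opi i))) => //.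
- by rewrite /= eqxx.
- by move=> x y f g xf yg w; rewrite gmulfM /= yg xf.
- by move=> a _; exact: st_proj_long.
- by move=> j a _ ij _; exact: st_proj_short.
by move=> j; split=> // /negPn/eqP ->.
Qed.

Definition st_image (g : vec R l -> vec R l) : Prop := exists x, st_proj R l x =1 g.

Lemma st_image_ext g g' : g =1 g' -> st_image g -> st_image g'.
Proof. by move=> gg' [x xg]; exists x => w; rewrite xg. Qed.

Lemma st_image_comp g g' : st_image g -> st_image g' -> st_image (g \o g').
Proof. by move=> [x xg] [y yg]; exists (x * y)%g => w; rewrite gmulfM /= yg xg. Qed.

Lemma st_image_divl g h k : st_image g -> st_image h -> h \o k =1 g -> st_image k.
Proof.
move=> [x xg] [y yh] hk; exists (y^-1 * x)%g => w.
by rewrite gmulfM gmulfV /= xg -hk /= -yh; exact: sp_VK.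
Qed.

Lemma st_image_divr g h k : st_image g -> st_image h -> k \o h =1 g -> st_image k.
Proof.
move=> [x xg] [y yh] kh; exists (x * y^-1)%g => w.
rewrite gmulfM gmulfV /= xg -kh /= -yh; congr k.
exact: sp_KV.
Qed.

Lemma st_image_basis i v b : v (opi i) = 0 -> st_image (transv (e_ i) v b).
Proof. by move=> v0; exists (X i v b); exact: st_proj_heis. Qed.

Lemma st_image_conj x u v b : st_image (transv u v b) ->
  st_image (transv (st_proj R l x u) (st_proj R l x v) b).
Proof.
move=> [y yE]; exists (x * y * x^-1)%g => w; rewrite !gmulfM gmulfV /= yE sp_transv.
congr (transv _ _ _ _); exact: sp_KV.
Qed.

(** T(w, 0, a) is the quotient of T(e_i + w, 0, a), a conjugate of T(e_i, 0, a) by an element of the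
    range, and T(e_i, a w, a). *)
Lemma st_image_perp i w a : i _|_ w -> st_image (transv w 0 a).
Proof.
move=> iw; have wi := perp_coord iw; have wi' := perp_coordN iw.
have [x xE] : st_image (transv (e_ (opi i)) (eps R (opi i) *: w) 0).
  by apply: st_image_basis; rewrite opiK vE wi mulr0.
apply: (st_image_divr (g := transv (e_ i + w) 0 a) (h := transv (e_ i) (a *: w) a)).
- have h := st_image_conj x (st_image_basis (i := i) (v := 0) a (v0E R (opi i))).
  rewrite sp0 xE in h.
  suff e : transv (e_ (opi i)) (eps R (opi i) *: w) 0 (e_ i) = e_ i + w by rewrite -e.
  apply/ffunP => k; rewrite !(transvE, fE, vE, opiK, wi, wi', eqxx) /=.
  by rewrite mulr1 mulrA epsK; ring.
- by apply: st_image_basis; rewrite vE wi' mulr0.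
move=> y; apply/ffunP => k.
by rewrite /= /transv !(formDl, formDr, formZl, formZr, form0l, vE, form_alt, perp_forml iw, perp_formr iw); ring.
Qed.

(** T(p e_i, v, 0) T(q e_{-i}, v, 0) = T(x, v, 0) T(v, 0, p q eps_i) for x = p e_i + q e_{-i}. *)
Lemma st_image_hyper i p q v : i _|_ v -> st_image (transv (@hyper R l i p q) v 0).
Proof.
move=> iv; have vi := perp_coord iv; have vi' := perp_coordN iv.
apply: (st_image_divr (g := transv (e_ i) (p *: v) 0 \o transv (e_ (opi i)) (q *: v) 0)
  (h := transv v 0 (p * q * eps R i))).
- by apply: st_image_comp; apply: st_image_basis; rewrite vE ?opiK ?vi ?vi' mulr0.
- exact: st_image_perp iv.
have fi := perp_forml iv; have fi' := perp_forml (i := opi i) iv.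
have gi := perp_formr iv; have gi' := perp_formr (i := opi i) iv.
move=> y; apply/ffunP => k; have e : form (e_ i) (e_ (opi i)) = eps R i.
  by rewrite form_basis opiK eqxx mulr1.
rewrite /= hyperV /transv !(formDl, formDr, formZl, formZr, form0l, form0r, vE, form_alt, e, fi, fi', gi, gi').
by ring.
Qed.

Lemma st_image_long u a : st_image (transv u 0 a).
Proof.
pose i : idx l := (widen_ord hl ord0, false).
have [k [ki _]] := third_plane hl i i.
have ir := rest_perp i u; have ip := pl_perp u (i := i) (k := k).
have pr : form (pl i u) (rest i u) = 0.
  rewrite plV hyperV formDl !formZl (perp_forml ir) (perp_forml (i := opi i) ir).
  by rewrite !mulr0 addr0.
have rp : form (rest i u) (pl i u) = 0 by rewrite formC pr oppr0.
apply: (st_image_ext (g := transv (pl i u) 0 a \o (transv (rest i u) 0 a \o transv (pl i u) (a *: rest i u) 0))).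
  move=> y; rewrite [in RHS](pl_rest i u); apply/ffunP => m.
  by rewrite /= /transv !(formDl, formDr, formZl, formZr, form0l, form0r, vE, form_alt, pr, rp); ring.
apply: st_image_comp; first by apply: (@st_image_perp k); apply: ip; rewrite eq_sym.
apply: st_image_comp; first exact: st_image_perp ir.
by rewrite plV; apply: st_image_hyper => j; have [_ h] := ir j; split=> // /h; rewrite vE => ->; rewrite mulr0.
Qed.

(** T(u + v, 0, 1) T(u, 0, b) = T(u, 0, 1) T(v, 0, 1) T(u, v, b), and all other factors are in the
    range by [st_image_long]. *)
Lemma st_image_transv u v b : form u v = 0 -> st_image (transv u v b).
Proof.
move=> uv; have vu : form v u = 0 by rewrite formC uv oppr0.
apply: (st_image_divl (g := transv (u + v) 0 1 \o transv u 0 b) (h := transv u 0 1 \o transv v 0 1)).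
- by apply: st_image_comp; exact: st_image_long.
- by apply: st_image_comp; exact: st_image_long.
move=> y; apply/ffunP => m.
by rewrite /= /transv !(formDl, formDr, formZl, formZr, form0l, form0r, vE, form_alt, uv, vu); ring.
Qed.

(** A conjugate of a root element by any isometry is again some T(u, v, b) with u orthogonal to v,
    hence in the range. *)
Lemma range_normal : is_normal [set f : sp R l | exists x, st_proj R l x = f]%classic.
Proof.
split=> [|_ _ [x <-] [y <-]|_ [x <-]|_ f [x <-]].
- by exists 1%g; rewrite gmulf1.
- by exists (x * y)%g; rewrite gmulfM.
- by exists x^-1%g; rewrite gmulfV.
elim/pres_ind: x => [|[i j r ij]|x y [x' ex] [y' ey]|x [x' ex]].
- by exists 1%g; rewrite !gmulf1 mulg1 mulgV.
- have [y yE] : st_image (transv (f (e_ i)) (f (if j == opi i then 0 else (r * eps R (opi j)) *: e_ (opi j)))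
      (if j == opi i then r else 0)).
    apply: st_image_transv; rewrite sp_form; case: eqP => _; rewrite ?form0r //.
    by rewrite formZr tX_perp ?mulr0.
  exists y; apply: spP => w; rewrite yE /= st_projX /tX.
  have fK : w = f ((f^-1)%g w) by rewrite sp_KV.
  by rewrite {1}fK -sp_transv; case: eqP.
- by exists (x' * y')%g; rewrite !gmulfM ex ey conj_mul.
by exists x'^-1%g; rewrite !gmulfV ex conj_inv.
Qed.

Lemma Ep_st_proj f : Ep f -> exists x, st_proj R l x = f.
Proof.
move/(_ [set g : sp R l | exists x, st_proj R l x = g]%classic); apply.
split; first exact: range_normal.
move=> g [[i [j [a [ij ij' ge]]]]|[i [a ge]]].
  have [x xE] : st_image (transv (e_ i) ((a * eps R (opi j)) *: e_ (opi j)) 0).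
    by apply: st_image_transv; rewrite formZr tX_perp ?mulr0.
  by exists x; apply: spP => w; rewrite ge.
have [x xE] := st_image_long (e_ i) a.
by exists x; apply: spP => w; rewrite ge.
Qed.

Lemma column_orbit u : is_column u -> exists x i, u = st_proj R l x (e_ i).
Proof. by move=> [f [i [/Ep_st_proj [x <-] ->]]]; exists x, i. Qed.

Lemma column_st_proj x u : is_column u -> is_column (st_proj R l x u).
Proof. by apply: column_Ep; exact: st_proj_Ep. Qed.

End Orbit.

(** * The isomorphism *)

Section KlLift.
Variables (R : comPzRingType) (l : nat) (I : {pred R}) (G : groupType).
Variables (act : StSp R l -> G -> G) (Y : idx l -> idx l -> R -> G).
Hypothesis K : kl_data I act (@Xt R l) Y.
Implicit Types (i j h k : idx l) (a b r : R).

Definition kl_gen (x : ygen l I) : G := Y (yrow x) (ycol x) (ypar x).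

Lemma kl_lift_rel x y : @kl_rel R l I x y ->
  free_lift (fun p : StSp R l * ygen l I => act p.1 (kl_gen p.2)) x =
  free_lift (fun p : StSp R l * ygen l I => act p.1 (kl_gen p.2)) y.
Proof.
set fl := free_lift _.
have gY i j a (ij : i != j) (aI : a \in I) : fl (Yw ij aI) = Y i j a.
  by rewrite /fl free_lift_gen /= (kl_act1 K).
have gXY i j r h k a (ij : i != j) (hk : h != k) (aI : a \in I) :
    fl (rel_act (Xst i j r ij) (Yw hk aI)) = act (Xt i j r) (Y h k a).
  by rewrite rel_act_gen /fl free_lift_gen /= mulg1 (XtE r ij).
have flM y1 y2 : fl (y1 * y2)%g = (fl y1 * fl y2)%g by exact: gmulfM.
have flV y1 : fl (y1^-1)%g = ((fl y1)^-1)%g by exact: gmulfV.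
case=> {x y} [i j a ij ji aI aI'|i j a b ij aI bI abI|i j h k r a ij hk aI hh kk
  |i j k r a ij jk ik aI raI hi hj|i j r a ii nij ij jj aI raI ra2I
  |i j r a ii nij ij jj aI raI ra2I|i j r a ij ji ii aI raI|i j h k a b ij hk aI bI];
  rewrite ?flM ?flV ?gXY ?gY.
- exact: (kl_0 K).
- exact: (kl_1 K).
- exact: (kl_2 K).
- exact: (kl_3 K).
- exact: (kl_4 K).
- exact: (kl_5 K).
- exact: (kl_6 K).
exact: (kl_7 K).
Qed.

Definition kl_lift : UMagmaMorphism.type (StSp_rel l I) G :=
  rel_lift (kl_actA K) (kl_actM K) kl_lift_rel.

Lemma kl_lift_act x y : kl_lift (rp_act x y) = act x (kl_lift y).
Proof.
have act_1 : act x 1%g = 1%g.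
  by apply: (mulgI (act x 1%g)); rewrite -(kl_actM K) !mulg1.
have act_V z : act x z^-1%g = (act x z)^-1%g.
  by apply: (mulgI (act x z)); rewrite -(kl_actM K) !mulgV act_1.
elim/rel_presented_ind: y => [|h y|y z ey ez|y ey].
- by rewrite rp_act1 !gmulf1 act_1.
- by rewrite -rp_actA /kl_lift !rel_lift_gen (kl_actA K).
- by rewrite rp_actM !gmulfM ey ez (kl_actM K).
by rewrite rp_actV !gmulfV ey act_V.
Qed.

Lemma kl_liftY i j a : i != j -> a \in I -> kl_lift (Yt I i j a) = Y i j a.
Proof. by move=> ij aI; rewrite (YtE ij aI) /kl_lift rel_lift_pres_gen //; exact: (kl_act1 K). Qed.

End KlLift.

(** * The T-group, its universal property and the action of [StSp] on it *)

Section TransvectionGroup.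
Variables (R : comPzRingType) (l : nat) (I : {pred R}).
Hypothesis hI : is_ideal I.
Implicit Types (i j h k : idx l) (a b c r : R) (u v w : vec R l) (x : StSp R l).
Local Notation pi := (st_proj R l).
Local Notation e_ := (basis R).

Definition Tt u v a b : Tgroup l I :=
  if pselect (is_tgen I u v a b) is left h then Tst u v a b h else 1%g.

Lemma TtE u v a b (h : is_tgen I u v a b) : Tt u v a b = Tst u v a b h.
Proof.
by rewrite /Tt; case: pselect => // h'; congr (Tst _ _ _ _ _); exact: Prop_irrelevance.
Qed.

Lemma Tt_relations : t_relations I Tt.
Proof.
have rel g g' := @pres_rel _ (@t_rel R l I) g g'.
have gen u v a b (h : is_tgen I u v a b) :
    quot_proj (normal_closure_normal (relators (@t_rel R l I))) (Tw h) = Tt u v a b.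
  by rewrite (TtE h).
split=> [u v a b r h1 h2|u v w a b c h1 h2|u v a b h1 h2|u v a h1 h2|u' v' a' b' u v a b h1 h2 h3
  |u a h1|u v a r h1 h2 h3 h4].
- by have := rel _ _ (t_T1 h1 h2); rewrite !gen.
- have h3 : is_tgen I u (v + w) a (b + c + a ^+ 2 * form v w).
    have [cu uv aI bI] := h1; have [_ uw _ cI] := h2; split=> //.
      by rewrite formDr uv uw addr0.
    by rewrite !(idealD hI) // expr2 -mulrA idealMr.
  by have := rel _ _ (t_T2 h1 h2 h3); rewrite gmulfM /= !gen.
- have h3 : is_tgen I u v (a + b) 0.
    by have [cu uv aI zI] := h1; have [_ _ bI _] := h2; split; rewrite ?idealD.
  by have := rel _ _ (t_T3 h1 h2 h3); rewrite gmulfM /= !gen.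
- by have := rel _ _ (t_T4 h1 h2); rewrite !gen.
- by have := rel _ _ (t_T5 h1 h2 h3); rewrite !gmulfM gmulfV /= !gen.
- have h2 : is_tgen I u 0 0 (2%:R * a).
    by have [cu uv aI zI] := h1; split; rewrite ?form0r ?idealMl.
  by have := rel _ _ (t_T6 h1 h2); rewrite !gen.
by have := rel _ _ (t_T7 h1 h2 h3 h4); rewrite !gmulfM /= !gen.
Qed.

Lemma tgen_st_proj x u v a b : is_tgen I u v a b -> is_tgen I (pi x u) (pi x v) a b.
Proof. by case=> cu uv aI bI; split; rewrite ?sp_form //; exact: column_st_proj. Qed.

Section Lift.
Variables (G : groupType) (tau : vec R l -> vec R l -> R -> R -> G).
Hypothesis T : t_relations I tau.

Definition t_gen (g : tgen l I) : G := tau (tfst g) (tsnd g) (tpar1 g) (tpar2 g).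

Lemma t_lift_rel g g' : t_rel g g' -> free_lift t_gen g = free_lift t_gen g'.
Proof.
have gen u v a b (h : is_tgen I u v a b) : free_lift t_gen (Tw h) = tau u v a b.
  by rewrite free_lift_gen.
have flM (y1 y2 : free_group (tgen l I)) : free_lift t_gen (y1 * y2)%g = (free_lift t_gen y1 * free_lift t_gen y2)%g.
  exact: gmulfM.
have flV (y1 : free_group (tgen l I)) : free_lift t_gen (y1^-1)%g = ((free_lift t_gen y1)^-1)%g by exact: gmulfV.
case=> {g g'} *; rewrite ?flM ?flV !gen.
- exact: (t1 T).
- exact: (t2 T).
- exact: (t3 T).
- exact: (t4 T).
- exact: (t5 T).
- exact: (t6 T).
exact: (t7 T).
Qed.

Definition t_lift : UMagmaMorphism.type (Tgroup l I) G := pres_lift t_lift_rel.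

Lemma t_liftT u v a b : is_tgen I u v a b -> t_lift (Tt u v a b) = tau u v a b.
Proof. by move=> h; rewrite (TtE h) /t_lift pres_lift_gen. Qed.

End Lift.

Lemma Tt_ind (P : Tgroup l I -> Prop) :
  P 1%g -> (forall u v a b, is_tgen I u v a b -> P (Tt u v a b)) ->
  (forall y z, P y -> P z -> P (y * z)%g) -> (forall y, P y -> P y^-1%g) -> forall y, P y.
Proof.
move=> P1 Pg PM PV; apply: pres_ind => // -[u v a b h]; rewrite -[pres_gen _ _]/(Tst u v a b h).
by rewrite -TtE; exact: Pg.
Qed.

(** T1-T7 are expressed by linear operations, the form, transvections and the set of columns, all
    respected by pi(x); hence each x induces an endomorphism of the T-group. *)
Lemma Tt_twist x : t_relations I (fun u v a b => Tt (pi x u) (pi x v) a b).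
Proof.
have tg := @tgen_st_proj x; have T := Tt_relations.
split=> [u v a b r h1 h2|u v w a b c h1 h2|u v a b h1 h2|u v a h1 h2|u' v' a' b' u v a b h1 h2 h3
  |u a h1|u v a r h1 h2 h3 h4].
- by have := tg _ _ _ _ h1; rewrite spZ => h1'; apply: (t1 T) => //; exact: tg.
- by rewrite (t2 T) ?spD ?sp_form //; exact: tg.
- by rewrite (t3 T) //; exact: tg.
- by rewrite (t4 T) //; exact: tg.
- have := tg _ _ _ _ h3; rewrite !sp_transv !spZ => h3'.
  by rewrite (t5 T) //; exact: tg.
- by rewrite sp0; apply: (t6 T); exact: tg.
have := (tg _ _ _ _ h1, tg _ _ _ _ h2, tg _ _ _ _ h3).
rewrite sp0 spD spZ => -[[h1' h2'] h3'].
by rewrite (t7 T) //; exact: tg.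
Qed.

Definition t_act x : Tgroup l I -> Tgroup l I := t_lift (Tt_twist x).

Lemma t_actT x u v a b : is_tgen I u v a b ->
  t_act x (Tt u v a b) = Tt (pi x u) (pi x v) a b.
Proof. exact: t_liftT. Qed.

Lemma t_act_1 x : t_act x 1%g = 1%g. Proof. exact: gmulf1. Qed.
Lemma t_actM x y z : t_act x (y * z)%g = (t_act x y * t_act x z)%g.
Proof. exact: gmulfM. Qed.
Lemma t_actV x y : t_act x y^-1%g = (t_act x y)^-1%g. Proof. exact: gmulfV. Qed.

Lemma Tt_kl : kl_data I t_act (@Xt R l) (root_tau Tt).
Proof.
apply: (root_tau_kl hI) => [y|x x' y|x y y'|i j r ij|i j r u v a b ij h|].
- elim/Tt_ind: y => [|u v a b h|y z ey ez|y ey].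
  + exact: t_act_1.
  + by rewrite t_actT // gmulf1.
  + by rewrite t_actM ey ez.
  by rewrite t_actV ey.
- elim/Tt_ind: y => [|u v a b h|y z ey ez|y ey].
  + by rewrite !t_act_1.
  + rewrite !t_actT //; last exact: tgen_st_proj.
    by rewrite gmulfM.
  + by rewrite !t_actM ey ez.
  by rewrite !t_actV ey.
- exact: t_actM.
- exact: (kl_S0 (Xt_kl R l)).
- by rewrite t_actT // (XtE r ij) !st_projX.
exact: Tt_relations.
Qed.

(** T2 for the generators with u = e_i is the multiplication law of E_i, so the claim reduces to
    multiples of basis vectors, where T1 and T6 apply. *)
Lemma Tt_heis i v a b : supp predT (predC1 (opi i)) v -> a \in I -> b \in I ->
  kl_lift Tt_kl (heis (short_of (Yt I)) (long_of (Yt I)) i (a *: v) b) = Tt (e_ i) v a b.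
Proof.
move=> hv aI bI; move: v hv b bI; have z0 := ideal0 hI; have T := Tt_relations.
have HG := kl_stdata hI (Yt_kl l hI).
set E := heis _ _; set phi := kl_lift Tt_kl.
have ci := column_basis R i.
have phiL b : b \in I -> phi (long_of (Yt I) i b) = Tt (e_ i) 0 0 b.
  by move=> bI; rewrite /phi kl_liftY ?neq_opi // /root_tau eqxx.
have phiM y z : phi (y * z)%g = (phi y * phi z)%g by exact: gmulfM.
have tg v b : supp predT (predC1 (opi i)) v -> b \in I -> is_tgen I (e_ i) v a b.
  by move=> hv bI; split=> //; rewrite form_basisl (suppE hv) ?mulr0 //= eqxx.
apply: (vec_ind (ideal_predT R)) => [b bI|j c ji _ b bI|v w hv hw Pv Pw b bI].
- by rewrite scaler0 /E (E0 hI HG) phiL // (tau_long hI T).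
- have hj : supp predT (predC1 (opi i)) (c *: e_ j) by apply: (supp_basis (ideal_predT R)).
  have acI := idealMr hI c aI.
  rewrite (tau_split hI T) //; last exact: tg.
  rewrite /E (E_long hI HG). rewrite phiM phiL //; congr (_ * _)%g; rewrite scalerA.
  have gj : is_tgen I (e_ i) (e_ j) (a * c) 0 by apply: tgen_basis => //; rewrite opi_eqC.
  rewrite (t1 T) //; last exact: tg.
  case: (eqVneq j i) gj => [->|ij] gj.
    by rewrite (E_basis_i hI HG) // phiL ?(t6 T) // (idealMl hI).
  have ij1 : i.1 != j.1 by rewrite eq_sym plane_neqP.
  have eI := idealMl hI (eps R j) acI.
  rewrite (E_basis hI HG) // /short_of /phi kl_liftY ?neq_planeN //.
  rewrite /root_tau opi_inj_eq (negPf ij) opiK; congr (Tt _ _ _ _).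
  by rewrite mulrAC epsK mul1r.
have aa : form (a *: v) (a *: w) \in I by rewrite formZl (idealMr hI).
have bI' : b - form (a *: v) (a *: w) \in I by rewrite (idealD hI) ?(idealN hI).
rewrite scalerDr /E (E_split hI HG) //; try by apply: suppZl.
rewrite phiM Pv // Pw // (t2 T); try exact: tg.
by congr (Tt _ _ _ _); rewrite formZl formZr; ring.
Qed.

End TransvectionGroup.

(** * Transvections T(u, v a, b) in a group with the relations KL0-KL7 *)

Section Transvections.
Variables (R : comPzRingType) (l : nat) (I : {pred R}) (G : groupType).
Variables (act : StSp R l -> G -> G) (Y : idx l -> idx l -> R -> G).
Hypothesis hl : (3 <= l)%N.
Hypothesis hI : is_ideal I.
Hypothesis K : kl_data I act (@Xt R l) Y.
Implicit Types (i j : idx l) (a b c r : R) (u v w : vec R l) (x : StSp R l).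
Local Notation pi := (st_proj R l).
Local Notation e_ := (basis R).
Local Notation sX := (short_of (@Xt R l)).
Local Notation lX := (long_of (@Xt R l)).
Local Notation sY := (short_of Y).
Local Notation lY := (long_of Y).
Local Notation E := (heis sY lY).
Local Notation X := (heis sX lX).
Let HS := Xt_stdata R l.
Let HG := kl_stdata hI K.

Section Family.
Variable vt : vec R l -> R -> G.
Hypothesis vt_s : forall i j r u a, i.1 != j.1 -> a \in I ->
  act (sX i j r) (vt u a) = vt (transv (e_ i) (r *: e_ j) 0 u) a.
Hypothesis vt_l : forall i r u a, a \in I ->
  act (lX i r) (vt u a) = vt (transv (e_ i) 0 r u) a.
Hypothesis vt_basis : forall i t a, a \in I -> vt (t *: e_ i) a = lY i (a * t ^+ 2).
Hypothesis vt_add : forall i v a, v (opi i) = 0 -> a \in I ->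
  vt (e_ i + v) a = (lY i a * E i (a *: v) 0 * vt v a)%g.
Hypothesis vt_peiffer : forall u a, a \in I -> peiffer I sX lX act sY lY predT (vt u a).

Lemma vt_act x u a : a \in I -> act x (vt u a) = vt (pi x u) a.
Proof.
move=> aI; elim/pres_ind: x u => [|[i j r ij]|x y ex ey|x ex] u.
- by rewrite (kl_act1 K) gmulf1.
- rewrite -[pres_gen _ _]/(Xst i j r ij) st_projX -(XtE r ij) /tX.
  case: (eqVneq j (opi i)) ij => [->|ji] ij; first exact: vt_l.
  have ij1 : i.1 != (opi j).1 by apply: plane_neqP; rewrite ?opiK // opi_eqC.
  rewrite -vt_s // /short_of opiK; congr (act (Xt _ _ _) _).
  by rewrite mulrCA epsK mulr1.
- by rewrite (kl_actA K) ey ex gmulfM.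
by apply: (canLR (act_K HG x)); rewrite ex gmulfV sp_KV.
Qed.

(* T(u, a v, b), recovered from T(u + v, 0, a) = T(u, 0, a) T(u, a v, 0) T(v, 0, a) *)
Definition tvt u v a b : G := ((vt u a)^-1 * vt (u + v) a * (vt v a)^-1 * vt u b)%g.

Lemma tvt_act x u v a b : a \in I -> b \in I ->
  act x (tvt u v a b) = tvt (pi x u) (pi x v) a b.
Proof.
by move=> aI bI; rewrite /tvt !(kl_actM K) !(act_V HG) !vt_act // spD.
Qed.

Lemma vt_e i a : a \in I -> vt (e_ i) a = lY i a.
Proof. by move=> aI; rewrite -[e_ i]scale1r vt_basis // expr1n mulr1. Qed.

Lemma tvt_basis i v a b : v (opi i) = 0 -> a \in I -> b \in I ->
  tvt (e_ i) v a b = E i (a *: v) b.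
Proof.
move=> v0 aI bI; rewrite /tvt vt_add // !vt_e // !mulgA mulVg mul1g mulgK.
by rewrite (E_long hI HG i _ b).
Qed.

Lemma form_basis0 i v : form (e_ i) v = 0 -> v (opi i) = 0.
Proof.
rewrite form_basisl => h; transitivity (eps R i * (eps R i * v (opi i))).
  by rewrite mulrA epsK mul1r.
by rewrite h mulr0.
Qed.

(** The reduction to u = e_i by which the relations are verified. *)
Lemma column_split u v : is_column u -> form u v = 0 ->
  exists x i w, [/\ u = pi x (e_ i), v = pi x w & w (opi i) = 0].
Proof.
move=> /(column_orbit hl) [x [i ue]] uv; exists x, i, (pi x^-1%g v).
have vE : v = pi x (pi x^-1%g v) by rewrite gmulfV /= sp_KV.
by split=> //; apply: form_basis0; rewrite -(sp_form (pi x)) -vE -ue.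
Qed.

Lemma supp_axis i v a : v (opi i) = 0 -> a \in I -> supp I (predC1 (opi i)) (a *: v).
Proof.
move=> v0 aI j; rewrite vE (idealMr hI) //; split=> // /negPn/eqP ->.
by rewrite v0 mulr0.
Qed.

Lemma tvt_axis x i v a b : v (opi i) = 0 -> a \in I -> b \in I ->
  tvt (pi x (e_ i)) (pi x v) a b = act x (E i (a *: v) b).
Proof. by move=> v0 aI bI; rewrite -tvt_act // tvt_basis. Qed.

(** After moving u to e_i, the element is E_i(a v', b), linked with its counterpart in [StSp]; the
    Peiffer identity for [vt] turns conjugation into the action, that is, into the transvection on
    vectors. *)
Lemma tvt_conj u v a b w c : is_tgen I u v a b -> c \in I ->
  cj (tvt u v a b) (vt w c) = vt (transv u (a *: v) b w) c.
Proof.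
move=> [cu uv aI bI] cI; have [x [i [v' [-> -> v0]]]] := column_split cu uv.
have [w' ->] : exists w', w = pi x w' by exists (pi x^-1%g w); rewrite gmulfV sp_KV.
have hv := supp_axis v0 aI.
rewrite tvt_axis // -spZ -sp_transv -!vt_act // -st_proj_heis; last by rewrite vE v0 mulr0.
have lk : linked I sX lX sY lY predT (X i (a *: v') b) (E i (a *: v') b).
  exact: (linked_E hI HS HG).
rewrite -vt_act // (vt_peiffer _ cI lk) /cj.
by rewrite -(act_V HG) -!(kl_actM K).
Qed.

Lemma vt_column u a : is_column u -> a \in I -> tvt u 0 0 a = vt u a.
Proof.
move=> cu aI; have [x [i [v [-> e v0]]]] := column_split cu (form0r u).
rewrite e tvt_axis ?(ideal0 hI) // scale0r (E0 hI HG) -vt_e //.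
by rewrite vt_act.
Qed.

Lemma vt_commute u v a b : is_column u -> form u v = 0 -> a \in I -> b \in I ->
  commute (vt u a) (vt v b).
Proof.
move=> cu uv aI bI; apply/commuteP; rewrite -{1 2}(vt_column cu aI).
rewrite -/(cj _ _) tvt_conj ?transv_id ?scaler0 ?form0l //.
by split; rewrite ?form0r ?(ideal0 hI).
Qed.

Lemma vt_scale u a r : is_column u -> a \in I -> vt (r *: u) a = vt u (a * r ^+ 2).
Proof.
move=> /(column_orbit hl) [x [i ->]] aI; rewrite -spZ -!vt_act // ?(idealMr hI) //.
by rewrite vt_basis // vt_e // (idealMr hI).
Qed.

(** T1, T2, T3 and T6 are checked at u = e_i, where they are properties of E_i. T4, T5 and T7 follow
    from the definition of [tvt] by the family T(u, 0, a). *)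
Lemma tvt_relations : t_relations I tvt.
Proof.
have z0 := ideal0 hI; have tr c a : a \in I -> a * c \in I := @idealMr _ _ hI c a.
have T1 u v a b r : is_tgen I u v (a * r) b -> a \in I ->
    tvt u (r *: v) a b = tvt u v (a * r) b.
  move=> [cu uv aI bI] aI'; have [x [i [v' [-> -> v0]]]] := column_split cu uv.
  by rewrite -spZ !tvt_axis // ?vE ?v0 ?mulr0 // scalerA.
have vt0 u : is_column u -> vt u 0 = 1%g.
  move=> /(column_orbit hl) [x [i ->]].
  by rewrite -vt_act // vt_e // (lG0 hI HG) (act_1 HG).
(* For b = 0 the last factor is trivial, and the elements at u, v and u + v commute by
   [vt_commute]. *)
have T4 u v a : is_tgen I u v a 0 -> is_tgen I v u a 0 -> tvt u v a 0 = tvt v u a 0.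
  move=> [cu uv aI _] [cv vu _ _]; rewrite /tvt !vt0 // !mulg1 [v + u]addrC.
  have cuv := vt_commute cu uv aI aI.
  have cuw : commute (vt u a) (vt (u + v) a).
    by apply: vt_commute; rewrite // formDr form_alt uv addr0.
  have cvw : commute (vt v a) (vt (u + v) a).
    by apply: vt_commute; rewrite // formDr form_alt vu addr0.
  move: cuv cuw cvw; move: (vt u a) (vt v a) (vt (u + v) a) => U V W cuv cuw cvw.
  by rewrite (commuteVl cuw) (commuteVl cvw) -!mulgA -!invgM cuv.
split=> [u v a b r h1 h2|u v w a b c h1 h2|u v a b h1 h2|//|u' v' a' b' u v a b h1 h2 h3
  |u a h1|u v a r h1 h2 h3 h4].
- by case: h1 => _ _ aI _; exact: T1.
- have [cu uv aI bI] := h1; have [_ uw _ cI] := h2.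
  have [x [i [v' [ue ve v0]]]] := column_split cu uv.
  have [w' we] : exists w', w = pi x w' by exists (pi x^-1%g w); rewrite gmulfV sp_KV.
  have w0 : w' (opi i) = 0.
    by apply: form_basis0; rewrite -(sp_form (pi x)) -we -ue.
  have aaI : a ^+ 2 * form v' w' \in I by rewrite expr2 !tr.
  rewrite ue ve we sp_form -spD !tvt_axis ?(idealD hI) //; last by rewrite vE v0 w0 addr0.
  rewrite -(kl_actM K) (E_mul hI HG) //; try exact: supp_axis.
  by rewrite -scalerDr formZl formZr mulrA -expr2.
- have [cu uv aI _] := h1; have [_ _ bI _] := h2.
  have [x [i [v' [-> -> v0]]]] := column_split cu uv.
  rewrite !tvt_axis ?(idealD hI) // -(kl_actM K) (E_mul hI HG) //; try exact: supp_axis.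
  by rewrite -scalerDl formZl formZr form_alt !mulr0 !addr0.
(* Conjugation distributes over the four factors T(u, 0, a) and so on, each of which is handled by
   [tvt_conj]. *)
- have [_ _ aI bI] := h2; rewrite /tvt -transvD -!tvt_conj // /cj.
  by rewrite !conj_mul !conj_inv.
- have [cu _ aI _] := h1; have [x [i ->]] := column_orbit hl cu.
  have e0 : e_ i (opi i) = 0 by rewrite !vE opi_neq.
  rewrite -(sp0 (pi x)) !tvt_axis ?(e0, v0E) ?(idealMl hI) //.
  by rewrite scale0r (E_basis_i hI HG) // (E0 hI HG).
have [cuv _ _ aI] := h1; have [cu _ _ _] := h2; have [cv _ _ arI] := h3; have [_ vu arI' _] := h4.
have uv : form u v = 0 by rewrite formC vu oppr0.
have g1 : is_tgen I u v (a * r) 0 by [].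
(* By T4 and T1 the short factor becomes T(u, a (r v), 0), whose definition contains the wanted
   element at u + r v. *)
rewrite !vt_column // T4 // -T1 // /tvt vt0 // mulg1 vt_scale //.
have c1 := vt_commute cu uv aI arI.
have c2 : commute (vt v (a * r ^+ 2)) (vt (u + r *: v) a).
  by apply: vt_commute; rewrite // formDr formZr form_alt mulr0 addr0.
move: c1 c2; move: (vt u a) (vt v _) (vt _ a) => U V W c1 c2.
by rewrite c1 -!mulgA mulVKg mulgA c2 mulgK.
Qed.

End Family.

Theorem transvections_exist : exists tau : vec R l -> vec R l -> R -> R -> G,
  [/\ t_relations I tau,
      forall x u v a b, a \in I -> b \in I -> act x (tau u v a b) = tau (pi x u) (pi x v) a b
    & forall i v a b, v (opi i) = 0 -> a \in I -> b \in I -> tau (e_ i) v a b = E i (a *: v) b].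
Proof.
have [vt [vt_s vt_l vt_b vt_a vt_p]] := long_family hl hI HS HG.
exists (tvt vt); split.
- exact: tvt_relations.
- by move=> *; exact: tvt_act.
by move=> *; exact: tvt_basis.
Qed.

End Transvections.

Theorem theorem1 (R : comPzRingType) (I : {pred R})
    (hI : is_ideal I)
    (l : nat) (hl : (3 <= l)%N) :
  exists phi : {multiplicative StSp_rel l I -> Tgroup l I},
    [/\ bijective phi,
        forall (i j : idx l) (a : R) (ij : i != j) (aI : a \in I),
          j != opi i ->
          exists h : is_tgen I (basis R i) (basis R (opi j)) (a * eps R (opi j)) 0,
            phi (Yst i j a ij aI) =
            Tst (basis R i) (basis R (opi j)) (a * eps R (opi j)) 0 h
      & forall (i : idx l) (a : R) (ii : i != opi i) (aI : a \in I),
          exists h : is_tgen I (basis R i) 0 0 a,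
            phi (Yst i (opi i) a ii aI) = Tst (basis R i) 0 0 a h].
Proof.
have z0 := ideal0 hI; have K := Yt_kl l hI; have HG := kl_stdata hI K.
have [tau [T tau_act tau_e]] := transvections_exist hl hI K.
pose phi := kl_lift (Tt_kl l hI); pose psi := t_lift T.
have phiM y z : phi (y * z)%g = (phi y * phi z)%g by exact: gmulfM.
have phiV y : phi y^-1%g = (phi y)^-1%g by exact: gmulfV.
have psiM y z : psi (y * z)%g = (psi y * psi z)%g by exact: gmulfM.
have psiV y : psi y^-1%g = (psi y)^-1%g by exact: gmulfV.
(* At e_i the transvections in the relative group give back its own generators; this makes [psi] a
   left inverse of [phi]. *)
have tau_root i j a : i != j -> a \in I -> root_tau tau i j a = Yt I i j a.
  move=> ij aI; rewrite /root_tau; case: (eqVneq j (opi i)) => [->|ji].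
    by rewrite tau_e ?vE // scaler0 (E0 hI HG).
  have ij1 : i.1 != (opi j).1 by apply: plane_neqP; rewrite ?opiK // opi_eqC.
  have aeI := idealMr hI (eps R (opi j)) aI.
  rewrite tau_e //; last by rewrite !vE opi_inj_eq (negPf ij).
  by rewrite (E_basis hI HG) // /short_of opiK mulrCA epsK mulr1.
have phiK : cancel phi psi.
  elim/rel_presented_ind => [|x [i j a ij aI]|y z ey ez|y ey].
  - by rewrite /phi /psi !gmulf1.
  - rewrite -[rel_pres_gen _ _]/(Yst i j a ij aI) -(YtE ij aI).
    rewrite /phi kl_lift_act kl_liftY // -tau_root //.
    (* One and the same quadruple represents the root element in both groups. *)
    have e : exists u v c d, [/\ is_tgen I u v c d, root_tau (Tt I) i j a = Tt I u v c d
        & root_tau tau i j a = tau u v c d].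
      rewrite /root_tau; case: eqP => _.
        exists (basis R i), 0, 0, a; split=> //; apply: tgen_long => //; exact: column_basis.
      exists (basis R i), (basis R (opi j)), (a * eps R (opi j)), 0; split=> //.
      by apply: tgen_basis; rewrite ?opiK ?(idealMr hI).
    have [u [v [c [d [g -> ->]]]]] := e; have [_ _ cI dI] := g.
    by rewrite t_actT // /psi t_liftT ?tau_act //; exact: tgen_st_proj.
  - by rewrite phiM psiM ey ez.
  by rewrite phiV psiV ey.
have psiK : cancel psi phi.
  elim/Tt_ind => [|u v a b g|y z ey ez|y ey].
  - by rewrite /phi /psi !gmulf1.
  - rewrite /psi t_liftT //; have [cu uv aI bI] := g.
    (* By equivariance the generator may be moved to u = e_i, where [tau] is E_i(a v', b) and
       [Tt_heis] gives its image under [phi]. *)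
    have [x [i [v' [ue ve v0]]]] := column_split hl cu uv.
    rewrite ue ve -tau_act // tau_e // /phi kl_lift_act.
    have hv : supp predT (predC1 (opi i)) v' by move=> j; split=> // /negPn/eqP ->.
    rewrite Tt_heis // t_actT //; split=> //; first exact: column_basis.
    by rewrite form_basisl v0 mulr0.
  - by rewrite psiM phiM ey ez.
  by rewrite psiV phiV ey.
exists phi; split=> [|i j a ij aI ji|i a ii aI]; first by exists psi.
- have h : is_tgen I (basis R i) (basis R (opi j)) (a * eps R (opi j)) 0.
    by apply: tgen_basis; rewrite ?opiK ?(idealMr hI).
  by exists h; rewrite -(YtE ij aI) /phi kl_liftY // /root_tau (negPf ji) (TtE h).
have h : is_tgen I (basis R i) 0 0 a by apply: tgen_long => //; exact: column_basis.
by exists h; rewrite -(YtE ii aI) /phi kl_liftY // /root_tau eqxx (TtE h).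
Qed.
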